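(* Let $f$ be a piecewise smooth function with compact support satisfying the refinement equation $$ f(x)=\sum_{j=0}^N c_j f(\lambda x-d_j),\qquad \sum_{j=0}^N c_j=\lambda, $$ where $\lambda>1$, the $c_j$ are real numbers, and $d_0<d_1<\cdots<d_N$ are integers. Then $f(x)$ is a spline function. Hence, the following hold. (A) There exists an integer $l>0$ such that $\lambda^l\in\mathbf{Z}$. (B) Let $k$ be the smallest positive integer such that $\lambda^k\in\mathbf{Z}$. Then the compactly supported distribution solution $\phi(x)$ of the refinement equation $$ \phi(x)=\sum_{j=0}^N c_j\lambda^{k-1}\phi(\lambda^k x-d_j) $$ is a spline. (C) There exists a constant $\alpha$ such that the spline $f(x)$ is expressible as $$ f(x)=\alpha\,\phi(x)*\phi(\lambda^{-1}x)*\cdots*\phi(\lambda^{-(k-1)}x), $$ where $*$ denotes convolution and $\phi(x)$ is the spline given in (B).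
   Context: A compactly supported function $f$ on $\mathbf{R}$ is piecewise smooth if there exist an integer $M$ and real numbers $a_1<a_2<\cdots<a_M$ such that $f\in\mathbf{C}^\infty(a_j,a_{j+1})$ for $j=1,2,\dots,M-1$ and $\operatorname{supp} f\subset[a_1,a_M]$. A spline function $f(x)$ is a piecewise polynomial function: there are points $-\infty=x_0<x_1<\cdots<x_M<x_{M+1}=+\infty$ and polynomials $P_j(x)$ such that $f(x)=P_j(x)$ for $x\in[x_{j-1},x_j)$ for each $j=1,\dots,M+1$. ''The compactly supported distribution solution'' of a refinement equation refers to its compactly supported distribution solution, which is unique up to a scalar multiple.
   Formalization: f is assumed not almost everywhere zero (for f=0 statement (A) fails), and the refinement equation, ''f is a spline'' and (C) hold almost everywhere (pointwise, the indicator of (0,1] is refinable but not a spline for the half-open convention). *)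

(* Defs.v *)
From mathcomp Require Import all_boot all_order all_algebra.
From mathcomp Require Import all_classical all_reals all_analysis.
Set Implicit Arguments.
Unset Strict Implicit.
Unset Printing Implicit Defensive.
Import Order.TTheory GRing.Theory Num.Theory.
Import numFieldNormedType.Exports.
Local Open Scope classical_set_scope.
Local Open Scope ring_scope.

(* Functions on the line are identified when they agree almost everywhere;
   without this, the indicator of ]0, 1], which is pointwise refinable, would
   not be a spline for the half-open convention of [spline]. *)
Definition ae_eq_fun (R : realType) (f g : R -> R) : Prop :=
  {ae (@lebesgue_measure R), forall x : R, f x = g x}.

Definition fsupp (R : realType) (f : R -> R) : set R :=
  closure [set x | f x != 0].

Definition smooth_on (R : realType) (U : set R) (f : R -> R) : Prop :=
  forall (n : nat) (x : R), U x -> derivable (derive1n n f) x 1.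

(* Only a 1, ..., a M matter. The intervals are open: nothing is required of f
   at, or in the limit towards, the points a j. *)
Definition piecewise_smooth (R : realType) (f : R -> R) : Prop :=
  exists (M : nat) (a : nat -> R),
    [/\ (0 < M)%N,
        forall j, (1 <= j < M)%N -> a j < a j.+1,
        forall j, (1 <= j < M)%N -> smooth_on [set` `]a j, a j.+1[] f
      & fsupp f `<=` [set` `[a 1%N, a M]]].

(* Only x 0, ..., x M.+1 and P 0, ..., P M matter. *)
Definition spline (R : realType) (f : R -> R) : Prop :=
  exists (M : nat) (x : nat -> \bar R) (P : nat -> {poly R}),
    [/\ x 0%N = -oo%E,
        x M.+1 = +oo%E,
        forall j, (j <= M)%N -> (x j < x j.+1)%E
      & forall (j : nat) (t : R), (j <= M)%N ->
          (x j <= t%:E)%E -> (t%:E < x j.+1)%E -> f t = (P j).[t]].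

Definition fun_refinable (R : realType) (N : nat) (lam : R)
    (c : 'I_N.+1 -> R) (d : 'I_N.+1 -> int) (f : R -> R) : Prop :=
  ae_eq_fun f (fun x => \sum_(j < N.+1) c j * f (lam * x - (d j)%:~R)).

Definition test_function (R : realType) (g : R -> R) : Prop :=
  smooth_on setT g /\ compact (fsupp g).

(* The values of T outside the test functions are irrelevant. *)
Definition distribution_on_line (R : realType) (T : (R -> R) -> R) : Prop :=
  (forall (a : R) (g h : R -> R), test_function g -> test_function h ->
     T (fun x => a * g x + h x) = a * T g + T h) /\
  (forall K : set R, compact K ->
     exists (C : R) (m : nat), forall (g : R -> R) (B : R),
       test_function g -> fsupp g `<=` K ->
       (forall (n : nat) (x : R), (n <= m)%N -> `|derive1n n g x| <= B) ->
       `|T g| <= C * B).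

Definition compactly_supported_distribution (R : realType)
    (T : (R -> R) -> R) : Prop :=
  distribution_on_line T /\
  exists2 K : set R, compact K &
    forall g, test_function g -> fsupp g `&` K = set0 -> T g = 0.

Definition nonzero_distribution (R : realType) (T : (R -> R) -> R) : Prop :=
  exists2 g, test_function g & T g != 0.

(* The distribution T (mu x - b), for mu > 0, defined by duality. *)
Definition dist_dilate (R : realType) (mu b : R) (T : (R -> R) -> R)
    : (R -> R) -> R :=
  fun g => mu^-1 * T (fun y => g ((y + b) / mu)).

Definition dist_refinable (R : realType) (N : nat) (mu : R)
    (c : 'I_N.+1 -> R) (d : 'I_N.+1 -> int) (T : (R -> R) -> R) : Prop :=
  forall g, test_function g ->
    T g = \sum_(j < N.+1) c j * dist_dilate mu (d j)%:~R T g.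

Definition is_dist_of_fun (R : realType) (s : R -> R) (T : (R -> R) -> R)
    : Prop :=
  forall g, test_function g ->
    T g = \int[(@lebesgue_measure R)]_x (s x * g x).

Definition spline_distribution (R : realType) (T : (R -> R) -> R) : Prop :=
  exists2 s, spline s & is_dist_of_fun s T.

Definition convolution (R : realType) (u v : R -> R) : R -> R :=
  fun x => \int[(@lebesgue_measure R)]_t (u t * v (x - t)).

(* phi(x) * phi(lam^-1 x) * ... * phi(lam^-n x), which has n + 1 factors. *)
Fixpoint conv_dilates (R : realType) (lam : R) (phi : R -> R) (n : nat)
    : R -> R :=
  if n is n'.+1 then
    convolution (conv_dilates lam phi n') (fun x => phi (lam ^- n * x))
  else phi.

(* Main.v *)
Require Import Defs.
From mathcomp Require Import all_boot all_order all_algebra.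
From mathcomp Require Import all_classical all_reals all_analysis.
From mathcomp Require Import all_field.
From mathcomp Require Import ring lra zify.
Import Order.TTheory GRing.Theory Num.Theory.
Import numFieldNormedType.Exports.
Local Open Scope classical_set_scope.
Local Open Scope ring_scope.
Set Implicit Arguments.
Unset Strict Implicit.

(* Everything happens in the time domain.  Put the left end of the support of f
   at 0, so that f(t) = c_0 f(lam t) just to the right of 0; hence f is there a
   function G with G(lam t) = G(t) / c_0, extended homogeneously to t > 0 and by
   0 to t <= 0.  Modulo germs of smooth functions, the refinement equation
   propagates singularities to the right, so the singularity of f at each b is
   q(b) times that of G at 0.  Since G is not smooth at 0 (a flat function
   cannot be homogeneous), q(b) vanishes off the finitely many break points, and
   f = sum_a q(a) G(. - a), because a solution vanishing near the left end is 0.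
   For large x this sum is 0; by homogeneity sum_a q(a) G(y - h a) vanishes at
   h = lam^-n, so Rolle's theorem gives M_i G^(i)(y) = 0 for all the moments
   M_i of q, one of which is not 0.  Hence G is a monomial t^r, c_0 = lam^-r, and
   f is a spline.

   Write P(z) = sum_a q(a) z^a and C(z) = sum_j (c_j / c_0) z^(d_j - d_0), so that
   P(z^lam) = C(z) P(z).  For (A): C divides P(z^(lam^n)), whence every exponent
   of P(z^(lam^n)) is congruent modulo 1 to another one; as there are finitely
   many exponents, some power of lam is rational with bounded denominators of its
   powers, that is, an integer.  For (B): 1, lam, ..., lam^(k-1) are independent
   over the rationals and the exponents of P lie in the semigroup that they
   generate, so the integer part P_1 of P satisfies P_1(z^(lam^k)) = C(z) P_1(z);
   it is the comb of the spline phi.  Uniqueness of the distribution solution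
   follows by iterating the transposed operator on test functions: its iterates
   become constant on compact sets, with all derivatives.  For (C): the
   convolution satisfies the same refinement equation as f, and both are
   multiples of a truncated power near the left end. *)

(** * Functions differentiable n times near a point *)

(** The equation holds only almost everywhere and nothing is known of [f] at its break points nor of
    its limits there, so solutions are compared on punctured neighbourhoods; a finite exceptional
    list turns germs back into almost everywhere equality. The engine is the equation solved for its
    leading term, [c0 U(y) = U(y / lam) - sum_i c_i U(y - d_i)]: beyond a positive point all
    arguments of the right-hand side lie a fixed distance to the left of [y], so data on a left
    half-line determine the solution. The first coefficients may vanish, whence the mask is cut at
    its first nonzero index [j0], and the origin is moved to the fixed point of [x -> lam x - d_j0].
    The degree of [phi] comes from its comb: if [m] is the order of the first nonzero moment,
    testing the identity for [P_1] on [x^m] gives [c_0 lam^(k m) = lam], that is, [k m = r + 1]. The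
    [m] vanishing moments make truncated powers of degree [m - 1] add up to a compactly supported
    function, and [k] factors of degree [m - 1] convolve to degree [k m - 1 = r]. *)

Fixpoint ndiff_near (R : realType) (n : nat) (f : R -> R) (x : R) : Prop :=
  if n is m.+1 then
    exists2 g : R -> R, (\forall y \near x, is_derive (y : R) 1 f (g y)) & ndiff_near m g x
  else True.

Lemma is_derive_affine (R : realType) (f : R -> R) (a b y df : R) :
  is_derive (a * y + b) 1 f df ->
  is_derive y 1 (fun z => f (a * z + b)) (a * df).
Proof.
move=> fd.
have h : is_derive y 1 (fun z : R => a * z + b) a.
  have -> : (fun z : R => a * z + b) = (a \*: (@idfun R)) + cst b.
    by apply/funext.
  by apply: is_derive_eq; rewrite /GRing.scale/=; ring.
by rewrite mulrC; exact: (@is_derive1_comp _ f (fun z : R => a * z + b) y df a fd h).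
Qed.

Lemma affine_cvg (R : realType) (a b x : R) :
  (fun y : R => a * y + b) @ x --> (a * x + b).
Proof. by apply: cvgD; [apply: cvgMr; apply: cvg_id|apply: cvg_cst]. Qed.

Lemma near_affine (R : realType) (a b x : R) (P : R -> Prop) :
  (\forall y \near (a * x + b), P y) -> \forall y \near x, P (a * y + b).
Proof. exact: affine_cvg. Qed.

Lemma near_affine_dnbhs (R : realType) (a b x : R) (P : R -> Prop) : a != 0 ->
  (\forall y \near (a * x + b)^', P y) -> \forall y \near x^', P (a * y + b).
Proof.
move=> a0; rewrite !near_withinE => /near_affine; apply: filterS => y + yx.
by apply; apply: contra yx => /eqP/addIr/(mulfI a0)->.
Qed.

Lemma ndiff_near_le (R : realType) (n m : nat) (f : R -> R) x : (m <= n)%N ->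
  ndiff_near n f x -> ndiff_near m f x.
Proof.
elim: n m f => [|n IH] [|m] f //= mn [g fg gn].
by exists g => //; apply: IH.
Qed.

Lemma ndiff_near_eq (R : realType) n (f g : R -> R) x :
  (\forall y \near x, f y = g y) -> ndiff_near n f x -> ndiff_near n g x.
Proof.
case: n => //= n fg [f1 ff1 f1n]; exists f1 => //.
have := near_join fg; move: ff1; apply: filterS2 => y ff1 fgy.
exact: near_eq_is_derive ff1.
Qed.

Lemma ndiff_near_cst (R : realType) n (a x : R) : ndiff_near n (cst a) x.
Proof. by elim: n a => //= n IH a; exists (cst 0) => //; near do exact: is_derive_cst.
Unshelve. all: end_near. Qed.

Lemma ndiff_nearD (R : realType) n (f g : R -> R) x :
  ndiff_near n f x -> ndiff_near n g x ->
  ndiff_near n (fun y => f y + g y) x.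
Proof.
elim: n f g => //= n IH f g [f1 df fn] [g1 dg gn].
exists (fun y => f1 y + g1 y); last exact: IH.
by move: df dg; apply: filterS2 => y df dg; exact: is_deriveD.
Qed.

Lemma ndiff_nearM (R : realType) n (f g : R -> R) x :
  ndiff_near n f x -> ndiff_near n g x ->
  ndiff_near n (fun y => f y * g y) x.
Proof.
elim: n f g => //= n IH f g [f1 df fn] [g1 dg gn].
exists (fun y => f1 y * g y + f y * g1 y).
  move: df dg; apply: filterS2 => y df dg.
  have := @is_deriveM _ _ f g y 1 _ _ df dg.
  by move=> h; apply: (is_derive_eq h); rewrite /GRing.scale/= addrC [g y * _]mulrC.
by apply: ndiff_nearD; apply: IH => //; apply: (@ndiff_near_le _ n.+1 n) => //=;
  [exists g1|exists f1].
Qed.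

Lemma ndiff_nearZ (R : realType) n (a : R) (f : R -> R) x :
  ndiff_near n f x -> ndiff_near n (fun y => a * f y) x.
Proof. by apply: ndiff_nearM; exact: ndiff_near_cst. Qed.

Lemma ndiff_near_sum (R : realType) n (I : Type) (s : seq I) (P : pred I)
    (f : I -> R -> R) x :
  (forall i, ndiff_near n (f i) x) ->
  ndiff_near n (fun y => \sum_(i <- s | P i) f i y) x.
Proof.
move=> fn; elim: s => [|i s IH].
  by rewrite (_ : (fun _ => _) = cst 0); [exact: ndiff_near_cst|
    apply/funext => y; rewrite big_nil].
case: (boolP (P i)) => Pi.
  rewrite (_ : (fun _ => _) =
    fun y => f i y + \sum_(j <- s | P j) f j y); first exact: ndiff_nearD.
  by apply/funext => y; rewrite big_cons Pi.
rewrite (_ : (fun _ => _) = fun y => \sum_(j <- s | P j) f j y) //.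
by apply/funext => y; rewrite big_cons (negbTE Pi).
Qed.

Lemma ndiff_near_affine (R : realType) n (f : R -> R) (a b x : R) :
  ndiff_near n f (a * x + b) -> ndiff_near n (fun y => f (a * y + b)) x.
Proof.
elim: n f => //= n IH f [g df gn].
exists (fun y => a * g (a * y + b)); last by apply: ndiff_nearZ; exact: IH.
by have := near_affine df; apply: filterS => y; exact: is_derive_affine.
Qed.

Lemma ndiff_nearV (R : realType) n (f : R -> R) x :
  (forall y, f y != 0) ->
  ndiff_near n f x -> ndiff_near n (fun y => (f y)^-1) x.
Proof.
move=> f0; elim: n => //= n IH [f1 df fn].
exists (fun y => -1 * ((f y)^-1 * (f y)^-1 * f1 y)).
  move: df; apply: filterS => y df.
  have := is_deriveV (f0 y) df.
  by move=> h; apply: (is_derive_eq h); rewrite /GRing.scale/= expr2 invfM; ring.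
have fn' : ndiff_near n (fun y => (f y)^-1) x.
  by apply: IH; apply: (@ndiff_near_le _ n.+1 n) => //=; exists f1.
by apply: ndiff_nearZ; apply: ndiff_nearM => //; apply: ndiff_nearM.
Qed.

(** The derivatives enter [ndiff_near] as witnesses, which makes it stable under algebra and under
    equality near a point; this lemma and the next two link it to the derivatives used in the
    theorem. *)
Lemma ndiff_near_derivable (R : realType) n (f : R -> R) x :
  ndiff_near n.+1 f x -> derivable (derive1n n f) x 1.
Proof.
elim: n f => [|n IH] f [g df gn].
  by have := nbhs_singleton df; case.
rewrite derive1Sn; apply: IH.
apply: (@ndiff_near_eq _ n.+1 g) gn; move: df; apply: filterS => y df.
by rewrite derive1E; apply/esym; case: df.
Qed.

Lemma smooth_ndiff_near (R : realType) (U : set R) n (f : R -> R) x :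
  open U -> smooth_on U f -> U x -> ndiff_near n f x.
Proof.
move=> oU; elim: n f => //= n IH f fU Ux.
have fD y : U y -> is_derive y 1 f (f^`()%classic y).
  by move=> Uy; rewrite derive1E; apply: derivableP; exact: (fU 0%N).
exists f^`()%classic.
  by have := open_nbhs_nbhs (conj oU Ux); apply: filterS => y /fD.
apply: IH => // m y Uy; rewrite -derive1Sn; exact: fU.
Qed.

Lemma smooth_onTP (R : realType) (f : R -> R) :
  smooth_on setT f <-> forall n x, ndiff_near n f x.
Proof.
split=> [fs n x|fs n x _].
  by apply: (@smooth_ndiff_near _ setT) => //; exact: openT.
exact/ndiff_near_derivable.
Qed.

Lemma ndiff_near_cont (R : realType) n (f : R -> R) x :
  ndiff_near n.+1 f x -> {for x, continuous f}.
Proof.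
case=> g /nbhs_singleton df _; apply: differentiable_continuous.
by apply/derivable1_diffP; case: df.
Qed.

(** * Punctured germs and flat functions *)

Definition germ0 (R : realType) (h : R -> R) (x : R) : Prop :=
  \forall y \near x^', h y = 0.

(** The neighbourhood where [g] is [n] times differentiable may shrink as [n] grows; only finite
    orders at [x] are ever used. *)
Definition regular (R : realType) (h : R -> R) (x : R) : Prop :=
  exists2 g : R -> R, (forall n, ndiff_near n g x) &
    \forall y \near x^', h y = g y.

Lemma near_shift_dnbhs (R : realType) (b : R) (P : R -> Prop) :
  (\forall y \near b^', P y) -> \forall t \near (0 : R)^', P (b + t).
Proof.
move=> h; have := @near_affine_dnbhs R 1 b 0 P (oner_neq0 _).
by rewrite mulr0 add0r => /(_ h); apply: filterS => t; rewrite mul1r addrC.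
Qed.

Lemma near_dnbhs0P (R : realType) (P : R -> Prop) :
  (\forall t \near (0 : R)^', P t) <->
  exists2 e : R, 0 < e & forall t, t != 0 -> `|t| < e -> P t.
Proof.
rewrite near_withinE; split=> [/nbhs_ballP[e/= e0 h]|[e e0 h]].
  by exists e => // t t0 te; apply: h => //; rewrite /ball/= sub0r normrN.
apply/nbhs_ballP; exists e => // t; rewrite /ball/= sub0r normrN => te t0.
exact: h.
Qed.

Lemma near0P (R : realType) (P : R -> Prop) :
  (\forall t \near (0 : R), P t) <->
  exists2 e : R, 0 < e & forall t, `|t| < e -> P t.
Proof.
split=> [/nbhs_ballP[e/= e0 h]|[e e0 h]].
  by exists e => // t te; apply: h => //; rewrite /ball/= sub0r normrN.
apply/nbhs_ballP; exists e => // t; rewrite /ball/= sub0r normrN => te.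
exact: h.
Qed.

Lemma germ0_cont (R : realType) (h : R -> R) (x : R) :
  {for x, continuous h} -> germ0 h x -> h x = 0.
Proof.
move=> hc h0; have hx : h y @[y --> x^'] --> h x.
  by apply: cvg_trans hc; apply: cvg_app; exact: nbhs_dnbhs.
have h0' : h y @[y --> x^'] --> (0 : R).
  have := @near_eq_cvg _ _ x^' _ (cst 0) h.
  move=> /(_ _ )H; apply: cvg_trans (H _) (cvg_cst _).
  by move: h0; apply: filterS => y ->.
by have := cvg_unique _ hx h0'; apply; exact: norm_hausdorff.
Qed.

Lemma regularD (R : realType) (f g : R -> R) x :
  regular f x -> regular g x -> regular (fun y => f y + g y) x.
Proof.
move=> [f1 sf ff1] [g1 sg gg1]; exists (fun y => f1 y + g1 y).
  by move=> n; exact: ndiff_nearD.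
by move: ff1 gg1; apply: filterS2 => y -> ->.
Qed.

Lemma regularZ (R : realType) a (f : R -> R) x :
  regular f x -> regular (fun y => a * f y) x.
Proof.
move=> [f1 sf ff1]; exists (fun y => a * f1 y).
  by move=> n; exact: ndiff_nearZ.
by move: ff1; apply: filterS => y ->.
Qed.

Lemma regular0 (R : realType) (f : R -> R) x : germ0 f x -> regular f x.
Proof. by exists (cst 0) => // n; exact: ndiff_near_cst. Qed.

Lemma regular_sum (R : realType) (I : Type) (s : seq I) (f : I -> R -> R) x :
  (forall i, regular (f i) x) ->
  regular (fun y => \sum_(i <- s) f i y) x.
Proof.
move=> fr; elim: s => [|i s IH].
  by apply: regular0; apply: nearW => y; rewrite big_nil.
rewrite (_ : (fun _ => _) = fun y => f i y + \sum_(j <- s) f j y).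
  exact: regularD.
by apply/funext => y; rewrite big_cons.
Qed.

Lemma regular_scale (R : realType) a (f : R -> R) : a != 0 ->
  regular f 0 -> regular (fun y => f (a * y)) 0.
Proof.
move=> a0 [g sg fg]; exists (fun y => g (a * y + 0)).
  by move=> n; apply: ndiff_near_affine; rewrite mulr0 addr0.
have := @near_affine_dnbhs R a 0 0 _ a0.
by rewrite mulr0 addr0 => /(_ _ fg); apply: filterS => y; rewrite addr0.
Qed.

Lemma regular_eq (R : realType) (f g : R -> R) x :
  (\forall y \near x^', f y = g y) -> regular f x -> regular g x.
Proof.
move=> fg [h sh fh]; exists h => //; move: fg fh.
by apply: filterS2 => y -> ->.
Qed.

Lemma exprn_unbounded (R : realType) (lam B : R) : 1 < lam ->
  exists n, B < lam ^+ n.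
Proof.
move=> lam1; have l0 : 0 < lam - 1 by rewrite subr_gt0.
have [n Bn] : exists n : nat, B / (lam - 1) < n%:R.
  by exists (Num.truncn (B / (lam - 1))).+1; exact: truncnS_gt.
exists n; move: Bn; rewrite ltr_pdivrMr // => Bn.
have : 1 + n%:R * (lam - 1) <= lam ^+ n.
  elim: (n) => [|m IH]; first by rewrite mul0r addr0 expr0.
  rewrite exprS -natr1; have m0 : 0 <= m%:R :> R by [].
  have lam0 : 0 <= lam by lra.
  have := ler_wpM2l lam0 IH; have : 0 <= m%:R * (lam - 1) ^+ 2.
    by rewrite mulr_ge0 // sqr_ge0.
  lra.
lra.
Qed.

(** For [y >= tau] both [y / lam] and [y - 1] lie at least [e = min ((1 - 1/lam) tau, 1)] to the
    left of [y], so [P] extends from a half-line by steps of length [e]. *)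
Lemma refinement_ind (R : realType) (lam tau : R) (P : R -> Prop) :
  1 < lam -> 0 < tau -> (forall x, x < tau -> P x) ->
  (forall y, 0 < y -> P (y / lam) -> (forall x, x <= y - 1 -> P x) -> P y) ->
  forall y, P y.
Proof.
move=> lam1 tau0 P0 PS y.
have lam0 : 0 < lam by lra.
pose e := Num.min ((1 - lam^-1) * tau) 1.
have li : 0 < 1 - lam^-1 by rewrite subr_gt0 invf_lt1.
have e0 : 0 < e by rewrite lt_min ltr01 mulr_gt0.
have e1 : e <= 1 by rewrite ge_min lexx orbT.
have e2 : e <= (1 - lam^-1) * tau by rewrite ge_min lexx.
have H n : forall x, x < tau + n%:R * e -> P x.
  elim: n => [|n IH] x; first by rewrite mul0r addr0; exact: P0.
  rewrite -natr1 mulrDl mul1r addrA => xe.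
  have [xt|tx] := ltP x tau; first exact: P0.
  apply: PS; [lra| |].
    apply: IH; have : x / lam <= x - e; last by lra.
    have : (1 - lam^-1) * tau <= (1 - lam^-1) * x by rewrite ler_pM2l.
    lra.
  by move=> z zx; apply: IH; lra.
have [n yn] : exists n : nat, (y - tau) / e < n%:R.
  by exists (Num.truncn ((y - tau) / e)).+1; exact: truncnS_gt.
by apply: (H n); move: yn; rewrite ltr_pdivrMr //; lra.
Qed.

(** The vanishing on the left forces the derivatives at 0 to vanish by continuity; the mean value
    theorem then gains one power of [y] per order. *)
Lemma flat_bound (R : realType) n (g : R -> R) :
  ndiff_near n.+1 g 0 -> (\forall y \near (0 : R), y < 0 -> g y = 0) ->
  exists B : R, \forall y \near (0 : R), 0 < y -> `|g y| <= B * y ^+ n.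
Proof.
elim: n g => [|n IH] g gn g0.
  have gc := ndiff_near_cont gn.
  exists (`|g 0| + 1); have : \forall y \near (0 : R), `|g 0 - g y| < 1.
    by move: gc => /cvgrPdist_lt /(_ 1 ltr01).
  apply: filterS => y gy _; rewrite expr0 mulr1.
  have := ler_normB (g 0) (g 0 - g y); rewrite subKr; lra.
have gc := ndiff_near_cont gn.
have g00 : g 0 = 0.
  apply/eqP/negPn/negP => g00.
  have g00' : 0 < `|g 0| by rewrite normr_gt0.
  move: gc => /cvgrPdist_lt /(_ _ g00') /near0P[e e0 he].
  move/near0P : g0 => [e' e'0 he'].
  pose m := - (Num.min e e' / 2).
  have m0 : 0 < Num.min e e' by rewrite lt_min e0.
  have [me me'] : Num.min e e' <= e /\ Num.min e e' <= e'.
    by rewrite !ge_min !lexx orbT.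
  have nm : `|m| = Num.min e e' / 2 by rewrite normrN ger0_norm //; lra.
  have mlt : m < 0 by rewrite /m; lra.
  have h1 : `|m| < e by rewrite nm; lra.
  have h2 : `|m| < e' by rewrite nm; lra.
  by have := he m h1; rewrite (he' m h2 mlt) subr0 ltxx.
case: gn => g1 dg g1n.
have g10 : \forall y \near (0 : R), y < 0 -> g1 y = 0.
  move: dg (near_join g0); apply: filterS2 => y dg gy y0.
  have gy0 : \forall z \near y, g z = cst 0 z.
    by move: (lt_nbhsl y0) gy; apply: filterS2 => z z0 gz; rewrite gz.
  have := near_eq_is_derive gy0 dg => -[_ <-].
  by rewrite derive_cst.
have [B hB] := IH g1 g1n g10; exists B.
move/near0P : hB => [e e0 he]; move/near0P : dg => [e' e'0 dg].
have m0 : 0 < Num.min e e' by rewrite lt_min e0.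
apply/near0P; exists (Num.min e e') => // y.
rewrite lt_min => /andP[ye ye'] y0.
have [yy] : `|y| = y by rewrite gtr0_norm.
have cnt x : `|x| < e' -> {for x, continuous g}.
  move=> xe; apply: differentiable_continuous.
  by apply/derivable1_diffP; case: (dg _ xe).
have xy x : x \in `[0, y] -> `|x| <= y.
  by rewrite in_itv /= => /andP[x0 xy]; rewrite ger0_norm.
have [||c cy] := @MVT R g g1 0 y y0.
- move=> x xy'; apply: dg; apply: le_lt_trans ye'; rewrite yy; apply: xy.
  exact: subset_itv_oo_cc xy'.
- apply: continuous_in_subspaceT => x /set_mem xy'; apply: cnt.
  by apply: le_lt_trans ye'; rewrite yy; exact: xy.
rewrite g00 !subr0 => ->; move: cy; rewrite in_itv /= => /andP[c0 cy].
have nc : `|c| = c by rewrite gtr0_norm.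
have ce : `|c| < e by rewrite nc (lt_trans cy) // -yy.
have := he c ce c0 => hc.
have B0 : 0 <= B.
  have := le_trans (normr_ge0 _) hc; rewrite pmulr_lge0 //.
  exact: exprn_gt0.
rewrite normrM yy exprSr mulrA ler_pM2r //; apply: le_trans hc _.
apply: ler_wpM2l => //; apply: lerXn2r; rewrite ?nnegrE; lra.
Qed.

(** Homogeneity gives [f (y / lam ^+ k) = c0 ^+ k * f y], while flatness bounds the left side by
    [B * y ^+ n / lam ^+ (n * k)]. Choosing [n] with [|c0| * lam ^+ n > 1] and letting [k] grow
    forces [f y = 0]. *)
Lemma homogeneous_regular_germ0 (R : realType) (lam c0 : R) (f : R -> R) :
  1 < lam -> c0 != 0 ->
  (\forall y \near (0 : R)^', y < 0 -> f y = 0) ->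
  (\forall y \near (0 : R)^', 0 < y -> f y = c0 * f (lam * y)) ->
  regular f 0 -> germ0 f 0.
Proof.
move=> lam1 c00 f0 fh [g sg fg].
have lam0 : 0 < lam by lra.
have g0 : \forall y \near (0 : R), y < 0 -> g y = 0.
  have : \forall y \near (0 : R)^', y < 0 -> g y = 0.
    by move: fg f0; apply: filterS2 => y ->.
  rewrite near_withinE; apply: filterS => y + y0; apply => //.
  by rewrite lt_eqF.
have nc0 : 0 < `|c0| by rewrite normr_gt0.
have [n cn] := exprn_unbounded `|c0|^-1 lam1.
have M1 : 1 < `|c0| * lam ^+ n.
  by rewrite mulrC -ltr_pdivrMr // div1r.
have [B hB] := flat_bound (sg n.+1) g0.
have {}hB : \forall y \near (0 : R)^', 0 < y -> `|g y| <= B * y ^+ n.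
  exact: nbhs_dnbhs.
have /near_dnbhs0P[e e0 he] : \forall y \near (0 : R)^', [/\ f y = g y,
    (y < 0 -> f y = 0), (0 < y -> f y = c0 * f (lam * y)) &
    (0 < y -> `|g y| <= B * y ^+ n)].
  by near=> y; split; near: y.
apply/near_dnbhs0P; exists e => // y yn0 ye.
have [_ fn _ _] := he y yn0 ye.
move: yn0; rewrite neq_lt => /orP[/fn//|y0].
have yk k : [/\ 0 < y / lam ^+ k, y / lam ^+ k != 0 & `|y / lam ^+ k| < e].
  have p : 0 < y / lam ^+ k by rewrite divr_gt0 ?exprn_gt0.
  rewrite gtr0_norm // p gt_eqF //; split=> //; apply: le_lt_trans ye.
  rewrite gtr0_norm // ler_pdivrMr ?exprn_gt0 // ler_peMr //; first exact: ltW.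
  by rewrite exprn_ege1 // ltW.
have fk k : f (y / lam ^+ k) = c0 ^+ k * f y.
  elim: k => [|k IH]; first by rewrite !expr0 divr1 mul1r.
  have [p n0 l] := yk k.+1; have [_ _ -> // _] := he _ n0 l.
  rewrite [c0 ^+ _]exprS -mulrA -IH; congr (_ * f _).
  by rewrite exprS; field; rewrite !gt_eqF ?exprn_gt0.
have bound k : (`|c0| * lam ^+ n) ^+ k * `|f y| <= B * y ^+ n.
  have [p n0 l] := yk k; have [fgk _ _ /(_ p)] := he _ n0 l.
  rewrite -fgk fk normrM normrX expr_div_n -exprM mulnC exprM mulrA.
  rewrite ler_pdivlMr ?exprn_gt0 // => h; rewrite exprMn.
  by apply: le_trans h; rewrite le_eqVlt; apply/orP; left; apply/eqP; ring.
apply/eqP/negPn/negP => fy; have fy0 : 0 < `|f y| by rewrite normr_gt0.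
have [k hk] := exprn_unbounded (B * y ^+ n / `|f y|) M1.
by move: hk; rewrite ltr_pdivrMr // ltNge bound.
Unshelve. all: end_near. Qed.

(** * Solutions of the refinement equation near the left end of the support *)

(** The equation after the translation that makes the first shift 0. That term is singled out
    because the equation will be solved for it; all other shifts [dl] are positive. *)
Definition germ_refinable (R : realType) (I : finType) (lam c0 : R)
    (c : I -> R) (dl : I -> nat) (U : R -> R) : Prop :=
  forall x, \forall y \near x^',
    U y = c0 * U (lam * y) + \sum_i c i * U (lam * y - (dl i)%:R).

Lemma near_sub_dnbhs (R : realType) (b d : R) (P : R -> Prop) :
  (\forall y \near (b - d)^', P y) -> \forall y \near b^', P (y - d).
Proof.
move=> h; have := @near_affine_dnbhs R 1 (- d) b P (oner_neq0 _).
by rewrite mul1r => /(_ h); apply: filterS => t; rewrite mul1r.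
Qed.

Lemma near_scale_dnbhs (R : realType) (b a : R) (P : R -> Prop) : a != 0 ->
  (\forall y \near (a * b)^', P y) -> \forall y \near b^', P (a * y).
Proof.
move=> a0 h; have := @near_affine_dnbhs R a 0 b P a0.
by rewrite addr0 => /(_ h); apply: filterS => t; rewrite addr0.
Qed.

Lemma filter_forall_fin (T : Type) (F : set_system T) (I : finType)
    (P : I -> T -> Prop) : Filter F ->
  (forall i, \forall y \near F, P i y) -> \forall y \near F, forall i, P i y.
Proof.
move=> FF h; have H (s : seq I) : \forall y \near F, forall i, i \in s -> P i y.
  elim: s => [|i s IH]; first exact: nearW.
  move: (h i) IH; apply: filterS2 => y Pi Ps j.
  by rewrite inE => /orP[/eqP->|/Ps].
by have := H (enum I); apply: filterS => y Py i; apply: Py; rewrite mem_enum.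
Qed.

Section Uniqueness.
Variables (R : realType) (I : finType) (lam c0 : R) (c : I -> R) (dl : I -> nat).
Hypotheses (lam_gt1 : 1 < lam) (c0_neq0 : c0 != 0) (dl_gt0 : forall i, (0 < dl i)%N).
Local Notation refi := (germ_refinable lam c0 c dl).

Let lam_gt0 : 0 < lam. Proof. exact: lt_trans lam_gt1. Qed.
Let lam_neq0 : lam != 0. Proof. by rewrite gt_eqF. Qed.

(** The equation at [y / lam], solved for the leading term: values at [y] come from points to the
    left of [y]. *)
Lemma germ_refinable_forward (U : R -> R) b : refi U ->
  \forall y \near b^',
    c0 * U y = U (y / lam) - \sum_i c i * U (y - (dl i)%:R).
Proof.
move=> Ur; have li : lam^-1 != 0 by rewrite invr_eq0.
have := @near_scale_dnbhs R b lam^-1 _ li (Ur (lam^-1 * b)).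
apply: filterS => y; rewrite mulVKf // [lam^-1 * y]mulrC => ->.
by rewrite addrK.
Qed.

Lemma germ0_forward (U : R -> R) b : refi U ->
  germ0 U (b / lam) -> (forall i, germ0 U (b - (dl i)%:R)) -> germ0 U b.
Proof.
move=> Ur Ub Ui; have li : lam^-1 != 0 by rewrite invr_eq0.
rewrite mulrC in Ub.
have H1 : \forall y \near b^', U (y / lam) = 0.
  by move: (near_scale_dnbhs li Ub); apply: filterS => y; rewrite mulrC.
have H2 : \forall y \near b^', forall i, U (y - (dl i)%:R) = 0.
  by apply: filter_forall_fin => i; exact: near_sub_dnbhs (Ui i).
have H3 := germ_refinable_forward b Ur.
near=> y; apply: (mulfI c0_neq0); rewrite mulr0 (near H3 y) // (near H1 y) //.
rewrite sub0r big1 ?oppr0 // => i _.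
by have := near H2 y; move=> -> //; rewrite mulr0.
Unshelve. all: end_near. Qed.

(** Every identification of two solutions, with the singular part or with the convolution, is this
    lemma applied to their difference. *)
Lemma germ_refinable_eq0 (U : R -> R) tau : 0 < tau -> refi U ->
  (forall x, x < tau -> germ0 U x) -> forall x, germ0 U x.
Proof.
move=> tau0 Ur U0; apply: (@refinement_ind R lam tau) => // y y0 P1 P2.
by apply: germ0_forward => // i; apply: P2; rewrite lerD2l lerN2 ler1n.
Qed.

(** Here the equation is used as it stands: for [x < 0] its arguments move to the left, and
    [lam ^+ n * x] eventually falls below [B]. *)
Lemma germ_refinable_neg (U : R -> R) B : refi U ->
  (forall x, x < B -> germ0 U x) -> forall x, x < 0 -> germ0 U x.
Proof.
move=> Ur U0 x x0.
have H n : forall x, lam ^+ n * x < B -> germ0 U x.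
  elim: n => [|n IH] {x0} x; first by rewrite expr0 mul1r; exact: U0.
  rewrite exprSr -mulrA => h.
  have H1 := near_scale_dnbhs lam_neq0 (IH _ h).
  have H2 : \forall y \near x^', forall i, U (lam * y - (dl i)%:R) = 0.
    apply: filter_forall_fin => i.
    apply: (near_scale_dnbhs lam_neq0 (P := fun z => U (z - (dl i)%:R) = 0)).
    apply: (near_sub_dnbhs (P := fun z => U z = 0)).
    apply: IH; apply: le_lt_trans h.
    by rewrite ler_pM2l ?exprn_gt0 // gerBl.
  have H3 := Ur x.
  near=> y; rewrite (near H3 y) // (near H1 y) // mulr0 add0r big1 // => i _.
  by have := near H2 y; move=> -> //; rewrite mulr0.
have [n hn] := exprn_unbounded (B / x) lam_gt1.
by apply: (H n); move: hn; rewrite ltr_ndivrMr.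
Unshelve. all: end_near. Qed.

End Uniqueness.

(** [G t] is read off at [t / lam ^+ n] for any [n] bringing that point below [e]; homogeneity makes
    the choice irrelevant, so one fixed [n] serves near each [t] and smoothness is inherited from
    [F]. *)
Lemma homogeneous_extension (R : realType) (lam c0 e : R) (F : R -> R) :
  1 < lam -> c0 != 0 -> 0 < e ->
  (forall y, 0 < y -> y < e -> F y = c0 * F (lam * y)) ->
  (forall n y, 0 < y -> y < e -> ndiff_near n F y) ->
  exists G : R -> R, [/\ forall t, t <= 0 -> G t = 0,
    forall t, G (lam * t) = c0^-1 * G t,
    forall n t, 0 < t -> ndiff_near n G t
  & forall t, 0 < t -> t < e -> G t = F t].
Proof.
move=> lam1 c00 e0 Fh Fs; have lam0 : 0 < lam by lra.
have ex t : exists n : nat, t / lam ^+ n < e.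
  have [n hn] := exprn_unbounded (t / e) lam1; exists n.
  by rewrite ltr_pdivrMr ?exprn_gt0 // mulrC -ltr_pdivrMr.
pose N t := projT1 (cid (ex t)).
have hN t : t / lam ^+ N t < e by exact: projT2 (cid (ex t)).
pose V n t := c0 ^- n * F (t / lam ^+ n).
pose G t := if 0 < t then V (N t) t else 0.
have Ve n m t : 0 < t -> (n <= m)%N -> t / lam ^+ n < e -> V m t = V n t.
  move=> t0 /subnK <-; elim: (m - n)%N => [//|k IH] h.
  rewrite -IH // addSn /V; set p := (k + n)%N.
  have tp : t / lam ^+ p <= t / lam ^+ n.
    rewrite ler_pM2l // lef_pV2 ?posrE ?exprn_gt0 //.
    by rewrite ler_weXn2l ?leq_addl // ltW.
  have tp1 : 0 < t / lam ^+ p.+1 by rewrite divr_gt0 ?exprn_gt0.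
  have lt : lam * (t / lam ^+ p.+1) = t / lam ^+ p.
    by rewrite exprS; field; rewrite !gt_eqF ?exprn_gt0.
  have tp2 : t / lam ^+ p.+1 < e.
    apply: le_lt_trans h; apply: le_trans tp; rewrite -lt.
    by rewrite ler_peMl // ltW.
  rewrite Fh // lt exprS; field.
  by rewrite expf_neq0.
have GE n t : 0 < t -> t / lam ^+ n < e -> G t = V n t.
  move=> t0 h; rewrite /G t0; case: (leqP n (N t)) => nN.
    by rewrite (Ve n (N t)) //.
  by rewrite (Ve (N t) n) // ltnW.
exists G; split.
- by move=> t t0; rewrite /G ltNge t0.
- move=> t; have [t0|t0] := ltP 0 t; last first.
    by rewrite /G !ltNge t0 pmulr_rle0 // t0 mulr0.
  have [n hn] := ex t; rewrite (GE n t) // (GE n.+1 (lam * t)).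
  + rewrite /V exprS (_ : lam * t / _ = t / lam ^+ n); last first.
      by rewrite exprS; field; rewrite !gt_eqF ?exprn_gt0.
    by rewrite invfM mulrA.
  + exact: mulr_gt0.
  + rewrite (_ : lam * t / _ = t / lam ^+ n) //.
    by rewrite exprS; field; rewrite !gt_eqF ?exprn_gt0.
- move=> n t t0; have [k hk] := ex t.
  apply: (@ndiff_near_eq _ n (fun y => c0 ^- k * F (lam ^- k * y + 0))).
    have /lt_nbhsl : t < lam ^+ k * e by rewrite mulrC -ltr_pdivrMr ?exprn_gt0.
    move: (lt_nbhsr t0); apply: filterS2 => y y0 yk; rewrite (GE k) //.
      by rewrite /V addr0 [y / _]mulrC.
    by rewrite ltr_pdivrMr ?exprn_gt0 // mulrC.
  apply: ndiff_nearZ; apply: ndiff_near_affine; apply: Fs; rewrite addr0 mulrC //.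
  by rewrite divr_gt0 ?exprn_gt0.
- by move=> t t0 te; rewrite (GE 0%N) /V ?expr0 ?divr1 ?invr1 ?mul1r.
Qed.

(** * The singular part of a piecewise smooth solution *)

Lemma near_dnbhs_notin (R : realType) (A : seq R) (x : R) :
  \forall y \near x^', y \notin A.
Proof.
elim: A => [|a A IH]; first exact: nearW.
have xa : \forall y \near x^', y != a.
  have [->|xa] := eqVneq x a; first by rewrite near_withinE; exact: nearW.
  apply: nbhs_dnbhs; move: xa; rewrite neq_lt => /orP[xa|xa].
    by move: (lt_nbhsl xa); apply: filterS => y ya; rewrite lt_eqF.
  by move: (lt_nbhsr xa); apply: filterS => y ya; rewrite gt_eqF.
by move: xa IH; apply: filterS2 => y ya yA; rewrite inE negb_or ya.
Qed.

(** [B] may exceed the image of [A]: sums over different dilates and translates of [A] can thus be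
    written over one common list. *)
Lemma sum_reindex_supp (R : nzRingType) (S T : eqType) (q : S -> R)
    (phi : T -> R) (A : seq S) (B : seq T) (g : S -> T) (h : T -> S) :
  uniq A -> uniq B -> cancel g h -> cancel h g ->
  (forall a, q a != 0 -> a \in A) -> (forall a, a \in A -> g a \in B) ->
  \sum_(a <- A) q a * phi (g a) = \sum_(b <- B) q (h b) * phi b.
Proof.
move=> uA uB gK hK qA gB.
rewrite [RHS](bigID (fun b => h b \in A)) /= [X in _ + X]big1 ?addr0; last first.
  move=> b hb; have -> : q (h b) = 0 by apply/eqP; apply: contraNT hb; exact: qA.
  by rewrite mul0r.
rewrite -[RHS]big_filter [RHS](perm_big (map g A)).
  by rewrite big_map; apply: eq_bigr => a _; rewrite gK.
apply: uniq_perm; rewrite ?filter_uniq ?map_inj_uniq //; first exact: can_inj gK.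
move=> b; rewrite mem_filter; apply/andP/mapP => [[hA _]|[a aA ->]].
  by exists (h b).
by rewrite gK aA gB.
Qed.

(** The identity [P(z^lam) = C(z) P(z)], times [c0], paired with an arbitrary function instead of
    exponentials. It serves with profiles of [G], with powers for the moments, and with translates
    for the comb of [phi]. *)
Lemma comb_refinement (R : realType) (I : finType) (lam c0 : R) (c : I -> R)
    (dl : I -> nat) (A : seq R) (q : R -> R) :
  0 < lam -> c0 != 0 -> uniq A -> (forall a, q a != 0 -> a \in A) ->
  (forall b, q b = q (b / lam) - \sum_i c0^-1 * c i * q (b - (dl i)%:R)) ->
  forall phi : R -> R, c0 * \sum_(a <- A) q a * phi (lam * a) =
    c0 * \sum_(a <- A) q a * phi a +
    \sum_i c i * \sum_(a <- A) q a * phi (a + (dl i)%:R).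
Proof.
move=> lam0 c00 uA qA qr phi; have lamn0 : lam != 0 by rewrite gt_eqF.
pose B := undup (map ( *%R lam) A ++ A ++
  flatten [seq map (fun a => a + (dl i)%:R) A | i <- enum I]).
have uB : uniq B by exact: undup_uniq.
rewrite (@sum_reindex_supp _ _ _ q phi A B ( *%R lam) (fun b => b / lam)) //.
- rewrite (@sum_reindex_supp _ _ _ q phi A B id id) //; last first.
    by move=> a aA; rewrite mem_undup !mem_cat aA orbT.
  rewrite (eq_bigr (fun i => c i *
      \sum_(b <- B) q (b - (dl i)%:R) * phi b)); last first.
    move=> i _; rewrite (@sum_reindex_supp _ _ _ q phi A B (fun a => a + (dl i)%:R)
      (fun b => b - (dl i)%:R)) //.
    - exact: addrK.
    - exact: subrK.
    - move=> a aA; rewrite mem_undup !mem_cat; apply/orP; right.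
      apply/orP; right; apply/flattenP.
      exists [seq a + (dl i)%:R | a <- A]; last by apply/mapP; exists a.
      by apply/mapP; exists i; rewrite ?mem_enum.
  under eq_bigr do rewrite mulr_sumr.
  rewrite exchange_big /= !mulr_sumr -big_split /=; apply: eq_bigr => b _.
  rewrite (qr b) mulrBl mulrBr; apply/eqP; rewrite -subr_eq0; apply/eqP.
  set X := \sum_i _; set Y := \sum_i _.
  have -> : Y = c0 * (X * phi b).
    rewrite /X /Y mulr_suml mulr_sumr; apply: eq_bigr => i _.
    by field.
  ring.
- by move=> a; rewrite mulrC mulKf.
- by move=> a; rewrite mulrC divfK.
- by move=> a aA; rewrite mem_undup mem_cat map_f.
Qed.

Section SingularPart.
Variables (R : realType) (I : finType) (lam c0 e : R) (c : I -> R) (dl : I -> nat).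
Variables (F G : R -> R) (A : seq R).
Hypotheses (lam_gt1 : 1 < lam) (c0_neq0 : c0 != 0)
  (dl_gt0 : forall i, (0 < dl i)%N) (e_gt0 : 0 < e).
Hypotheses (F_ref : germ_refinable lam c0 c dl F)
  (F_neg : forall x, x < 0 -> germ0 F x)
  (F_smooth : forall x, x \notin A -> forall n, ndiff_near n F x).
Hypotheses (G_le0 : forall t, t <= 0 -> G t = 0)
  (G_hom : forall t, G (lam * t) = c0^-1 * G t)
  (G_smooth : forall n t, 0 < t -> ndiff_near n G t)
  (FG : forall t, 0 < t -> t < e -> G t = F t)
  (G_neq0 : ~ germ0 G 0).

Let lam_gt0 : 0 < lam. Proof. exact: lt_trans lam_gt1. Qed.
Let lam_neq0 : lam != 0. Proof. by rewrite gt_eqF. Qed.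

Lemma homogeneous_not_regular : ~ regular G 0.
Proof.
move=> Gr; apply: G_neq0.
apply: (homogeneous_regular_germ0 lam_gt1 c0_neq0) => //.
  by apply: nearW => y y0; rewrite G_le0 // ltW.
by apply: nearW => y y0; rewrite G_hom mulVKf.
Qed.

Lemma F_left : \forall y \near (0 : R)^', y < 0 -> F y = 0.
Proof.
move: (near_dnbhs_notin A 0); apply: filterS => y yA y0.
by apply: germ0_cont (F_neg y0); apply: ndiff_near_cont (F_smooth yA 1%N).
Qed.

Definition singular_coef b s := regular (fun t => F (b + t) - s * G t) 0.

Lemma singular_coef_uniq b s s' :
  singular_coef b s -> singular_coef b s' -> s = s'.
Proof.
move=> h h'; apply/eqP/negPn/negP => ss'; apply: homogeneous_not_regular.
have d0 : s' - s != 0 by rewrite subr_eq0 eq_sym.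
have := regularZ (s' - s)^-1 (regularD h (regularZ (-1) h')).
by apply: regular_eq; apply: nearW => t; field.
Qed.

Lemma singular_coef_base b : b < e -> singular_coef b (b == 0)%:R.
Proof.
move=> be; have [->|b0] := eqVneq b 0.
  apply: regular0; have /near_dnbhs0P[e' e'0 he] := F_left.
  apply/near_dnbhs0P; exists (Num.min e e'); first by rewrite lt_min e_gt0.
  move=> t t0; rewrite lt_min add0r mul1r => /andP[te te'].
  have := he t t0 te'; move: t0; rewrite neq_lt => /orP[t0 /(_ t0)->|t0 _].
    by rewrite G_le0 ?subr0 // ltW.
  by rewrite -FG ?subrr // -(gtr0_norm t0).
move: b0; rewrite neq_lt => /orP[b0|b0].
  apply: regular0; move: (near_shift_dnbhs (F_neg b0)); apply: filterS => t ->.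
  by rewrite mul0r subr0.
exists (fun t => G (1 * t + b)).
  by move=> n; apply: ndiff_near_affine; rewrite mulr0 add0r; exact: G_smooth.
have H : \forall y \near b^', F y = G y.
  apply: nbhs_dnbhs; move: (lt_nbhsr b0) (lt_nbhsl be).
  by apply: filterS2 => y y0 ye; rewrite FG.
move: (near_shift_dnbhs H); apply: filterS => t ->.
by rewrite mul0r subr0 mul1r addrC.
Qed.

(** The factor [c0^-1] comes from solving the equation for [F], the factor [c0] from
    [G (t / lam) = c0 * G t]; their cancellation is why [q] obeys a recursion free of dilation
    weights. *)
Lemma singular_coef_step b s1 (s2 : I -> R) : singular_coef (b / lam) s1 ->
  (forall i, singular_coef (b - (dl i)%:R) (s2 i)) ->
  singular_coef b (c0^-1 * (c0 * s1) - \sum_i c0^-1 * c i * s2 i).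
Proof.
move=> h1 h2; have li : lam^-1 != 0 by rewrite invr_eq0.
have := near_shift_dnbhs (germ_refinable_forward lam_gt1 b F_ref).
move: (regularD (regularZ c0^-1 (regular_scale li h1)) (regular_sum (enum I)
  (fun i => regularZ (- (c0^-1 * c i)) (h2 i)))).
move=> h H; apply: regular_eq h; move: H; apply: filterS => t H.
have -> : F (b + t) = c0^-1 * (c0 * F (b + t)) by rewrite mulKf.
have Gt : G (lam^-1 * t) = c0 * G t.
  by rewrite -{2}(mulVKf lam_neq0 t) G_hom mulVKf.
rewrite H Gt.
have -> : \sum_(i <- enum I)
    - (c0^-1 * c i) * (F (b - (dl i)%:R + t) - s2 i * G t) =
    - (c0^-1 * \sum_i c i * F (b + t - (dl i)%:R)) +
    (\sum_i c0^-1 * c i * s2 i) * G t.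
  rewrite big_enum /= mulr_suml mulr_sumr -sumrN -big_split /=.
  by apply: eq_bigr => i _; rewrite (addrAC b); ring.
have -> : b / lam + lam^-1 * t = (b + t) / lam by rewrite mulrDl [t / _]mulrC.
set X := \sum_i _; set Y := \sum_i _; field.
exact: c0_neq0.
Qed.

Lemma singular_coef_ex b : exists s, singular_coef b s.
Proof.
apply: (@refinement_ind R lam e (fun b => exists s, singular_coef b s)) => //.
  by move=> x /singular_coef_base; exists (x == 0)%:R.
move=> y y0 [s1 h1] h2.
have h i : {s | singular_coef (y - (dl i)%:R) s}.
  by apply: cid; apply: h2; rewrite lerD2l lerN2 ler1n.
eexists; apply: (singular_coef_step h1 (fun i => projT2 (h i))).
Qed.

Definition sing b := projT1 (cid (singular_coef_ex b)).

Lemma singP b : singular_coef b (sing b).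
Proof. exact: projT2 (cid (singular_coef_ex b)). Qed.

Lemma sing_refinement b :
  sing b = sing (b / lam) - \sum_i c0^-1 * c i * sing (b - (dl i)%:R).
Proof.
apply: (singular_coef_uniq (singP b)).
have := singular_coef_step (singP (b / lam)) (fun i => singP (b - (dl i)%:R)).
by rewrite mulKf.
Qed.

Lemma sing_small b : b < e -> sing b = (b == 0)%:R.
Proof. by move=> /singular_coef_base; apply: singular_coef_uniq; exact: singP. Qed.

Lemma sing_supp b : sing b != 0 -> b \in A.
Proof.
apply: contraNT => bA; apply/eqP; apply: (singular_coef_uniq (singP b)).
exists (fun t => F (1 * t + b)).
  by move=> n; apply: ndiff_near_affine; rewrite mulr0 add0r; exact: F_smooth.
by apply: nearW => t; rewrite mul0r subr0 mul1r addrC.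
Qed.

Let H x := \sum_(a <- A) sing a * G (x - a).

Hypothesis A_uniq : uniq A.

Lemma singular_part_refinable x :
  H x = c0 * H (lam * x) + \sum_i c i * H (lam * x - (dl i)%:R).
Proof.
have := comb_refinement lam_gt0 c0_neq0 A_uniq sing_supp sing_refinement
  (fun u => G (lam * x - u)).
rewrite /H => h; transitivity (c0 * \sum_(a <- A) sing a * G (lam * x - lam * a)).
  rewrite mulr_sumr; apply: eq_bigr => a _.
  by rewrite -mulrBr G_hom; field.
rewrite h; congr (_ + _); apply: eq_bigr => i _; congr (_ * _).
by apply: eq_bigr => a _; rewrite opprD addrA addrAC.
Qed.

Lemma pos_seq_gap (s : seq R) :
  exists2 t : R, 0 < t & forall a, a \in s -> 0 < a -> t <= a.
Proof.
elim: s => [|b s [t t0 ht]]; first by exists 1.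
have [b0|b0] := ltP 0 b; last first.
  exists t => // a; rewrite inE => /orP[/eqP->|/ht//].
  by rewrite ltNge b0.
exists (Num.min b t); first by rewrite lt_min b0.
move=> a; rewrite inE ge_min => /orP[/eqP->|/ht h /h ->]; last by rewrite orbT.
by rewrite lexx.
Qed.

(** [H] solves the same equation as [F]. Left of [e] and of all positive points of [A], only the
    term [a = 0] survives: coefficients at [a < 0] vanish, and so does [G (y - a)] for [a > 0].
    There [H] is [G], and so is [F]. *)
Lemma singular_part_eq x : germ0 (fun y => F y - H y) x.
Proof.
have [t t0 ht] := pos_seq_gap A.
have t'0 : 0 < Num.min e t by rewrite lt_min e_gt0.
have HG y : y < Num.min e t -> H y = G y.
  rewrite lt_min => /andP[ye yt].
  have sa a : a \in A -> sing a * G (y - a) = if a == 0 then G y else 0.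
    move=> aA; have [->|a0] := eqVneq a 0.
      by rewrite sing_small // eqxx mul1r subr0.
    move: a0; rewrite neq_lt => /orP[a0|a0].
      by rewrite sing_small ?(lt_trans a0) // lt_eqF // mul0r.
    by rewrite G_le0 ?mulr0 // subr_le0 (le_trans (ltW yt)) // ht.
  rewrite /H big_seq (eq_bigr _ sa) -big_seq -big_mkcond /= big_const_seq.
  have A0 : 0 \in A by apply: sing_supp; rewrite sing_small // eqxx oner_neq0.
  by rewrite count_uniq_mem // A0 /= addr0.
apply: (@germ_refinable_eq0 R I lam c0 c dl lam_gt1 c0_neq0 dl_gt0 _ _ t'0).
  move=> z; move: (F_ref z); apply: filterS => y ->.
  rewrite /= singular_part_refinable mulrBr.
  have -> : \sum_i c i * (F (lam * y - (dl i)%:R) - H (lam * y - (dl i)%:R)) =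
    \sum_i c i * F (lam * y - (dl i)%:R) - \sum_i c i * H (lam * y - (dl i)%:R).
    by rewrite -sumrB; apply: eq_bigr => i _; rewrite mulrBr.
  ring.
move=> z zt; have zt' := nbhs_dnbhs (lt_nbhsl zt).
have ze : z < e by move: zt; rewrite lt_min => /andP[].
suff FGz : \forall y \near z^', F y = G y.
  by move: FGz zt'; apply: filterS2 => y -> /HG ->; rewrite subrr.
have [z0|z0] := ltP z 0.
  move: (F_neg z0) (nbhs_dnbhs (lt_nbhsl z0)); apply: filterS2 => y -> y0.
  by rewrite G_le0 // ltW.
have nz : \forall y \near z^', y != 0.
  by move: (near_dnbhs_notin [:: 0] z); apply: filterS => y; rewrite inE.
have Fl : \forall y \near z^', y < 0 -> F y = 0.
  move: z0; rewrite le_eqVlt => /orP[/eqP<-|z0]; first exact: F_left.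
  apply: nbhs_dnbhs; move: (lt_nbhsr z0); apply: filterS => y y0 y0'.
  by have := lt_trans y0 y0'; rewrite ltxx.
move: nz Fl (nbhs_dnbhs (lt_nbhsl ze)); apply: filterS3 => y.
rewrite neq_lt => /orP[y0 /(_ y0)-> _|y0 _ ye]; first by rewrite G_le0 // ltW.
by rewrite FG.
Qed.

Lemma singular_part_exists : exists q : R -> R,
  [/\ forall a, q a != 0 -> a \in A,
      forall b, q b = q (b / lam) - \sum_i c0^-1 * c i * q (b - (dl i)%:R),
      forall b, b < e -> q b = (b == 0)%:R
    & forall x, germ0 (fun y => F y - \sum_(a <- A) q a * G (y - a)) x].
Proof.
exists sing; split.
- exact: sing_supp.
- exact: sing_refinement.
- exact: sing_small.
- exact: singular_part_eq.
Qed.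

End SingularPart.

(** * The profile of the singularities is a monomial *)

Lemma is_derive_bigsum (R : realType) (T : eqType) (s : seq T) (f : T -> R -> R)
    (df : T -> R) (x : R) :
  (forall i, i \in s -> is_derive x 1 (f i) (df i)) ->
  is_derive x 1 (fun y => \sum_(i <- s) f i y) (\sum_(i <- s) df i).
Proof.
elim: s => [|i s IH] h.
  rewrite big_nil (_ : (fun _ => _) = cst 0); first exact: is_derive_cst.
  by apply/funext => y; rewrite big_nil.
rewrite big_cons (_ : (fun _ => _) = (f i : R -> R) + (fun y => \sum_(j <- s) f j y)).
  apply: is_deriveD; first by apply: h; rewrite mem_head.
  by apply: IH => j js; apply: h; rewrite inE js orbT.
by apply/funext => y; rewrite big_cons.
Qed.

Definition zeros_cluster (R : realType) (phi : R -> R) :=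
  forall e : R, 0 < e -> exists h, [/\ 0 < h, h < e & phi h = 0].

(** Rolle between two zeros, the second one chosen in front of the first. *)
Lemma zeros_cluster_derive (R : realType) (phi dphi : R -> R) (eta : R) :
  0 < eta -> (forall h : R, `|h| < eta -> is_derive h 1 phi (dphi h)) ->
  zeros_cluster phi -> zeros_cluster dphi.
Proof.
move=> eta0 dp Z e e0.
have m0 : 0 < Num.min e eta by rewrite lt_min e0.
have [h1 [h10]] := Z _ m0; rewrite lt_min => /andP[h1e h1eta] z1.
have [h2 [h20 h21 z2]] := Z _ h10.
have inb x : h2 <= x -> x <= h1 -> `|x| < eta.
  move=> a b; rewrite ger0_norm; first exact: le_lt_trans h1eta.
  by apply: le_trans a; exact: ltW.
have dx x : h2 <= x -> x <= h1 -> derivable phi x 1.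
  by move=> a b; case: (dp _ (inb _ a b)).
have [|||c cc dc] := @Rolle R phi h2 h1 h21.
- by move=> x; rewrite in_itv/= => /andP[a b]; apply: dx; exact: ltW.
- apply: derivable_within_continuous => x; rewrite in_itv/= => /andP[a b].
  exact: dx.
- by rewrite z1 z2.
move: cc; rewrite in_itv/= => /andP[a b]; exists c; split.
- exact: lt_trans a.
- exact: lt_trans h1e.
- have [_ <-] := dp _ (inb _ (ltW a) (ltW b)).
  by case: dc.
Qed.

Lemma zeros_cluster_eq0 (R : realType) (phi : R -> R) :
  {for 0, continuous phi} -> zeros_cluster phi -> phi 0 = 0.
Proof.
move=> cphi Z; apply/eqP/negPn/negP => p0.
have p0' : 0 < `|phi 0| by rewrite normr_gt0.
move: cphi => /cvgrPdist_lt /(_ _ p0') /near0P[e e0 he].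
have [h [h0 hlt hz]] := Z e e0.
have := he h; rewrite hz subr0 ltxx gtr0_norm // => /(_ hlt).
by [].
Qed.

(** Otherwise [q] would annihilate all polynomials, in particular the one whose roots are the points
    of [A] other than [a0]. *)
Lemma exists_moment_neq0 (R : realType) (A : seq R) (q : R -> R) (a0 : R) :
  uniq A -> a0 \in A -> q a0 != 0 ->
  exists i, \sum_(a <- A) q a * a ^+ i != 0.
Proof.
move=> uA a0A q0; apply/not_existsP => H.
have M i : \sum_(a <- A) q a * a ^+ i = 0 by apply/eqP/negPn/negP/H.
have P (p : {poly R}) : \sum_(a <- A) q a * p.[a] = 0.
  under eq_bigr do rewrite horner_coef mulr_sumr.
  rewrite exchange_big big1 //= => i _.
  under eq_bigr do rewrite mulrCA.
  by rewrite -mulr_sumr M mulr0.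
have := P (\prod_(b <- rem a0 A) ('X - b%:P)).
set p := \prod_(b <- _) _.
have pr a : a \in rem a0 A -> q a * p.[a] = 0.
  by move=> aA; apply/eqP; rewrite mulf_eq0 -/(root _ _) root_prod_XsubC aA orbT.
rewrite (perm_big _ (perm_to_rem a0A)) /= big_cons big_seq big1 // addr0.
move/eqP; rewrite mulf_eq0 (negbTE q0) /= -/(root _ _) root_prod_XsubC.
by rewrite mem_rem_uniq // inE eqxx.
Qed.

Definition antiderivp (R : realType) (p : {poly R}) : {poly R} :=
  \poly_(i < (size p).+1) (p`_i.-1 / i%:R).

Lemma antiderivpK (R : realType) (p : {poly R}) : (antiderivp p)^`() = p.
Proof.
apply/polyP => i; rewrite coef_deriv coef_poly ltnS.
case: ltnP => [ip|pi]; last by rewrite mul0rn nth_default.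
by rewrite /= -[LHS]mulr_natr divfK // pnatr_eq0.
Qed.

Lemma derivs_eq0_poly (R : realType) m (gs : nat -> R -> R) :
  (forall i (t : R), 0 < t -> is_derive t 1 (gs i) (gs i.+1 t)) ->
  (forall t : R, 0 < t -> gs m t = 0) ->
  exists p : {poly R}, forall t : R, 0 < t -> gs 0%N t = p.[t].
Proof.
elim: m gs => [|m IH] gs dg g0; first by exists 0 => t t0; rewrite horner0 g0.
have [p hp] := IH (fun i => gs i.+1) (fun i => dg i.+1) g0.
pose P := antiderivp p; pose k := gs 0%N 1 - P.[1].
exists (P + k%:P) => t t0; rewrite hornerD hornerC.
pose D : R -> R := gs 0%N - horner P.
have dD (x : R) : 0 < x -> is_derive x 1 D 0.
  move=> x0; have := is_deriveB (dg 0%N x x0) (is_derive_poly P x).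
  by rewrite antiderivpK hp // subrr.
have cst (a b : R) : 0 < a -> a < b -> D a = D b.
  move=> a0 ab; have ax x : a <= x -> 0 < x by apply: lt_le_trans.
  have [||c _] := @MVT R D (fun=> 0) a b ab.
  - by move=> x; rewrite in_itv/= => /andP[/ltW /ax x0 _]; exact: dD.
  - apply: derivable_within_continuous => x; rewrite in_itv/= => /andP[/ax x0 _].
    by case: (dD x x0).
  - by rewrite mul0r => /eqP; rewrite subr_eq0 => /eqP.
have : D t = D 1.
  by case: (ltgtP t 1) => [/cst->//|/cst ->//|->].
have DE x : D x = gs 0%N x - P.[x] by [].
by rewrite !DE /k => h; rewrite -h; ring.
Qed.

Lemma poly_eq_pos (R : realType) (p q : {poly R}) :
  (forall t, 0 < t -> p.[t] = q.[t]) -> p = q.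
Proof.
move=> pq; apply/eqP; rewrite -subr_eq0; apply/negPn/negP => n0.
have /max_poly_roots := n0; move=> /(_ [seq (i.+1)%:R | i <- iota 0 (size (p - q))]).
rewrite size_map size_iota ltnn => H; suff : false by [].
apply: H.
  apply/allP => x /mapP[i _ ->]; rewrite /root hornerD hornerN pq ?subrr //.
  by rewrite map_inj_uniq ?iota_uniq // => i j /eqP; rewrite eqr_nat => /eqP[].
Qed.

(** Comparing coefficients, [lam ^+ i = kap] whenever the [i]-th coefficient is nonzero, and the
    powers of [lam > 1] are distinct. *)
Lemma homogeneous_poly (R : realType) (lam kap : R) (p : {poly R}) :
  1 < lam -> p != 0 -> (forall t, 0 < t -> p.[lam * t] = kap * p.[t]) ->
  exists r, [/\ kap = lam ^+ r, p`_r != 0 & p = p`_r *: 'X^r].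
Proof.
move=> lam1 p0 hp; have lam0 : 0 < lam by lra.
have E : p \Po (lam *: 'X) = kap *: p.
  by apply: poly_eq_pos => t t0; rewrite horner_comp !hornerE hp.
have C i : lam ^+ i * p`_i = kap * p`_i.
  rewrite -[RHS]coefZ -E comp_polyE coef_sum.
  have [ip|pi] := ltnP i (size p); last first.
    rewrite [in LHS]nth_default // mulr0 big1 // => j _.
    rewrite exprZn !coefZ coefXn gtn_eqF ?mulr0 //.
    exact: leq_trans (ltn_ord j) pi.
  rewrite (bigD1 (Ordinal ip)) //= exprZn !coefZ coefXn eqxx mulr1 mulrC.
  rewrite big1 ?addr0 // => j ji; rewrite exprZn !coefZ coefXn.
  by rewrite -val_eqE /= eq_sym in ji; rewrite (negbTE ji) !mulr0.
exists (size p).-1; set r := (size p).-1.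
have lr : p`_r != 0 by rewrite -/(lead_coef p) lead_coef_eq0.
have kr : kap = lam ^+ r by apply: (mulIf lr); rewrite C.
split=> //; apply/polyP => i; rewrite coefZ coefXn.
have [->|ir] := eqVneq i r; first by rewrite mulr1.
rewrite mulr0; apply/eqP/negPn/negP => pi.
have /(mulIf pi) := C i; rewrite kr => /(ieexprIn lam0 _) E'.
by move: ir; rewrite E' ?eqxx // gt_eqF.
Qed.

(** For [r = 0] the value at 0 is 1, so that the truncated power is continuous from the right, as
    the half-open pieces of [spline] demand. *)
Definition tpow (R : realType) (r : nat) (y : R) : R := if 0 <= y then y ^+ r else 0.

Lemma homogeneous_comb_tpow (R : realType) (lam c0 X : R) (A : seq R)
    (q G : R -> R) :
  1 < lam -> c0 != 0 ->
  uniq A -> (forall a, a \in A -> 0 <= a) -> 0 \in A -> q 0 != 0 ->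
  (forall t, t <= 0 -> G t = 0) -> (forall t, G (lam * t) = c0^-1 * G t) ->
  (forall n t, 0 < t -> ndiff_near n G t) -> ~ germ0 G 0 ->
  (forall x, X < x -> \sum_(a <- A) q a * G (x - a) = 0) ->
  exists r C, [/\ c0^-1 = lam ^+ r, C != 0 &
    forall t, t != 0 -> G t = C * tpow r t].
Proof.
move=> lam1 c00 uA A0 A00 q0 Gle0 Gh Gs Gn0 GX.
have lam0 : 0 < lam by lra.
pose gs i := derive1n i G.
have dg i (t : R) : 0 < t -> is_derive t 1 (gs i) (gs i.+1 t).
  move=> t0; rewrite /gs derive1nS derive1E; apply: derivableP.
  exact: ndiff_near_derivable (Gs i.+1 t t0).
have Ghn n t : G (lam ^+ n * t) = c0 ^- n * G t.
  elim: n => [|n IH]; first by rewrite !expr0 invr1 !mul1r.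
  by rewrite !exprS -mulrA Gh IH invfM mulrA.
have [m Mm] := exists_moment_neq0 uA A00 q0.
have gm0 (y : R) : 0 < y -> gs m y = 0.
  (* The [i]-th derivative in [h] of [sum_a q(a) G(y - a h)]. Since [S] exceeds every [a], the
     arguments stay positive for [|h| < y / S], where [G] is smooth. At [h = 0] it equals [(-1)^i]
     times the [i]-th moment times [gs i y]. *)
  move=> y0; pose phi i (h : R) := \sum_(a <- A) (q a * (- a) ^+ i) * gs i (- a * h + y).
  pose S := 1 + \sum_(a <- A) a.
  have aS a : a \in A -> a < S.
    move=> aA; rewrite /S (perm_big _ (perm_to_rem aA)) /= big_cons.
    have : 0 <= \sum_(j <- rem a A) j.
      by rewrite big_seq sumr_ge0 // => j /mem_rem; exact: A0.
    lra.
  have S0 : 0 < S by rewrite (le_lt_trans _ (aS 0 A00)).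
  have eta0 : 0 < y / S by rewrite divr_gt0.
  have pos (a h : R) : a \in A -> `|h| < y / S -> 0 < - a * h + y.
    move=> aA; rewrite ltr_pdivlMr // => hy.
    have : a * h <= `|h| * S.
      rewrite mulrC; apply: le_trans (ler_wpM2r (A0 a aA) (ler_norm h)) _.
      by rewrite ler_wpM2l // ltW // aS.
    lra.
  have dphi i (h : R) : `|h| < y / S -> is_derive h 1 (phi i) (phi i.+1 h).
    move=> hy; apply: is_derive_bigsum => a aA.
    have H := is_derive_affine (dg i _ (pos a h aA hy)).
    have := @is_deriveZ _ _ _ (fun z => gs i (- a * z + y)) (q a * (- a) ^+ i) h 1 _ H.
    by move=> H'; apply: (is_derive_eq H'); rewrite /GRing.scale /= exprS; ring.
  (* Zeros occur at [h = lam ^- n]: the threshold for [lam ^+ n] ensures both [h < e] and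
     [lam ^+ n * y > X]. *)
  have Z0 : zeros_cluster (phi 0%N).
    move=> e e0; have [n hn] := exprn_unbounded (e^-1 + `|X| / y) lam1.
    exists (lam ^- n).
    have p : 0 < lam ^+ n by rewrite exprn_gt0.
    have ei : 0 < e^-1 by rewrite invr_gt0.
    have Xy : 0 <= `|X| / y by rewrite divr_ge0 // ltW.
    split; first by rewrite invr_gt0.
      rewrite -[ltRHS]invrK ltf_pV2 ?posrE //; lra.
    have : X < lam ^+ n * y.
      rewrite -ltr_pdivrMr //; apply: le_lt_trans (_ : `|X| / y < _); last by lra.
      by rewrite ler_pM2r ?invr_gt0 // ler_norm.
    move=> /GX H; apply: (mulfI (_ : c0 ^- n != 0)).
      by rewrite invr_eq0 expf_neq0.
    rewrite mulr0 -H mulr_sumr; apply: eq_bigr => a _.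
    rewrite expr0 mulr1 mulrCA -Ghn; congr (_ * G _).
    by field; rewrite gt_eqF.
  have Zi i : zeros_cluster (phi i).
    elim: i => [//|i IH]; exact: zeros_cluster_derive eta0 (dphi i) IH.
  have phi0 : phi m 0 = 0.
    apply: zeros_cluster_eq0 => //; apply: differentiable_continuous.
    by apply/derivable1_diffP; case: (dphi m 0); rewrite ?normr0.
  move: phi0; rewrite /phi.
  rewrite (eq_bigr (fun a => (q a * a ^+ m) * ((-1) ^+ m * gs m y))); last first.
    by move=> a _; rewrite mulr0 add0r (exprNn a); ring.
  rewrite -mulr_suml => /eqP; rewrite mulf_eq0 (negbTE Mm) /= mulf_eq0.
  by rewrite signr_eq0 /= => /eqP.
have [p hp] := derivs_eq0_poly dg gm0.
have p0 : p != 0.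
  apply/eqP => p0; apply: Gn0; apply: nearW => t.
  have [/Gle0//|t0] := leP t 0.
  by have := hp t t0; rewrite p0 horner0.
have [|r [kr pr pE]] := @homogeneous_poly R lam c0^-1 p lam1 p0.
  by move=> t t0; rewrite -!hp ?mulr_gt0 //; exact: Gh.
exists r, p`_r; split=> // t; rewrite neq_lt /tpow => /orP[t0|t0].
  by rewrite Gle0 ?(ltW t0) // leNgt t0 mulr0.
by rewrite ltW // (hp t t0 : G t = _) pE hornerZ hornerXn coefZ coefXn eqxx mulr1.
Qed.

(** * Exponents of the comb modulo 1 *)

(** By coprimality the [m]-th power of the denominator divides [z0] for arbitrarily large [m], so
    the denominator is 1. *)
Lemma rat_int_of_powers (rho : rat) (z0 : int) : z0 != 0 ->
  (forall N : nat, exists m z, (N <= m)%N /\ rho ^+ m * z0%:~R = z%:~R) ->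
  exists z : int, rho = z%:~R.
Proof.
move=> z00 H; exists (numq rho); rewrite -[LHS]divq_num_den.
suff -> : denq rho = 1 by rewrite divr1.
have D1 m z : rho ^+ m * z0%:~R = z%:~R -> (`|denq rho| ^ m <= `|z0|)%N.
  move=> h; have {}h : numq rho ^+ m * z0 = z * denq rho ^+ m.
    apply/eqP; rewrite -(eqr_int rat) !rmorphM !rmorphXn /= -h.
    have := divq_num_den rho; have := denq_neq0 rho.
    move: (numq rho) (denq rho) => n d d0 <-; rewrite expr_div_n.
    by apply/eqP; field; rewrite expf_neq0 // intr_eq0.
  have /(congr1 absz) := h; rewrite !abszM !abszX => h'.
  apply: dvdn_leq; first by rewrite absz_gt0.
  rewrite -(@Gauss_dvdr _ (`|numq rho| ^ m)) ?h' ?dvdn_mull //.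
  by rewrite coprimeXl // coprimeXr // coprime_sym coprime_num_den.
have [m [z [Nm /D1 hm]]] := H (`|z0|.+1)%N.
have d0 := denq_gt0 rho.
apply/eqP; apply: contraT => d1.
have d2 : (1 < `|denq rho|)%N by lia.
have := ltn_expl m d2.
move: hm; set X := (_ ^ m)%N; lia.
Qed.

Lemma ratr_int_of_powers (R : realType) (rho : rat) (lam : R) (z0 : int) :
  z0 != 0 -> lam = ratr rho ->
  (forall N : nat, exists m z, (N <= m)%N /\ lam ^+ m * z0%:~R = z%:~R :> R) ->
  lam \is a Num.int.
Proof.
move=> z00 lr H; have [|z hz] := @rat_int_of_powers rho z0 z00; last first.
  by rewrite lr hz ratr_int intr_int.
move=> N; have [m [z [Nm h]]] := H N; exists m, z; split=> //.
apply: (fmorph_inj (@ratr R)); rewrite rmorphM rmorphXn /= -lr.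
by rewrite !ratr_int.
Qed.

Lemma pigeonhole_infinite (T : eqType) (A : seq T) (P : nat -> T -> Prop) :
  (forall n, exists2 a, a \in A & P n a) ->
  exists2 a, a \in A & forall N : nat, exists2 n, (N <= n)%N & P n a.
Proof.
move=> H; apply: contrapT => NE.
have [N hN] : exists N : nat, forall a, a \in A -> forall n, (N <= n)%N -> ~ P n a.
  have : forall a, a \in A -> exists N : nat, forall n, (N <= n)%N -> ~ P n a.
    move=> a aA; apply: contrapT => Na; apply: NE; exists a => // N.
    apply: contrapT => Nn; apply: Na; exists N => n Nnn Pn; apply: Nn.
    by exists n.
  elim: A {H NE} => [|a A IH] h; first by exists 0%N.
  have [N1 h1] := h a (mem_head _ _).
  have [|N2 h2] := IH; first by move=> b bA; apply: h; rewrite inE bA orbT.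
  exists (maxn N1 N2) => b; rewrite inE => /orP[/eqP->|bA] n;
    rewrite geq_max => /andP[n1 n2]; [exact: h1|exact: h2].
by have [a aA Pa] := H N; exact: hN Pa.
Qed.

Section Comb.
Variables (R : realType) (I : finType) (lam c0 e : R) (c : I -> R) (dl : I -> nat).
Variables (A : seq R) (q : R -> R).
Hypotheses (lam_gt1 : 1 < lam) (c0_neq0 : c0 != 0)
  (dl_gt0 : forall i, (0 < dl i)%N) (e_gt0 : 0 < e).
Hypotheses (q_supp : forall a, q a != 0 -> a \in A)
  (q_ref : forall b, q b = q (b / lam) - \sum_i c0^-1 * c i * q (b - (dl i)%:R))
  (q_small : forall b, b < e -> q b = (b == 0)%:R).

Let lam_gt0 : 0 < lam. Proof. exact: lt_trans lam_gt1. Qed.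
Let lam_neq0 : lam != 0. Proof. by rewrite gt_eqF. Qed.

(** The comb of [P(z) C(z^lam) ... C(z^(lam^n))]. Iterating the identity for [P] shows that this is
    the quotient of [P(z^(lam^(n+1)))] by [C(z)], so the divisibility is explicit. *)
Fixpoint quot_comb (n : nat) (y : R) : R :=
  if n is m.+1 then
    quot_comb m y + \sum_i c0^-1 * c i * quot_comb m (y - lam ^+ n * (dl i)%:R)
  else q y.

Lemma quot_combE n y : q (y / lam ^+ n.+1) =
  quot_comb n y + \sum_i c0^-1 * c i * quot_comb n (y - (dl i)%:R).
Proof.
elim: n y => [|n IH] y; first by rewrite expr1 /= (q_ref y) subrK.
have -> : y / lam ^+ n.+2 = y / lam ^+ n.+1 / lam.
  by rewrite [lam ^+ n.+2]exprS invfM [lam^-1 * _]mulrC mulrA.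
have := q_ref (y / lam ^+ n.+1) => /eqP; rewrite eq_sym subr_eq => /eqP ->.
rewrite IH.
have -> : \sum_i c0^-1 * c i * q (y / lam ^+ n.+1 - (dl i)%:R) =
  \sum_i c0^-1 * c i * (quot_comb n (y - lam ^+ n.+1 * (dl i)%:R) +
    \sum_j c0^-1 * c j * quot_comb n (y - lam ^+ n.+1 * (dl i)%:R - (dl j)%:R)).
  apply: eq_bigr => i _; congr (_ * _); rewrite -IH; congr q.
  by field; rewrite expf_neq0.
have -> : \sum_i c0^-1 * c i * quot_comb n.+1 (y - (dl i)%:R) =
  \sum_i c0^-1 * c i * quot_comb n (y - (dl i)%:R) +
  \sum_i \sum_j c0^-1 * c j * (c0^-1 * c i *
    quot_comb n (y - lam ^+ n.+1 * (dl j)%:R - (dl i)%:R)).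
  rewrite -big_split; apply: eq_bigr => i _; rewrite /= mulrDr; congr (_ + _).
  rewrite mulr_sumr; apply: eq_bigr => j _; rewrite addrAC; ring.
rewrite [in RHS]exchange_big /=.
under [X in _ + X = _]eq_bigr do rewrite mulrDr mulr_sumr.
by rewrite big_split /= addrACA.
Qed.

Lemma quot_comb_neg n y : y < 0 -> quot_comb n y = 0.
Proof.
elim: n y => [|n IH] y y0 /=.
  by rewrite q_small ?(lt_trans y0) // lt_eqF.
rewrite IH // add0r big1 // => i _; rewrite IH ?mulr0 //.
by rewrite subr_lt0 (lt_le_trans y0) // mulr_ge0 ?exprn_ge0 // ltW.
Qed.

Lemma quot_comb_bounded n : exists X, forall y, X < y -> quot_comb n y = 0.
Proof.
elim: n => [|n [X hX]].
  exists (\sum_(a <- A) `|a|) => y hy; apply/eqP; apply: contraTT hy => /q_supp yA.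
  rewrite -leNgt (perm_big _ (perm_to_rem yA)) /= big_cons.
  by apply: le_trans (ler_norm _) _; rewrite lerDl sumr_ge0.
exists (X + \sum_i lam ^+ n.+1 * (dl i)%:R) => y hy /=.
have p i : 0 <= lam ^+ n.+1 * (dl i)%:R by rewrite mulr_ge0 ?exprn_ge0 // ltW.
rewrite hX; last by apply: le_lt_trans hy; rewrite lerDl sumr_ge0.
rewrite add0r big1 // => i _; rewrite hX ?mulr0 // ltrBrDr.
apply: le_lt_trans hy; rewrite lerD2l (bigD1 i) //= lerDl sumr_ge0 //.
Qed.

Variable i1 : I.
Hypotheses (c_i1 : c i1 != 0)
  (dl_i1 : forall i, i != i1 -> c i != 0 -> (dl i < dl i1)%N).

(* The mask divides P(z^(lam^n)), and it has at least two terms; hence no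
   class of exponents modulo 1 of P(z^(lam^n)) reduces to a single term. *)
Lemma comb_class n t : q t != 0 ->
  exists t', [/\ t' != t, q t' != 0 & lam ^+ n.+1 * (t - t') \is a Num.int].
Proof.
move=> qt; apply: contrapT => NE.
have ln0 : lam ^+ n.+1 != 0 by rewrite expf_neq0.
(* Along the class [y0 + m], starting at a negative [y0], [V] and [W] are the coefficients of
   [P(z^(lam^(n+1)))] and of its quotient by [C]: ordinary sequences with [V = C W]. By the
   assumption to be refuted, [V] lives at [N0] alone. *)
pose y := lam ^+ n.+1 * t; pose N0 := (Num.truncn y).+1.
have yN0 : y < N0%:R by exact: truncnS_gt.
pose y0 := y - N0%:R; pose W m := quot_comb n (y0 + m%:R).
have y00 : y0 < 0 by rewrite subr_lt0.
pose V m := q ((y0 + m%:R) / lam ^+ n.+1).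
have VE m : V m = W m + \sum_i c0^-1 * c i *
    (if (dl i <= m)%N then W (m - dl i)%N else 0).
  rewrite /V quot_combE; congr (_ + _); apply: eq_bigr => i _; congr (_ * _).
  case: leqP => mi; first by rewrite /W natrB // addrA.
  rewrite quot_comb_neg //; have : m%:R < (dl i)%:R :> R by rewrite ltr_nat.
  lra.
have VN : V N0 != 0 by rewrite /V /y0 subrK /y mulrC mulKf.
have V0 m : m != N0 -> V m = 0.
  move=> mN; apply/eqP; apply: contraT => Vm; case: NE.
  exists ((y0 + m%:R) / lam ^+ n.+1); split => //.
    apply: contra mN => /eqP h.
    have : y0 + m%:R = y by rewrite /y -h; field.
    rewrite /y0 => h'; have : m%:R = N0%:R :> R by lra.
    by move/eqP; rewrite eqr_nat.
  rewrite (_ : _ * _ = N0%:~R - m%:~R); first by rewrite rpredB ?intr_int.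
  by rewrite !pmulrn /y0 /y; field.
have exW : exists m, W m != 0.
  apply: contrapT => NW; have {NW}W0 m : W m = 0.
    by apply/eqP; apply: contraT => Wm; case: NW; exists m.
  move: VN; rewrite VE W0 add0r big1 ?eqxx // => i _.
  by case: ifP; rewrite ?W0 mulr0.
(* Let [u] and [v] be the lowest and highest exponents of [W]. The extreme terms of the product
   cannot cancel, so [V] is nonzero at [u] and at [v + dl i1 > u], whereas it has a single term. *)
have [u Wu umin] := ex_minnP exW.
have uN : u = N0.
  apply/eqP; apply: contraT => /V0; rewrite VE big1 ?addr0 => [Wu0|i _].
    by rewrite Wu0 eqxx in Wu.
  case: ifP => [iu|_]; last by rewrite mulr0.
  suff -> : W (u - dl i)%N = 0 by rewrite mulr0.
  apply/eqP; apply: contraT => /umin.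
  by rewrite leqNgt ltn_subrL dl_gt0 (leq_trans (dl_gt0 i) iu).
have [X hX] := quot_comb_bounded n.
have ub m : W m != 0 -> (m <= Num.truncn (X - y0))%N.
  apply: contraNT; rewrite -ltnNge => h; apply/eqP; apply: hX.
  have : X - y0 < m%:R.
    by apply: lt_le_trans (truncnS_gt _) _; rewrite ler_nat.
  lra.
have [v Wv vmax] := ex_maxnP exW ub.
have vN : (v + dl i1)%N = N0.
  apply/eqP; apply: contraT => /V0; rewrite VE (bigD1 i1) //=.
  rewrite leq_addl addnK big1 ?addr0 => [h|i ii1]; last first.
    have [->|ci] := eqVneq (c i) 0; first by rewrite mulr0 mul0r.
    have lt := dl_i1 ii1 ci.
    rewrite (leq_trans (ltnW lt)) ?leq_addl //.
    suff -> : W (v + dl i1 - dl i)%N = 0 by rewrite mulr0.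
    apply/eqP; apply: contraT => /vmax.
    by rewrite leq_subLR addnC leq_add2r leqNgt lt.
  have W0 : W (v + dl i1)%N = 0.
    apply/eqP; apply: contraT => /vmax.
    by rewrite -{2}[v]addn0 leq_add2l leqNgt dl_gt0.
  move: h => /eqP; rewrite W0 add0r mulf_eq0 (negbTE Wv) orbF mulf_eq0.
  by rewrite invr_eq0 (negbTE c0_neq0) (negbTE c_i1).
by have := umin v Wv; rewrite uN -vN -{2}[v]addn0 leq_add2l leqNgt dl_gt0.
Qed.

(** [comb_class] at the exponent 0 yields, for each [n], a suitable nonzero point of the finite list
    [A]; one point serves infinitely many [n]. *)
Lemma int_multiples g : (0 < g)%N -> exists2 t, t != 0 &
  forall N : nat, exists2 n, (N <= n)%N & (lam ^+ g) ^+ n * t \is a Num.int.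
Proof.
move=> g0.
have q00 : q 0 != 0 by rewrite q_small // eqxx oner_neq0.
have [n|t tA ht] := @pigeonhole_infinite _ A
  (fun n t => t != 0 /\ (lam ^+ g) ^+ n.+1 * t \is a Num.int).
  have [t [t0 qt ht]] := comb_class (g * n.+1).-1 q00.
  exists t; first exact: q_supp.
  split=> //; move: ht; rewrite prednK ?muln_gt0 ?g0 // exprM sub0r mulrN.
  by rewrite rpredN.
have [n0 _ [t0 _]] := ht 0%N; exists t => // N.
have [n Nn [_ h]] := ht N; exists n.+1 => //; exact: leqW.
Qed.

(** Two integral multiples of one [t] have a power of [lam] as quotient, so some [lam ^+ g] is
    rational. The argument repeated for [lam ^+ g] gives an integer [z2] with [(lam ^+ g) ^+ m * z2]
    integral for arbitrarily large [m], which excludes a denominator. *)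
Lemma exists_int_power : exists l, (0 < l)%N /\ lam ^+ l \is a Num.int.
Proof.
have key g t N : (0 < g)%N -> t != 0 ->
    (forall N : nat, exists2 n, (N <= n)%N & (lam ^+ g) ^+ n * t \is a Num.int) ->
    exists z0 : int, z0 != 0 /\ exists m z, (N <= m)%N /\
      (lam ^+ g) ^+ m * z0%:~R = z%:~R :> R.
  move=> g0 t0 h; have [n0 _ /intrP[z0 hz0]] := h 0%N.
  have [n1 n01 /intrP[z1 hz1]] := h (n0 + N)%N.
  exists z0; split.
    by rewrite -(intr_eq0 R) -hz0 mulf_neq0 // !expf_neq0.
  exists (n1 - n0)%N, z1; split; first lia.
  rewrite -hz0 -hz1 mulrA -exprD subnK //; lia.
have [t t0 ht] := int_multiples (ltn0Sn 0).
have [z0 [z00 [g [z [g0 hg]]]]] := key 1%N t 1%N isT t0 ht.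
have lg : lam ^+ g = ratr (z%:~R / z0%:~R).
  rewrite fmorph_div /= !ratr_int -hg expr1; field.
  by rewrite intr_eq0.
exists g; split => //.
have [t' t'0 ht'] := int_multiples g0.
have [n0 _ /intrP[z2 hz2]] := ht' 0%N.
apply: (ratr_int_of_powers (z0 := z2) _ lg).
  by rewrite -(intr_eq0 R) -hz2 mulf_neq0 // !expf_neq0.
move=> N; have [n1 n01 /intrP[z1 hz1]] := ht' (n0 + N)%N.
exists (n1 - n0)%N, z1; split; first lia.
rewrite -hz2 -hz1 mulrA -exprD subnK //; lia.
Qed.

End Comb.

(** * The integer part of the comb *)

Section Independence.
Variables (R : realType) (lam : R) (k : nat) (L : nat).
Hypotheses (lam_gt1 : 1 < lam) (k_gt0 : (0 < k)%N) (lamk : lam ^+ k = L%:R)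
  (k_min : forall m, (0 < m < k)%N -> lam ^+ m \isn't a Num.int).

Let lam_gt0 : 0 < lam. Proof. exact: lt_trans lam_gt1. Qed.

(** The powers of [lam ^+ e] with exponent a multiple of [k] are integers; hence a rational
    [lam ^+ e] is itself an integer, and [k] is the least such exponent. *)
Lemma rational_power_ge (e : nat) (rho : rat) :
  (0 < e)%N -> lam ^+ e = ratr rho -> (k <= e)%N.
Proof.
move=> e0 h; rewrite leqNgt; apply/negP => ek.
have := k_min; move=> /(_ e); rewrite e0 ek => /(_ isT) /negP; apply.
apply: (@ratr_int_of_powers R rho (lam ^+ e) 1) => // N.
exists (k * N)%N, (L ^ (e * N))%:Z; split; first exact: leq_pmull.
by rewrite mulr1 -exprM mulnCA exprM lamk -natrX -pmulrn.
Qed.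

(* A common factor over the rationals of g and X^k - lam^k has all its roots of
   modulus lam, so its constant term shows that a power of lam of exponent
   its degree is rational. *)
Lemma rational_root_size (g : {poly rat}) :
  g != 0 -> root (map_poly (@ratr R) g) lam -> (k < size g)%N.
Proof.
move=> g0 gr; pose f : {poly rat} := 'X^k - (L%:R)%:P.
have f0 : f != 0 by rewrite -size_poly_gt0 size_XnsubC.
pose h := gcdp g f.
have h0 : h != 0 by rewrite gcdp_eq0 negb_and g0.
have hr : root (map_poly (@ratr R) h) lam.
  rewrite gcdp_map root_gcd gr /= /f rmorphB /= map_polyXn map_polyC /=.
  by rewrite /root !hornerE lamk ratr_nat subrr.
have sh : (1 < size h)%N.
  rewrite -(size_map_poly (@ratr R)); apply: root_size_gt1 hr.
  by rewrite map_poly_eq0.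
apply: leq_trans (dvdp_leq g0 (dvdp_gcdl g f)); rewrite -/h.
rewrite -[X in (_ < X)%N](prednK (ltnW sh)) ltnS.
(* The common factor is split over the algebraic numbers, because the moduli of all its roots are
   needed, not only the real root [lam]. *)
pose hC := map_poly (ratr : rat -> algC) h.
have [rs hrs] := closed_field_poly_normal hC.
have lh : lead_coef hC = ratr (lead_coef h) by rewrite lead_coef_map.
have lh0 : lead_coef h != 0 by rewrite lead_coef_eq0.
have srs : size rs = (size h).-1.
  rewrite -(size_map_poly (ratr : {rmorphism rat -> algC})) -/hC hrs.
  rewrite size_scale ?size_prod_XsubC // lh fmorph_eq0 //.
have rk z : z \in rs -> `|z| ^+ k = L%:R.
  move=> zrs; have : root hC z.
    by rewrite hrs rootZ ?root_prod_XsubC // lh fmorph_eq0.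
  rewrite /hC gcdp_map root_gcd => /andP[_].
  rewrite /f rmorphB /= map_polyXn map_polyC /= /root !hornerE ratr_nat.
  by rewrite subr_eq0 => /eqP; rewrite -normrX => ->; rewrite normr_nat.
(* The product of the moduli of the roots, a rational number. Its [k]-th power is [L] to the degree,
   so it equals [lam] to the degree. *)
pose rho := `|h.[0] / lead_coef h|.
have rhoE : rho ^+ k = L%:R ^+ (size h).-1.
  apply: (fmorph_inj (ratr : {rmorphism rat -> algC})).
  rewrite /rho rmorphXn /= ratr_norm fmorph_div /=.
  have -> : ratr h.[0] = hC.[0].
    by rewrite /hC -(rmorph0 (ratr : {rmorphism rat -> algC})) horner_map.
  rewrite {1}hrs hornerZ lh mulrC mulKf ?fmorph_eq0 // horner_prod.
  rewrite normr_prod -prodrXl rmorphXn /= ratr_nat -srs.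
  rewrite big_seq (eq_bigr (fun=> L%:R)) => [|z zrs].
    by rewrite -big_seq big_const_seq count_predT iter_mulr_1.
  by rewrite !hornerE ?sub0r ?add0r normrN rk.
apply: (@rational_power_ge _ rho); first by rewrite -subn1 subn_gt0.
have lp : 0 <= lam ^+ (size h).-1 by rewrite exprn_ge0 // ltW.
have rp : 0 <= ratr rho :> R by rewrite ler0q normr_ge0.
apply: (pexpIrn k_gt0); rewrite ?nnegrE //.
have := congr1 (@ratr R) rhoE; rewrite !rmorphXn /= ratr_nat => ->.
by rewrite -exprM mulnC exprM lamk.
Qed.

Lemma powers_independent (r : nat -> rat) :
  \sum_(i < k) ratr (r i) * lam ^+ i = 0 -> forall i, (i < k)%N -> r i = 0.
Proof.
move=> h; pose g := \poly_(i < k) r i.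
have [g0|g0] := eqVneq g 0.
  by move=> i ik; have := congr1 (fun p : {poly rat} => p`_i) g0; rewrite coef_poly ik coef0.
have : (k < size g)%N; last by rewrite ltnNge size_poly.
apply: rational_root_size => //; rewrite /root -h; apply/eqP.
have -> : map_poly (@ratr R) g = \poly_(i < k) ratr (r i).
  by apply/polyP => i; rewrite coef_map !coef_poly; case: ifP => // _; exact: rmorph0.
by rewrite horner_poly.
Qed.

End Independence.

Section IntegerPart.
Variables (R : realType) (I : finType) (lam c0 e : R) (c : I -> R) (dl : I -> nat).
Variables (A : seq R) (q : R -> R) (k L : nat).
Hypotheses (lam_gt1 : 1 < lam) (c0_neq0 : c0 != 0)
  (dl_gt0 : forall i, (0 < dl i)%N) (e_gt0 : 0 < e).
Hypotheses (q_supp : forall a, q a != 0 -> a \in A)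
  (q_ref : forall b, q b = q (b / lam) - \sum_i c0^-1 * c i * q (b - (dl i)%:R))
  (q_small : forall b, b < e -> q b = (b == 0)%:R).
Hypotheses (k_gt0 : (0 < k)%N) (lamk : lam ^+ k = L%:R)
  (k_min : forall m, (0 < m < k)%N -> lam ^+ m \isn't a Num.int).

Let lam_gt0 : 0 < lam. Proof. exact: lt_trans lam_gt1. Qed.
Let lam_neq0 : lam != 0. Proof. by rewrite gt_eqF. Qed.
Let L_neq0 : L%:R != 0 :> R. Proof. by rewrite -lamk expf_neq0. Qed.

(** The recursion reaches [y] only from [y / lam] or from some [y - dl i]. Multiplication by [lam]
    preserves the semigroup because the overflow [lam ^+ k] is the integer [L], carried back to the
    coordinate 0. *)
Lemma supp_lattice t : q t != 0 ->
  exists n : nat -> nat, t = \sum_(i < k) (n i)%:R * lam ^+ i.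
Proof.
move: t; apply: (@refinement_ind R lam e) => //.
  move=> x xe; rewrite q_small //; have [-> _|_] := eqVneq x 0; last by rewrite eqxx.
  by exists (fun=> 0%N); rewrite big1 // => i _; rewrite mul0r.
move=> y y0 H1 H2 qy.
have [qy1|qy1] := eqVneq (q (y / lam)) 0; last first.
  have [n hn] := H1 qy1; have {hn} yE : y = lam * \sum_(i < k) (n i)%:R * lam ^+ i.
    by rewrite -hn; field.
  have lk : L%:R = lam * lam ^+ k.-1 by rewrite -lamk -exprS prednK.
  exists (fun i => if i is j.+1 then n j else (L * n k.-1)%N).
  rewrite yE mulr_sumr -(prednK k_gt0) big_ord_recr big_ord_recl /= addrC.
  congr (_ + _).
    by rewrite expr0 mulr1 natrM lk; ring.
  by apply: eq_bigr => i _; rewrite /bump /= add1n exprS; ring.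
have [i qi] : exists i, q (y - (dl i)%:R) != 0.
  apply: contrapT => NE; move: qy; rewrite q_ref qy1 big1 ?subrr ?eqxx // => i _.
  have [->|qi] := eqVneq (q (y - (dl i)%:R)) 0; first by rewrite mulr0.
  by case: NE; exists i.
have [|n hn] := H2 _ _ qi; first by rewrite lerD2l lerN2 ler1n.
exists (fun i0 => if i0 is j.+1 then n i0 else (n 0 + dl i)%N).
have -> : y = y - (dl i)%:R + (dl i)%:R by rewrite subrK.
rewrite hn -(prednK k_gt0) !big_ord_recl /= !expr0 !mulr1 natrD.
by rewrite addrAC.
Qed.

Lemma supp_coord t (r : nat -> rat) : q t != 0 ->
  t = \sum_(i < k) ratr (r i) * lam ^+ i -> exists n : nat, r 0%N = n%:R.
Proof.
move=> /supp_lattice[n hn] hr; exists (n 0%N).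
apply/eqP; rewrite -subr_eq0; apply/eqP.
apply: (powers_independent lam_gt1 k_gt0 lamk k_min
  (r := fun i => r i - (n i)%:R) _ k_gt0).
under eq_bigr do rewrite rmorphB /= ratr_nat mulrBl.
by rewrite sumrB -hr -hn subrr.
Qed.

(** Since [m / lam ^+ j = (m / L) lam ^+ (k - j)], the coordinate of this point at [lam ^+ 0] is
    [- d < 0], which no point of the support has. *)
Lemma q_shift_eq0 (m j d : nat) : (0 < j < k)%N -> (0 < d)%N ->
  q (m%:R / lam ^+ j - d%:R) = 0.
Proof.
move=> /andP[j0 jk] d0; apply/eqP; apply: contraT => qn.
have kj : (k - j < k)%N by lia.
have kj0 : (0 < k - j)%N by lia.
pose r i : rat := if i == 0%N then - d%:R else
  if i == (k - j)%N then m%:R / L%:R else 0.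
have [|n] := supp_coord (r := r) qn.
  rewrite -(big_mkord xpredT (fun i => ratr (r i) * lam ^+ i)).
  rewrite big_ltn // (big_cat_nat (n := (k - j)%N)) //=; last exact: ltnW.
  rewrite [X in _ + (_ + X)]big_ltn // big_nat_cond big1 ?add0r; last first.
    move=> i /andP[/andP[i0 ij] _]; rewrite /r gtn_eqF // ltn_eqF //.
    by rewrite rmorph0 mul0r.
  rewrite big_nat_cond big1 ?addr0; last first.
    move=> i /andP[/andP[i0 ij] _]; rewrite /r !gtn_eqF //.
      by rewrite rmorph0 mul0r.
    exact: leq_trans i0.
  have -> : r 0%N = - d%:R by [].
  have -> : r (k - j)%N = m%:R / L%:R by rewrite /r gtn_eqF // eqxx.
  rewrite rmorphN fmorph_div /= !ratr_nat expr0 mulr1 addrC; congr (_ + _).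
  have -> : L%:R = lam ^+ (k - j) * lam ^+ j by rewrite -exprD subnK ?lamk // ltnW.
  by field; rewrite !expf_neq0.
rewrite /r /= => /eqP; rewrite eq_sym -subr_eq0 opprK -natrD pnatr_eq0.
lia.
Qed.

Definition int_part (y : R) : R := if y \is a Num.nat then q y else 0.

Lemma int_part_supp a : int_part a != 0 -> a \in A.
Proof. by rewrite /int_part; case: ifP => _; [exact: q_supp|rewrite eqxx]. Qed.

Lemma int_part_small b : b < e -> int_part b = (b == 0)%:R.
Proof.
move=> be; rewrite /int_part; have [->|b0] := eqVneq b 0.
  by case: ifP => [_|/negP[]]; [rewrite q_small // eqxx|exact: rpred0].
by case: ifP => // _; rewrite q_small // (negbTE b0).
Qed.

(** The recursion for [q] is followed [k] times from an integer [m]. At the intermediate points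
    [m / lam ^+ j], [0 < j < k], the shifted terms vanish by [q_shift_eq0], so the mask acts only
    once. *)
Lemma int_part_refinement b :
  int_part b = int_part (b / lam ^+ k) -
    \sum_i c0^-1 * c i * int_part (b - (dl i)%:R).
Proof.
have q_neg y : y < 0 -> q y = 0.
  by move=> y0; rewrite q_small ?(lt_trans y0) // lt_eqF.
have [|bN] := boolP (b \is a Num.nat); last first.
  rewrite {1}/int_part (negbTE bN) /int_part ifN ?big1 ?subrr // => [i _|].
    rewrite ifN ?mulr0 //; apply: contra bN => h.
    by rewrite -(subrK (dl i)%:R b) rpredD ?natr_nat.
  by apply: contra bN => h; rewrite -(divfK L_neq0 b) rpredM ?natr_nat // -lamk.
move=> /natrP[m ->].
have chain j : (0 < j <= k)%N -> q (m%:R / lam) = q (m%:R / lam ^+ j).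
  elim: j => [//|j IH] /andP[_ jk]; have [->|j0] := posnP j; first by rewrite expr1.
  rewrite IH ?j0 ?(ltnW jk) // q_ref big1 ?subr0 => [|i _]; last first.
    by rewrite q_shift_eq0 ?mulr0 // j0 jk.
  by rewrite exprSr invfM mulrA.
(* The point is the rational [m / L]; by independence a rational point of the support is a natural
   number. *)
have -> : int_part (m%:R / lam ^+ k) = q (m%:R / lam ^+ k).
  rewrite /int_part; case: ifPn => // h; apply/esym/eqP; apply: contraT => qn.
  have [|n] := supp_coord (r := fun i => if i == 0%N then m%:R / L%:R else 0) qn.
    rewrite -(prednK k_gt0) big_ord_recl /= expr0 mulr1 fmorph_div /= !ratr_nat.
    rewrite big1 ?addr0 ?prednK ?lamk // => i _.
    by rewrite rmorph0 mul0r.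
  move=> /= hn; case/negP: h; apply/natrP; exists n.
  by have := congr1 (@ratr R) hn; rewrite fmorph_div /= !ratr_nat lamk.
rewrite -chain ?k_gt0 ?leqnn // {1}/int_part natr_nat q_ref; congr (_ - _).
apply: eq_bigr => i _; congr (_ * _); rewrite /int_part.
case: ifPn => // /negP h; have [mi|mi] := leqP (dl i) m.
  by case: h; rewrite -natrB // natr_nat.
by rewrite q_neg // subr_lt0 ltr_nat.
Qed.

End IntegerPart.

(** In [(a + d) ^+ m] only [a ^+ m] survives, the lower moments being 0. This relates the first
    nonzero moment to the sum of the mask. *)
Lemma moment_refinement (R : realType) (I : finType) (mu c0 : R) (c : I -> R)
    (dl : I -> nat) (A : seq R) (q : R -> R) (m : nat) :
  (forall phi : R -> R, c0 * \sum_(a <- A) q a * phi (mu * a) =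
    c0 * \sum_(a <- A) q a * phi a +
    \sum_i c i * \sum_(a <- A) q a * phi (a + (dl i)%:R)) ->
  (forall i, (i < m)%N -> \sum_(a <- A) q a * a ^+ i = 0) ->
  \sum_(a <- A) q a * a ^+ m != 0 ->
  c0 * mu ^+ m = c0 + \sum_i c i.
Proof.
move=> H M0 Mm; apply: (mulIf Mm); have := H (fun x => x ^+ m).
under eq_bigr do rewrite exprMn mulrCA.
rewrite -mulr_sumr mulrA => ->; rewrite mulrDl mulr_suml; congr (_ + _).
apply: eq_bigr => i _; congr (_ * _).
under eq_bigr do rewrite addrC exprDn mulr_sumr.
rewrite exchange_big /= big_ord_recr /= subnn binn big1 ?add0r.
  by apply: eq_bigr => a _; rewrite expr0 mul1r mulr1n.
move=> j _; transitivity ((dl i)%:R ^+ (m - j) *+ 'C(m, j) *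
    \sum_(a <- A) q a * a ^+ j).
  by rewrite mulr_sumr; apply: eq_bigr => a _; rewrite mulrnAl mulrnAr; congr (_ *+ _); ring.
by rewrite M0 ?mulr0.
Qed.

(** * Smooth bumps and cutoffs *)

(** The negative power makes the family stable under differentiation up to linear combinations, so
    smoothness is a single induction. *)
Definition flat_exp (R : realType) (n : nat) (x : R) : R :=
  if 0 < x then x ^- n * expR (- x^-1) else 0.

Lemma flat_exp_le (R : realType) n (x : R) : 0 < x ->
  flat_exp n x <= (n.+1)`!%:R * x.
Proof.
move=> x0; rewrite /flat_exp x0 expRN.
have xi : 0 < x^-1 by rewrite invr_gt0.
have h := expR_ge1Dxn n (ltW xi).
have p : 0 < x ^+ n by rewrite exprn_gt0.
have f0 : 0 < (n.+1)`!%:R :> R by rewrite ltr0n fact_gt0.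
rewrite -invfM -[leRHS]invrK lef_pV2 ?posrE; last 2 first.
- by rewrite mulr_gt0 ?expR_gt0.
- by rewrite invr_gt0 mulr_gt0.
apply: le_trans (ler_wpM2l (ltW p) h); rewrite invfM.
have -> : x ^+ n * (1 + x^-1 ^+ n.+1 / (n.+1)`!%:R) =
    x ^+ n + (n.+1)`!%:R^-1 / x.
  by rewrite exprVn exprS; field; rewrite !gt_eqF.
by rewrite lerDr ltW.
Qed.

Lemma flat_exp_ge0 (R : realType) n (x : R) : 0 <= flat_exp n x.
Proof.
rewrite /flat_exp; case: ltP => // x0.
by rewrite mulr_ge0 ?expR_ge0 // invr_ge0 exprn_ge0 // ltW.
Qed.

Lemma flat_exp_derive (R : realType) n (x : R) :
  is_derive x 1 (flat_exp n) (flat_exp n.+2 x - n%:R * flat_exp n.+1 x).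
Proof.
have [x0|] := ltP 0 x.
  have E : \forall y \near x, (y ^+ n)^-1 * expR (- y^-1) = flat_exp n y.
    by move: (lt_nbhsr x0); apply: filterS => y y0; rewrite /flat_exp y0.
  have xn0 : x != 0 by rewrite gt_eqF.
  have xnn : x ^+ n != 0 by rewrite expf_neq0.
  have d1 : is_derive x 1 (fun y : R => y ^+ n) (n%:R * x ^+ n.-1).
    have -> : (fun y : R => y ^+ n) = horner 'X^n.
      by apply/funext => y; rewrite hornerXn.
    apply: (is_derive_eq (is_derive_poly 'X^n x)).
    by rewrite derivXn hornerMn hornerXn mulr_natl.
  have d2 := @is_deriveV R (fun y => y ^+ n) x _ 1 xnn d1.
  have d3 : is_derive x 1 (fun y : R => - y^-1) (x ^- 2).
    have := is_deriveN (@is_deriveV R id x 1 1 xn0 (is_derive_id x (1 : R))).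
    by move=> h; apply: (is_derive_eq h); rewrite /GRing.scale /= mulr1 opprK.
  have d4 := @is_derive1_comp R expR (fun y => - y^-1) x _ _
    (is_derive_expR (- x^-1)) d3.
  have := is_deriveM d2 d4.
  move=> h; apply: (is_derive_eq (near_eq_is_derive E h)).
  rewrite /GRing.scale /= /flat_exp x0.
  case: n xnn E d1 d2 h => [|n] xnn _ _ _ _.
    by rewrite !expr0 invr1 /=; ring.
  rewrite /= !exprS; field.
  by rewrite expf_neq0 // xn0.
rewrite le_eqVlt => /orP[/eqP->|x0]; last first.
  rewrite /flat_exp !ltNge (ltW x0) /= mulr0 subrr.
  have E : \forall y \near x, cst 0 y = flat_exp n y.
    by move: (lt_nbhsl x0); apply: filterS => y y0; rewrite /flat_exp ltNge ltW.
  exact: near_eq_is_derive E (is_derive_cst _ _ _).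
rewrite /flat_exp !ltxx mulr0 subrr -/(flat_exp n).
(* For [h > 0] the difference quotient at 0 is [flat_exp n.+1 h], which [flat_exp_le] sends to 0. *)
have H : (fun h : R => h^-1 *: (flat_exp n (h *: 1 + 0) - flat_exp n 0)) @ 0^'
    --> (0 : R).
  apply/cvgrPdist_le => e e0; near=> h.
  have h0 : h != 0 by near: h; exact: nbhs_dnbhs_neq.
  have -> : flat_exp n 0 = 0 :> R by rewrite /flat_exp ltxx.
  rewrite sub0r normrN subr0 addr0 /GRing.scale /= mulr1.
  have [hp|hn] := ltP 0 h; last first.
    have -> : flat_exp n h = 0 by rewrite /flat_exp ltNge hn.
    by rewrite mulr0 normr0 ltW.
  have -> : h^-1 * flat_exp n h = flat_exp n.+1 h.
    by rewrite /flat_exp hp exprS invfM mulrA.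
  rewrite ger0_norm ?flat_exp_ge0 //; apply: le_trans (flat_exp_le _ hp) _.
  rewrite mulrC -ler_pdivlMr ?ltr0n ?fact_gt0 //; apply: le_trans (ler_norm _) _.
  near: h; apply: dnbhs0_le; rewrite divr_gt0 ?ltr0n ?fact_gt0 //.
by apply: DeriveDef; [apply/cvg_ex; exists 0|apply: cvg_lim H].
Unshelve. all: end_near. Qed.

Lemma ndiff_near_flat_exp (R : realType) m n (x : R) : ndiff_near m (flat_exp n) x.
Proof.
elim: m n => //= m IH n.
exists (fun x => flat_exp n.+2 x - n%:R * flat_exp n.+1 x).
  by near do exact: flat_exp_derive.
rewrite (_ : (fun _ => _) =
    fun y => flat_exp n.+2 y + (- n%:R) * flat_exp n.+1 y).
  by apply: ndiff_nearD => //; apply: ndiff_nearZ.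
by apply/funext => y; rewrite mulNr.
Unshelve. all: end_near. Qed.

Lemma ndiff_near_shift (R : realType) n (f : R -> R) (b x : R) :
  ndiff_near n f (x - b) -> ndiff_near n (fun y => f (y - b)) x.
Proof.
have -> : (fun y => f (y - b)) = (fun y => f (1 * y - b)).
  by apply/funext => y; rewrite mul1r.
by move=> h; apply: ndiff_near_affine; rewrite mul1r.
Qed.

Lemma ndiff_near_reflect (R : realType) n (f : R -> R) (b x : R) :
  ndiff_near n f (b - x) -> ndiff_near n (fun y => f (b - y)) x.
Proof.
have -> : (fun y => f (b - y)) = (fun y => f (-1 * y + b)).
  by apply/funext => y; rewrite mulN1r addrC.
by move=> h; apply: ndiff_near_affine; rewrite mulN1r addrC.
Qed.

Lemma flat_exp0_gt0 (R : realType) (x : R) : (0 < flat_exp 0 x) = (0 < x).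
Proof.
rewrite /flat_exp; case: ifP => [x0|]; last by rewrite ltxx.
by rewrite expr0 invr1 mul1r expR_gt0.
Qed.

Lemma bump_exists (R : realType) (a b : R) : exists g : R -> R,
  [/\ forall n x, ndiff_near n g x, forall x, 0 <= g x,
      forall x, a < x < b -> 0 < g x & forall x, ~~ (a < x < b) -> g x = 0].
Proof.
exists (fun x => flat_exp 0 (x - a) * flat_exp 0 (b - x)); split.
- move=> n x; apply: ndiff_nearM.
    by apply: ndiff_near_shift; exact: ndiff_near_flat_exp.
  by apply: ndiff_near_reflect; exact: ndiff_near_flat_exp.
- by move=> x; rewrite mulr_ge0 // flat_exp_ge0.
- move=> x /andP[ax xb]; apply: mulr_gt0; rewrite flat_exp0_gt0 subr_gt0 //.
- move=> x; rewrite negb_and -!leNgt => /orP[xa|bx].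
    by rewrite {1}/flat_exp subr_gt0 ltNge xa mul0r.
  by rewrite {2}/flat_exp subr_gt0 ltNge bx mulr0.
Qed.

Lemma cutoff_exists (R : realType) (r : R) : exists g : R -> R,
  [/\ forall n x, ndiff_near n g x, forall x, `|x| <= r -> g x = 1
    & forall x, r + 1 < `|x| -> g x = 0].
Proof.
pose d (x : R) := flat_exp 0 x + flat_exp 0 (1 - x).
have d0 x : d x != 0.
  rewrite gt_eqF // /d; have [x0|x0] := ltP 0 x.
    by rewrite ltr_wpDr ?flat_exp_ge0 // flat_exp0_gt0.
  by rewrite ltr_wpDl ?flat_exp_ge0 // flat_exp0_gt0; lra.
pose E (x : R) := flat_exp 0 x * (d x)^-1.
have En n x : ndiff_near n E x.
  apply: ndiff_nearM; first exact: ndiff_near_flat_exp.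
  apply: ndiff_nearV => //; apply: ndiff_nearD; first exact: ndiff_near_flat_exp.
  by apply: ndiff_near_reflect; exact: ndiff_near_flat_exp.
have E0 x : x <= 0 -> E x = 0.
  by move=> x0; rewrite /E /flat_exp ltNge x0 mul0r.
have E1 x : 1 <= x -> E x = 1.
  move=> x1; rewrite /E /d [flat_exp 0 (1 - x)]/flat_exp subr_gt0 ltNge x1 addr0.
  by rewrite divff // gt_eqF // flat_exp0_gt0; lra.
exists (fun x => E (x - (- (r + 1))) * E (r + 1 - x)); split.
- move=> n x; apply: ndiff_nearM; first exact: ndiff_near_shift.
  exact: ndiff_near_reflect.
- by move=> x; rewrite ler_norml => /andP[a b]; rewrite !E1 ?mulr1 //; lra.
- move=> x; have [x0|x0] := ltP 0 x.
    rewrite gtr0_norm // => h; rewrite [X in _ * X]E0 ?mulr0 //; lra.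
  rewrite ler0_norm // => h; rewrite E0 ?mul0r //; lra.
Qed.

Lemma fsupp_itv (R : realType) (g : R -> R) (a b : R) :
  (forall x, g x != 0 -> a <= x <= b) -> fsupp g `<=` [set` `[a, b]].
Proof.
move=> h x gx; apply: (@interval_closed R (BLeft a) (BRight b) isT isT).
by apply: closure_subset gx => y /= gy; rewrite in_itv /=; exact: h.
Qed.

Lemma test_functionP (R : realType) (g : R -> R) : test_function g <->
  (forall n x, ndiff_near n g x) /\ exists r, forall x, r < `|x| -> g x = 0.
Proof.
split=> [[/smooth_onTP gs /compact_bounded[M [Mr hM]]]|[gs [r hr]]].
  split=> //; exists (M + 1) => x xM; apply/eqP; apply: contraTT xM => gx.
  rewrite -leNgt; apply: (hM (M + 1)); first by rewrite ltrDl.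
  exact: subset_closure.
split; first exact/smooth_onTP.
apply: (subclosed_compact (@closed_closure _ _) (@segment_compact _ (- r) r)).
apply: fsupp_itv => x gx; rewrite -ler_norml leNgt.
by apply: contra gx => /hr ->.
Qed.

Lemma smooth_derive1n (R : realType) n (f : R -> R) :
  (forall n x, ndiff_near n f x) -> forall m x, ndiff_near m (derive1n n f) x.
Proof.
move=> /smooth_onTP fs; apply/smooth_onTP => m x _.
by rewrite /derive1n -iterD; exact: fs.
Qed.

Lemma is_derive_derive1n (R : realType) n (f : R -> R) (x : R) :
  (forall n x, ndiff_near n f x) ->
  is_derive x 1 (derive1n n f) (derive1n n.+1 f x).
Proof.
by move=> fs; rewrite derive1nS derive1E; apply: derivableP; apply/ndiff_near_derivable.
Qed.

Lemma derive1_eq (R : realType) (f g : R -> R) :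
  (forall x : R, is_derive x 1 f (g x)) -> f^`()%classic = g.
Proof. by move=> fg; apply/funext => x; rewrite derive1E; case: (fg x). Qed.

Lemma derive1nD (R : realType) n (f g : R -> R) :
  (forall n x, ndiff_near n f x) -> (forall n x, ndiff_near n g x) ->
  derive1n n (fun x => f x + g x) = fun x => derive1n n f x + derive1n n g x.
Proof.
move=> fs gs; elim: n => [//|n IH]; rewrite derive1nS IH; apply: derive1_eq => x.
by apply: is_deriveD; exact: is_derive_derive1n.
Qed.

Lemma derive1nZ (R : realType) n a (f : R -> R) :
  (forall n x, ndiff_near n f x) ->
  derive1n n (fun x => a * f x) = fun x => a * derive1n n f x.
Proof.
move=> fs; elim: n => [//|n IH]; rewrite derive1nS IH; apply: derive1_eq => x.
exact: (is_deriveZ a (is_derive_derive1n n x fs)).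
Qed.

Lemma derive1n_sum (R : realType) n (T : Type) (s : seq T) (f : T -> R -> R) :
  (forall i n x, ndiff_near n (f i) x) ->
  derive1n n (fun x => \sum_(i <- s) f i x) =
  fun x => \sum_(i <- s) derive1n n (f i) x.
Proof.
move=> fs; elim: s => [|i s IH].
  have -> : (fun x => \sum_(i <- [::]) f i x) = cst 0.
    by apply/funext => x; rewrite big_nil.
  have -> : derive1n n (cst 0) = cst (0 : R).
    by elim: n => [//|n IH]; rewrite derive1nS IH; apply: derive1_eq => x.
  by apply/funext => x; rewrite big_nil.
have -> : (fun x => \sum_(j <- i :: s) f j x) =
    (fun x => f i x + \sum_(j <- s) f j x).
  by apply/funext => x; rewrite big_cons.
rewrite derive1nD //; last by move=> m x; exact: ndiff_near_sum.
by rewrite IH; apply/funext => x; rewrite big_cons.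
Qed.

Lemma derive1n_affine (R : realType) n (a b : R) (f : R -> R) :
  (forall n x, ndiff_near n f x) ->
  derive1n n (fun x => f (a * x + b)) = fun x => a ^+ n * derive1n n f (a * x + b).
Proof.
move=> fs; elim: n => [|n IH]; first by apply/funext => x; rewrite expr0 mul1r.
rewrite derive1nS IH; apply: derive1_eq => x.
have := is_derive_affine (is_derive_derive1n n (a * x + b) fs).
move=> /(is_deriveZ (a ^+ n)) h; apply: (is_derive_eq h).
by rewrite /GRing.scale /= exprSr mulrA.
Qed.

(** Leibniz's rule by induction on the order, [chi] varying because its derivative is again
    supported in [[-r, r]]. The point is that [C] is independent of [v], as the continuity of
    distributions requires. *)
Lemma cutoff_mul_bound (R : realType) (r : R) i (chi : R -> R) : 0 <= r ->
  (forall n x, ndiff_near n chi x) -> (forall x, r < `|x| -> chi x = 0) ->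
  exists C : R, 0 <= C /\ forall (v : R -> R) (B : R),
    (forall n x, ndiff_near n v x) ->
    (forall j x, (j <= i)%N -> `|x| <= r -> `|derive1n j v x| <= B) ->
    forall x, `|derive1n i (fun y => chi y * v y) x| <= C * B.
Proof.
move=> r0; elim: i chi => [|i IH] chi cs c0.
  have [M hM] : exists M : R, forall x, `|chi x| <= M.
    have cc : {within `[- r, r], continuous chi}.
      apply: continuous_subspaceT => x; exact: ndiff_near_cont (cs 1%N x).
    have := compact_bounded (continuous_compact cc (@segment_compact _ _ _)).
    move=> [M [_ hM]]; exists (`|M| + 1) => x.
    have Mp : M < `|M| + 1 by have := ler_norm M; lra.
    have [xr|rx] := leP `|x| r; last by rewrite c0 // normr0 addr_ge0.
    by apply: (hM _ Mp); exists x => //=; rewrite in_itv /= -ler_norml.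
  have M0 : 0 <= M by apply: le_trans (hM 0).
  exists M; split=> // v B vs hv x /=; rewrite normrM.
  have [xr|rx] := leP `|x| r.
    by apply: ler_pM => //; exact: (hv 0%N x).
  rewrite c0 // normr0 mul0r; apply: mulr_ge0 => //.
  by apply: le_trans (hv 0%N 0 _ _); rewrite ?normr0.
have c's m x : ndiff_near m (derive1n 1 chi) x by exact: smooth_derive1n.
have c'0 x : r < `|x| -> derive1n 1 chi x = 0.
  move=> rx; have E : \forall y \near x, cst 0 y = chi y.
    have : \forall y \near x, r < `|y|.
      have nc : {for x, continuous (fun y : R => `|y|)} by exact: norm_continuous.
      exact: (nc _ (lt_nbhsr rx)).
    by apply: filterS => y ry; rewrite c0.
  have := near_eq_is_derive E (is_derive_cst (0 : R) x (1 : R)).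
  by rewrite derive1n1 derive1E => -[_ ->].
have [C1 [C10 h1]] := IH _ c's c'0; have [C2 [C20 h2]] := IH _ cs c0.
exists (C1 + C2); split; first exact: addr_ge0.
move=> v B vs hv x; rewrite derive1Sn.
have -> : (fun y => chi y * v y)^`()%classic =
    fun y => derive1n 1 chi y * v y + chi y * derive1n 1 v y.
  apply: derive1_eq => y.
  have := is_deriveM (is_derive_derive1n 0 y cs) (is_derive_derive1n 0 y vs).
  by move=> h; apply: (is_derive_eq h); rewrite /GRing.scale /= addrC [v y * _]mulrC.
have v's m y : ndiff_near m (derive1n 1 v) y by exact: smooth_derive1n.
rewrite derive1nD; last 2 first.
- by move=> m y; apply: ndiff_nearM.
- by move=> m y; apply: ndiff_nearM.
apply: le_trans (ler_normD _ _) _; rewrite mulrDl; apply: lerD.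
  by apply: h1 => // j y ji yr; apply: hv => //; exact: leqW.
by apply: h2 => // j y ji yr; rewrite derive1n1 -derive1Sn; exact: hv.
Qed.

(** * The transfer operator on smooth functions *)

Definition smooth_fun (R : realType) (g : R -> R) := forall n x, ndiff_near n g x.

Definition geometric (R : realType) (L : R) (u : nat -> R -> R) :=
  exists C th : R, [/\ 0 <= C, 0 < th, th < 1 &
    forall n y, `|y| <= L -> `|u n y| <= C * th ^+ n].

Lemma geometric_le (R : realType) (L K : R) (u v : nat -> R -> R) :
  0 <= K -> geometric L u ->
  (forall n y C, `|y| <= L -> (forall z, `|z| <= L -> `|u n z| <= C) ->
     `|v n y| <= K * C) ->
  geometric L v.
Proof.
move=> K0 [C [th [C0 th0 th1 hu]]] h; exists (K * C), th; split=> //.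
  exact: mulr_ge0.
by move=> n y yL; rewrite -mulrA; apply: h => // z zL; exact: hu.
Qed.

Lemma geometric_common (R : realType) (L : R) m (u : nat -> nat -> R -> R) :
  (forall j, (j <= m)%N -> geometric L (u j)) ->
  exists C th : R, [/\ 0 <= C, 0 < th, th < 1 &
    forall j n y, (j <= m)%N -> `|y| <= L -> `|u j n y| <= C * th ^+ n].
Proof.
elim: m => [|m IH] h.
  have [C [th [C0 th0 th1 hu]]] := h 0%N (leqnn _).
  exists C, th; split=> // j n y; rewrite leqn0 => /eqP ->; exact: hu.
have [|C1 [t1 [C10 t10 t11 h1]]] := IH; first by move=> j jm; apply: h; exact: leqW.
have [C2 [t2 [C20 t20 t21 h2]]] := h m.+1 (leqnn _).
have ge_pow (a b : R) n : 0 < a -> a <= b -> a ^+ n <= b ^+ n.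
  by move=> a0 ab; apply: lerXn2r; rewrite ?nnegrE ?(ltW a0) // (le_trans (ltW a0)).
exists (C1 + C2), (Num.max t1 t2); split.
- exact: addr_ge0.
- by rewrite lt_max t10.
- by rewrite gt_max t11.
- have m0 n : 0 <= Num.max t1 t2 ^+ n by rewrite exprn_ge0 // le_max (ltW t10).
  move=> j n y; rewrite leq_eqVlt => /orP[/eqP->|jm] yL.
    apply: le_trans (h2 n y yL) _; apply: ler_pM => //; first exact/exprn_ge0/ltW.
      by rewrite lerDr.
    by apply: ge_pow => //; rewrite le_max lexx orbT.
  apply: le_trans (h1 j n y jm yL) _; apply: ler_pM => //; first exact/exprn_ge0/ltW.
    by rewrite lerDl.
  by apply: ge_pow => //; rewrite le_max lexx.
Qed.

Lemma geometric_eq0 (R : realType) (X C th : R) : 0 < th -> th < 1 ->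
  (forall n, `|X| <= C * th ^+ n) -> X = 0.
Proof.
move=> th0 th1 h; apply/eqP/negPn/negP => X0; have X1 : 0 < `|X| by rewrite normr_gt0.
have i1 : 1 < th^-1 by rewrite invf_gt1.
have [n hn] := exprn_unbounded (C / `|X|) i1.
have := h n; rewrite leNgt => /negP; apply.
move: hn; rewrite exprVn ltr_pdivrMr // => hn.
by rewrite -ltr_pdivlMr ?exprn_gt0 // mulrC.
Qed.

Lemma smooth_bounded (R : realType) (L : R) (g : R -> R) : smooth_fun g ->
  exists2 M : R, 0 <= M & forall y, `|y| <= L -> `|g y| <= M.
Proof.
move=> gs; have gc : {within `[- L, L], continuous g}.
  apply: continuous_subspaceT => x; exact: ndiff_near_cont (gs 1%N x).
have := compact_bounded (continuous_compact gc (@segment_compact _ _ _)).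
move=> [M [_ hM]]; exists (`|M| + 1); first exact: addr_ge0.
have Mp : M < `|M| + 1 by have := ler_norm M; lra.
by move=> x xr; apply: (hM _ Mp); exists x => //=; rewrite in_itv /= -ler_norml.
Qed.

Lemma smooth_lipschitz (R : realType) (L C : R) (g : R -> R) : smooth_fun g ->
  (forall y, `|y| <= L -> `|derive1n 1 g y| <= C) ->
  forall a b, `|a| <= L -> `|b| <= L -> `|g a - g b| <= 2 * L * C.
Proof.
move=> gs hC.
have H a b : `|a| <= L -> `|b| <= L -> a <= b -> `|g a - g b| <= 2 * L * C.
  move=> aL bL ab.
  have [||c] := @MVT_segment R g (derive1n 1 g) a b ab.
  - by move=> x _; exact: (is_derive_derive1n 0).
  - by apply: continuous_subspaceT => x; exact: ndiff_near_cont (gs 1%N x).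
  rewrite in_itv /= => /andP[ac cb] E; rewrite distrC E normrM mulrC.
  move: aL bL; rewrite !ler_norml => /andP[aL1 aL2] /andP[bL1 bL2].
  apply: ler_pM => //.
    by rewrite ger0_norm; lra.
  by apply: hC; rewrite ler_norml; apply/andP; split; lra.
move=> a b aL bL; have [ab|/ltW ba] := leP a b; first exact: H.
by rewrite distrC; apply: H.
Qed.

Section Transfer.
Variables (R : realType) (J : finType) (mu : R) (b t : J -> R).
Hypotheses (mu_gt1 : 1 < mu) (b_sum : \sum_j b j = mu).

Let mu_gt0 : 0 < mu. Proof. exact: lt_trans mu_gt1. Qed.
Let mu_neq0 : mu != 0. Proof. by rewrite gt_eqF. Qed.

(** The transpose of refinement: a refinable distribution takes the same value at [g] and at
    [transfer g]. The sum of the [b j] being [mu], constants are fixed. *)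
Definition transfer (g : R -> R) (y : R) : R :=
  \sum_j b j * (mu^-1 * g ((y + t j) / mu)).

Lemma transfer_affine g : transfer g =
  fun y => \sum_j (b j * mu^-1) * g (mu^-1 * y + t j / mu).
Proof.
apply/funext => y; apply: eq_bigr => j _.
by rewrite mulrA mulrDl [y / _]mulrC.
Qed.

Lemma smooth_dilate (g : R -> R) a u :
  smooth_fun g -> smooth_fun (fun y => g (a * y + u)).
Proof. by move=> gs n x; exact: ndiff_near_affine. Qed.

Lemma smooth_transfer g : smooth_fun g -> smooth_fun (transfer g).
Proof.
move=> gs n x; rewrite transfer_affine; apply: ndiff_near_sum => j.
by apply: ndiff_nearZ; exact: smooth_dilate.
Qed.

Lemma derive1n_transfer i g : smooth_fun g ->
  derive1n i (transfer g) = fun y => mu ^- i * transfer (derive1n i g) y.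
Proof.
move=> gs; rewrite transfer_affine derive1n_sum; last first.
  by move=> j n x; apply: ndiff_nearZ; exact: smooth_dilate.
apply/funext => y; rewrite transfer_affine mulr_sumr; apply: eq_bigr => j _.
rewrite derive1nZ ?derive1n_affine //; last exact: smooth_dilate.
by rewrite exprVn mulrCA.
Qed.

Lemma smooth_iter n g : smooth_fun g -> smooth_fun (iter n transfer g).
Proof. by move=> gs; elim: n => // n IH; exact: smooth_transfer. Qed.

Variable L : R.
Hypotheses (L_ge0 : 0 <= L) (t_le : forall j, `|t j| <= (mu - 1) * L).

(** [[-L, L]] is stable under all the contractions, so bounds over it can be iterated. *)
Lemma dilate_stable j y : `|y| <= L -> `|(y + t j) / mu| <= L.
Proof.
move=> yL; rewrite normrM normfV (gtr0_norm mu_gt0) ler_pdivrMr //.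
apply: le_trans (ler_normD _ _) _; have := t_le j; lra.
Qed.

Let B0 := \sum_j `|b j * mu^-1|.

(** Each application multiplies an [i]-th derivative by [mu ^- i], so for such [i] the supremum over
    [[-L, L]] contracts; the mean with 1 is a rate in []0, 1[]. *)
Lemma transfer_decay_high i g : smooth_fun g -> B0 * mu ^- i < 1 ->
  geometric L (fun n => derive1n i (iter n transfer g)).
Proof.
move=> gs Bi; have [M M0 hM] := smooth_bounded L (smooth_derive1n i gs).
have p : 0 <= B0 * mu ^- i.
  by apply: mulr_ge0; [exact: sumr_ge0|rewrite invr_ge0 exprn_ge0 // ltW].
exists M, ((B0 * mu ^- i + 1) / 2); split=> //; [lra|lra|].
move=> n; elim: n => [|n IH] y yL; first by rewrite expr0 mulr1; exact: hM.
rewrite iterS derive1n_transfer; last exact: smooth_iter.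
set th := (_ / 2) in IH *; rewrite normrM ger0_norm; last by rewrite invr_ge0 exprn_ge0 // ltW.
have : `|transfer (derive1n i (iter n transfer g)) y| <= B0 * (M * th ^+ n).
  rewrite /transfer; apply: (le_trans (ler_norm_sum _ _ _)).
  rewrite mulr_suml; apply: ler_sum => j _.
  by rewrite mulrA normrM ler_wpM2l // IH // dilate_stable.
have mi : 0 <= mu ^- i by rewrite invr_ge0 exprn_ge0 // ltW.
move=> /(ler_wpM2l mi) h; apply: le_trans h _.
have -> : mu ^- i * (B0 * (M * th ^+ n)) = B0 * mu ^- i * (M * th ^+ n) by ring.
have -> : M * th ^+ n.+1 = th * (M * th ^+ n) by rewrite exprS; ring.
apply: ler_wpM2r.
  by rewrite mulr_ge0 // exprn_ge0 // /th; lra.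
rewrite /th; lra.
Qed.

(** As the weights [b j / mu] sum to 1, the operator adds to [w] only differences of values of [w],
    which the derivative of order [i.+1] makes geometrically small. Up to this error the factor is
    [mu ^- i], less than 1 for [i > 0], without the constant [B0]. *)
Lemma transfer_decay_step i g : (0 < i)%N -> smooth_fun g ->
  geometric L (fun n => derive1n i.+1 (iter n transfer g)) ->
  geometric L (fun n => derive1n i (iter n transfer g)).
Proof.
move=> i0 gs [C1 [th1 [C10 th10 th11 h1]]].
have [M M0 hM] := smooth_bounded L (smooth_derive1n i gs).
pose tau := mu ^- i; pose K := tau * (B0 * (2 * L * C1)).
have tau0 : 0 < tau by rewrite invr_gt0 exprn_gt0.
have tau1 : tau < 1 by rewrite invf_lt1 ?exprn_gt0 // exprn_egt1 // -lt0n.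
have B00 : 0 <= B0 by rewrite sumr_ge0.
have K0 : 0 <= K by rewrite !mulr_ge0 // ltW.
(* [th] lies strictly above both rates, so a large [C] satisfies [tau * C + K <= C * th], which
   closes the induction. *)
pose mx := Num.max tau th1; pose th := (mx + 1) / 2.
have mxt : tau <= mx by rewrite le_max lexx.
have mxh : th1 <= mx by rewrite le_max lexx orbT.
have mx1 : mx < 1 by rewrite gt_max tau1.
have gap : 0 < th - mx by rewrite /th; lra.
have thp : 0 < th by lra.
pose C := M + K / (th - mx).
have C0 : 0 <= C by rewrite addr_ge0 // divr_ge0 // ltW.
have KC : K <= C * (th - tau).
  apply: le_trans (_ : C * (th - mx) <= _).
    by rewrite mulrDl divfK ?gt_eqF // lerDr mulr_ge0 // ltW.
  by rewrite ler_wpM2l //; lra.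
exists C, th; split=> //; first by rewrite /th; lra.
elim=> [|n IH] y yL.
  by rewrite expr0 mulr1; apply: le_trans (hM y yL) _; rewrite lerDl divr_ge0 // ltW.
rewrite iterS derive1n_transfer; last exact: smooth_iter.
set w := derive1n i (iter n transfer g) in IH *.
have -> : transfer w y = w y + \sum_j (b j * mu^-1) * (w ((y + t j) / mu) - w y).
  rewrite /transfer; under [X in _ = _ + X]eq_bigr do rewrite mulrBr.
  rewrite sumrB -mulr_suml -mulr_suml b_sum divff // mul1r addrC subrK.
  by apply: eq_bigr => j _; rewrite mulrA.
have ws : smooth_fun w by apply: smooth_derive1n; exact: smooth_iter.
have lip j : `|w ((y + t j) / mu) - w y| <= 2 * L * (C1 * th1 ^+ n).
  apply: smooth_lipschitz => //; last exact: dilate_stable.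
  by move=> z zL; rewrite derive1n1 -derive1nS; exact: h1.
rewrite normrM ger0_norm; last exact: ltW.
have th1n : th1 ^+ n <= th ^+ n.
  by apply: lerXn2r; rewrite ?nnegrE; lra.
have S : `|\sum_j b j / mu * (w ((y + t j) / mu) - w y)| <=
    B0 * (2 * L * C1) * th ^+ n.
  apply: (le_trans (ler_norm_sum _ _ _)); rewrite -mulrA mulr_suml.
  apply: ler_sum => j _; rewrite normrM ler_wpM2l //.
  apply: le_trans (lip j) _; rewrite -!mulrA ler_wpM2l // ler_wpM2l //.
  by rewrite ler_wpM2l.
have thn : 0 <= th ^+ n by rewrite exprn_ge0 // ltW.
have H : `|w y + \sum_j b j / mu * (w ((y + t j) / mu) - w y)| <=
    C * th ^+ n + B0 * (2 * L * C1) * th ^+ n.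
  by apply: le_trans (ler_normD _ _) _; apply: lerD => //; exact: IH.
apply: le_trans (ler_wpM2l (ltW tau0) H) _; rewrite -/tau.
have := ler_wpM2r thn KC; rewrite /K exprS; lra.
Qed.

Lemma transfer_decay i g : (0 < i)%N -> smooth_fun g ->
  geometric L (fun n => derive1n i (iter n transfer g)).
Proof.
move=> i0 gs; have [i1 hi1] := exprn_unbounded B0 mu_gt1.
have hi j : (i1 <= j)%N -> B0 * mu ^- j < 1.
  move=> ij; rewrite ltr_pdivrMr ?exprn_gt0 // mul1r; apply: lt_le_trans hi1 _.
  by rewrite ler_weXn2l // ltW.
have H k : forall j, (0 < j)%N -> (i1 <= j + k)%N ->
    geometric L (fun n => derive1n j (iter n transfer g)).
  elim: k => [|k IH] j j0 jk.
    by apply: transfer_decay_high => //; apply: hi; rewrite addn0 in jk.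
  by apply: transfer_decay_step => //; apply: IH => //; rewrite addSnnS.
by apply: (H i1) => //; exact: leq_addl.
Qed.

End Transfer.

(** * Uniqueness of the compactly supported distribution solution *)

Section Distribution.
Variables (R : realType) (T : (R -> R) -> R).
Hypothesis T_dist : distribution_on_line T.

Lemma test_function0 : test_function (fun _ : R => 0 : R).
Proof.
apply/test_functionP; split; first by move=> n x; exact: ndiff_near_cst.
by exists 0.
Qed.

Lemma test_functionZD a (g h : R -> R) : test_function g -> test_function h ->
  test_function (fun x => a * g x + h x).
Proof.
move=> /test_functionP[gs [r hr]] /test_functionP[hs [r' hr']].
apply/test_functionP; split.
  by move=> n x; apply: ndiff_nearD => //; exact: ndiff_nearZ.
exists (Num.max r r') => x; rewrite gt_max => /andP[rx rx'].
by rewrite hr // hr' // mulr0 addr0.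
Qed.

Lemma test_functionM (g h : R -> R) : smooth_fun g -> test_function h ->
  test_function (fun x => g x * h x).
Proof.
move=> gs /test_functionP[hs [r' hr']]; apply/test_functionP; split.
  by move=> n x; apply: ndiff_nearM.
by exists r' => x rx; rewrite hr' // mulr0.
Qed.

Lemma test_function_affine a b (g : R -> R) : a != 0 -> test_function g ->
  test_function (fun x => g (a * x + b)).
Proof.
move=> a0 /test_functionP[gs [r hr]]; apply/test_functionP; split.
  by move=> n x; exact: ndiff_near_affine.
have na : 0 < `|a| by rewrite normr_gt0.
exists ((`|r| + `|b|) / `|a|) => x; rewrite ltr_pdivrMr // mulrC -normrM => h.
apply: hr; apply: le_lt_trans (ler_norm _) _.
by have := ler_normB (a * x + b) b; rewrite addrK; lra.
Qed.

Lemma distD a (g h : R -> R) : test_function g -> test_function h ->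
  T (fun x => a * g x + h x) = a * T g + T h.
Proof. by case: T_dist => H _; exact: H. Qed.

Lemma dist0 : T (fun=> 0) = 0.
Proof.
have := distD (-1) test_function0 test_function0.
by rewrite !mulr0 addr0 mulN1r addNr.
Qed.

Lemma dist_sum (I : Type) (s : seq I) (a : I -> R) (g : I -> R -> R) :
  (forall i, test_function (g i)) ->
  test_function (fun x => \sum_(i <- s) a i * g i x) /\
  T (fun x => \sum_(i <- s) a i * g i x) = \sum_(i <- s) a i * T (g i).
Proof.
move=> gt; elim: s => [|i s [IH1 IH2]].
  have -> : (fun x => \sum_(i <- [::]) a i * g i x) = fun=> 0.
    by apply/funext => x; rewrite big_nil.
  by split; [exact: test_function0|rewrite dist0 big_nil].
have -> : (fun x => \sum_(j <- i :: s) a j * g j x) =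
    fun x => a i * g i x + \sum_(j <- s) a j * g j x.
  by apply/funext => x; rewrite big_cons.
by split; [exact: test_functionZD|rewrite distD // IH2 big_cons].
Qed.

Lemma dist_transfer N mu (c : 'I_N.+1 -> R) (d : 'I_N.+1 -> int) g :
  mu != 0 -> dist_refinable mu c d T -> test_function g ->
  test_function (transfer mu c (fun j => (d j)%:~R) g) /\
  T (transfer mu c (fun j => (d j)%:~R) g) = T g.
Proof.
move=> mu0 Tr gt; rewrite transfer_affine.
have [|h1 h2] := @dist_sum _ (index_enum _) (fun j => c j / mu)
  (fun j y => g (mu^-1 * y + (d j)%:~R / mu)).
  by move=> j; apply: test_function_affine => //; rewrite invr_eq0.
split=> //; rewrite h2 (Tr g gt); apply: eq_bigr => j _.
rewrite /dist_dilate mulrA; congr (_ * T _); apply/funext => y.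
by rewrite mulrDl [y / _]mulrC.
Qed.

Lemma derive1n_cst n (a x : R) : derive1n n.+1 (cst a) x = 0.
Proof.
suff -> : derive1n n.+1 (cst a) = cst (0 : R) by [].
elim: n => [|n IH]; first by apply: derive1_eq => y.
by rewrite derive1nS IH; apply: derive1_eq => y.
Qed.

Lemma cutoff_mul_bounds (r : R) m (chi : R -> R) : 0 <= r ->
  smooth_fun chi -> (forall x, r < `|x| -> chi x = 0) ->
  exists C : R, 0 <= C /\ forall (v : R -> R) (B : R), 0 <= B ->
    smooth_fun v ->
    (forall j x, (j <= m)%N -> `|x| <= r -> `|derive1n j v x| <= B) ->
    forall j x, (j <= m)%N -> `|derive1n j (fun y => chi y * v y) x| <= C * B.
Proof.
move=> r0 cs c0; elim: m => [|m [C1 [C10 h1]]].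
  have [C [C0 hC]] := cutoff_mul_bound 0 r0 cs c0.
  by exists C; split=> // v B _ vs hv j x; rewrite leqn0 => /eqP ->; exact: hC.
have [C2 [C20 h2]] := cutoff_mul_bound m.+1 r0 cs c0.
exists (C1 + C2); split; first exact: addr_ge0.
move=> v B B0 vs hv j x; rewrite leq_eqVlt mulrDl => /orP[/eqP->|jm].
  by apply: le_trans (h2 v B vs hv x) _; rewrite lerDr mulr_ge0.
apply: (@le_trans _ _ (C1 * B)); last by rewrite lerDl mulr_ge0.
by apply: h1 => // i y im yr; apply: hv => //; exact: leqW.
Qed.

Variables (N : nat) (mu : R) (c : 'I_N.+1 -> R) (d : 'I_N.+1 -> int).
Hypotheses (mu_gt1 : 1 < mu) (c_sum : \sum_(j < N.+1) c j = mu)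
  (T_ref : dist_refinable mu c d T).
Variables (K : set R) (r L : R) (chi : R -> R).
Hypotheses (T_supp : forall g, test_function g -> fsupp g `&` K = set0 -> T g = 0)
  (K_r : forall x, K x -> `|x| < r) (L_ge0 : 0 <= L)
  (chi_smooth : smooth_fun chi) (chi1 : forall x, `|x| <= r -> chi x = 1)
  (chi0 : forall x, L < `|x| -> chi x = 0)
  (L_d : forall j, `|(d j)%:~R| <= (mu - 1) * L).

Local Notation trf := (transfer mu c (fun j => (d j)%:~R)).

Let mu_neq0 : mu != 0. Proof. by rewrite gt_eqF // (lt_trans _ mu_gt1). Qed.

Lemma dist_cutoff h : test_function h -> T h = T (fun x => chi x * h x).
Proof.
move=> ht; have ht1 := test_functionM chi_smooth ht.
have ht2 : test_function (fun x => -1 * (chi x * h x) + h x).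
  exact: test_functionZD.
have : T (fun x => -1 * (chi x * h x) + h x) = 0.
  apply: T_supp => //; rewrite -subset0 => x [hx Kx].
  move: (K_r Kx) => xr.
  have [y [/= hy yr]] : ([set y | -1 * (chi y * h y) + h y != 0] `&`
      [set y : R | `|y| < r]) !=set0.
    apply: hx; have nc := @norm_continuous R R x.
    exact: (nc _ (lt_nbhsl xr)).
  by move: hy; rewrite chi1 ?ltW // mul1r mulN1r addNr eqxx.
by rewrite distD // mulN1r => /eqP; rewrite addrC subr_eq0 => /eqP.
Qed.

Lemma test_iter n g : test_function g ->
  test_function (iter n trf g) /\ T (iter n trf g) = T g.
Proof.
move=> gt; elim: n => [//|n [IH1 IH2]].
have [h1 h2] := dist_transfer mu_neq0 T_ref IH1.
by split=> //; rewrite iterS h2.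
Qed.

(** The iterates keep the value [T g] while approaching constants on [[-L, L]] with all derivatives;
    cut off by [chi], they approach [iter n trf g 0] times [chi], and [T] is continuous. *)
Lemma dist_close g : test_function g -> exists C th : R, [/\ 0 < th, th < 1 &
  forall n, `|T g - iter n trf g 0 * T chi| <= C * th ^+ n].
Proof.
move=> gt; have [gs _] := (test_functionP g).1 gt.
have [_ /(_ _ (@segment_compact R (- L) L))[C1 [m hC1]]] := T_dist.
have [C2 [C20 hC2]] := cutoff_mul_bounds m L_ge0 chi_smooth chi0.
have chit : test_function chi.
  by apply/test_functionP; split=> //; exists L.
pose u n x := iter n trf g x + cst (- iter n trf g 0) x.
have us n : smooth_fun (u n).
  move=> k x; apply: ndiff_nearD; last exact: ndiff_near_cst.
  exact: smooth_iter.
have ug j : geometric L (fun n => derive1n j (u n)).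
  case: j => [|j].
    have g1 := transfer_decay mu_gt1 c_sum L_ge0 L_d (ltn0Sn 0) gs.
    apply: (geometric_le (K := 2 * L) _ g1); first by rewrite mulr_ge0.
    move=> n y C yL hC /=; rewrite /u /=.
    by apply: smooth_lipschitz => //; rewrite ?normr0 //; exact: smooth_iter.
  have [C [th [C0 th0 th1 h]]] :=
    transfer_decay mu_gt1 c_sum L_ge0 L_d (ltn0Sn j) gs.
  exists C, th; split=> [||| n y yL]; [exact: C0|exact: th0|exact: th1|].
  rewrite /u derive1nD.
  - by rewrite derive1n_cst addr0; exact: h.
  - exact: smooth_iter.
  - by move=> k x; exact: ndiff_near_cst.
have [C3 [th [C30 th0 th1 h3]]] := geometric_common (m := m) (fun j _ => ug j).
exists (C1 * (C2 * C3)), th; split=> // n.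
have [it iT] := test_iter n gt.
have ut : test_function (fun x => chi x * u n x).
  apply/test_functionP; split.
    by move=> k x; apply: ndiff_nearM; [exact: chi_smooth|exact: us].
  by exists L => x xL; rewrite chi0 ?mul0r.
have -> : T g - iter n trf g 0 * T chi = T (fun x => chi x * u n x).
  rewrite -iT dist_cutoff //.
  have -> : (fun x => chi x * iter n trf g x) =
      (fun x => iter n trf g 0 * chi x + chi x * u n x).
    by apply/funext => x; rewrite /u /=; ring.
  by rewrite distD // addrC addKr.
have thn : 0 <= th ^+ n by rewrite exprn_ge0 // ltW.
rewrite -!mulrA; apply: hC1 => //.
- apply: fsupp_itv => x; apply: contraR; rewrite -ler_norml -ltNge => /chi0 ->.
  by rewrite mul0r.
- move=> j x jm; apply: hC2 => //; first exact: mulr_ge0.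
  by move=> i y im yL; exact: h3.
Qed.

End Distribution.

Lemma compact_norm_bound (R : realType) (K : set R) : compact K ->
  exists r : R, forall x, K x -> `|x| < r.
Proof.
move=> /compact_bounded[M [_ hM]]; exists (M + 2) => x Kx.
have : `|x| <= M + 1 by apply: (hM (M + 1)) => //; rewrite ltrDl.
lra.
Qed.

(** The numbers [iter n g 0] are the same for both distributions and can be eliminated. The product
    form avoids dividing by [T2 chi], whose vanishing would make [T2] zero. *)
Lemma dist_unique (R : realType) (N : nat) (mu : R) (c : 'I_N.+1 -> R)
    (d : 'I_N.+1 -> int) (T1 T2 : (R -> R) -> R) :
  1 < mu -> \sum_(j < N.+1) c j = mu ->
  compactly_supported_distribution T1 -> dist_refinable mu c d T1 ->
  compactly_supported_distribution T2 -> dist_refinable mu c d T2 ->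
  exists chi, forall g, test_function g ->
    T1 g * T2 chi = T1 chi * T2 g /\ (T2 chi = 0 -> T2 g = 0).
Proof.
move=> mu1 cs [D1 [K1 cK1 S1]] R1 [D2 [K2 cK2 S2]] R2.
have [r1 h1] := compact_norm_bound cK1; have [r2 h2] := compact_norm_bound cK2.
(* Chosen so that all contractions [y -> (y + d j) / mu] preserve [[-L, L]]. *)
pose S := (\sum_j `|(d j)%:~R : R|) / (mu - 1).
have mu10 : 0 < mu - 1 by rewrite subr_gt0.
have S0 : 0 <= S by rewrite divr_ge0 ?sumr_ge0 // ltW.
pose r := `|r1| + `|r2| + S; pose L := r + 1.
have L0 : 0 <= L by rewrite /L /r !addr_ge0.
have Ld j : `|(d j)%:~R : R| <= (mu - 1) * L.
  rewrite mulrC -ler_pdivrMr //; apply: le_trans (_ : S <= _).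
    rewrite ler_pM2r ?invr_gt0 // (bigD1 j) //= lerDl sumr_ge0 //.
  by rewrite /L /r; have := normr_ge0 r1; have := normr_ge0 r2; lra.
have [chi [chis chi1 chi0]] := cutoff_exists r.
have k1 x : K1 x -> `|x| < r.
  move=> /h1 xr; apply: lt_le_trans xr _; apply: le_trans (ler_norm _) _.
  by rewrite /r -addrA lerDl addr_ge0.
have k2 x : K2 x -> `|x| < r.
  move=> /h2 xr; apply: lt_le_trans xr _; apply: le_trans (ler_norm _) _.
  by rewrite /r addrAC lerDr addr_ge0.
exists chi => g gt.
have [C1 [t1 [t10 t11 e1]]] := dist_close D1 mu1 cs R1 S1 k1 L0 chis chi1 chi0 Ld gt.
have [C2 [t2 [t20 t21 e2]]] := dist_close D2 mu1 cs R2 S2 k2 L0 chis chi1 chi0 Ld gt.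
pose w n := iter n (transfer mu c (fun j => (d j)%:~R)) g 0.
have C10 : 0 <= C1 by have := le_trans (normr_ge0 _) (e1 0%N); rewrite expr0 mulr1.
have C20 : 0 <= C2 by have := le_trans (normr_ge0 _) (e2 0%N); rewrite expr0 mulr1.
split; last first.
  move=> z; apply: (geometric_eq0 (C := C2) t20 t21) => n.
  by have := e2 n; rewrite z mulr0 subr0.
apply/eqP; rewrite -subr_eq0; apply/eqP.
apply: (@geometric_eq0 _ _ (C1 * `|T2 chi| + `|T1 chi| * C2) (Num.max t1 t2)).
- by rewrite lt_max t10.
- by rewrite gt_max t11.
move=> n; set th := Num.max t1 t2.
have th0 : 0 <= th by rewrite /th le_max ltW.
have p1 : t1 ^+ n <= th ^+ n.
  by apply: lerXn2r; rewrite ?nnegrE ?(ltW t10) // /th le_max lexx.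
have p2 : t2 ^+ n <= th ^+ n.
  by apply: lerXn2r; rewrite ?nnegrE ?(ltW t20) // /th le_max lexx orbT.
have -> : T1 g * T2 chi - T1 chi * T2 g =
    (T1 g - w n * T1 chi) * T2 chi - T1 chi * (T2 g - w n * T2 chi) by ring.
apply: le_trans (ler_normB _ _) _; rewrite !normrM mulrDl; apply: lerD.
  rewrite mulrAC ler_wpM2r //; apply: le_trans (e1 n) _.
  by rewrite ler_wpM2l.
rewrite -mulrA ler_wpM2l //; apply: le_trans (e2 n) _.
by rewrite ler_wpM2l.
Qed.

(** * Integrals of truncated powers *)

(** The integrands may jump at the ends of their support. Recording a continuous [G] behind them
    gives integrability and access to substitution and the fundamental theorem on a segment. *)
Definition piece (R : realType) (u : R -> R) (a b : R) (G : R -> R) : Prop :=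
  [/\ a <= b, continuous G & u = G \_ `[a, b]].

Definition integrableT (R : realType) (u : R -> R) : Prop :=
  (@lebesgue_measure R).-integrable setT (EFin \o u).

Lemma piece_integrable (R : realType) (u G : R -> R) (a b : R) :
  piece u a b G -> integrableT u.
Proof.
move=> [ab Gc ->]; rewrite /integrableT -restrict_EFin.
apply/(integrable_mkcond _ _).1; first exact: measurable_itv.
apply: continuous_compact_integrable; first exact: segment_compact.
exact: continuous_subspaceT.
Qed.

Lemma piece_Rintegral (R : realType) (u G : R -> R) (a b : R) :
  piece u a b G -> \int[@lebesgue_measure R]_x u x =
    \int[@lebesgue_measure R]_(x in [set` `[a, b]]) G x.
Proof. by move=> [ab Gc ->]; rewrite [in RHS]Rintegral_mkcond. Qed.

Lemma patchE_itv (R : realType) (G : R -> R) (a b x : R) :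
  (G \_ `[a, b]) x = if a <= x <= b then G x else 0.
Proof. by rewrite patchE mem_setE in_itv. Qed.

Lemma Rintegral_lincomb (R : realType) (I : Type) (s : seq I) (w : I -> R)
    (u : I -> R -> R) : (forall i, integrableT (u i)) ->
  integrableT (fun x => \sum_(i <- s) w i * u i x) /\
  \int[@lebesgue_measure R]_x (\sum_(i <- s) w i * u i x) =
  \sum_(i <- s) w i * \int[@lebesgue_measure R]_x u i x.
Proof.
move=> ui; elim: s => [|i s [IH1 IH2]].
  have -> : (fun x : R => \sum_(i <- [::]) w i * u i x) = fun=> 0.
    by apply/funext => x; rewrite big_nil.
  split; first exact: integrable0.
  by rewrite big_nil /Rintegral integral0_eq.
have -> : (fun x : R => \sum_(j <- i :: s) w j * u j x) =
    (fun x => w i * u i x + \sum_(j <- s) w j * u j x).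
  by apply/funext => x; rewrite big_cons.
have wi : integrableT (fun x => w i * u i x).
  exact: (integrableZl measurableT (w i) (ui i)).
split; first exact: (integrableD measurableT wi IH1).
rewrite RintegralD // big_cons; congr (_ + _); last exact: IH2.
exact: (RintegralZl (w i) measurableT (ui i)).
Qed.

Lemma piece_affine (R : realType) (u G : R -> R) (a b mu d : R) : 0 < mu ->
  piece u a b G ->
  piece (fun x => u (mu * x - d)) ((a + d) / mu) ((b + d) / mu)
    (fun x => G (mu * x - d)).
Proof.
move=> mu0 [ab Gc ->]; split.
- by rewrite ler_pM2r ?invr_gt0 // lerD2r.
- move=> x; apply: (continuous_comp (f := fun x => mu * x - d)); last exact: Gc.
  exact: affine_cvg.
- apply/funext => x; rewrite !patchE_itv ler_pdivrMr // ler_pdivlMr //.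
  by rewrite lerBrDr lerBlDr [x * mu]mulrC.
Qed.

Lemma piece_subst (R : realType) (u G : R -> R) (a b mu d : R) : 0 < mu ->
  piece u a b G ->
  \int[@lebesgue_measure R]_x u x =
    mu * \int[@lebesgue_measure R]_x u (mu * x - d).
Proof.
move=> mu0 up; have up' := piece_affine d mu0 up.
rewrite (piece_Rintegral up) (piece_Rintegral up').
case: up up' => ab Gc _ [ab' Gc' _].
pose F x := mu * x - d.
have dF (x : R) : is_derive x 1 F mu.
  have := @is_derive_affine R id mu (- d) x 1 (is_derive_id _ _).
  by rewrite mulr1.
have F'E : F^`()%classic = cst mu by apply: derive1_eq.
have Fa : F ((a + d) / mu) = a by rewrite /F mulrC divfK ?addrK // gt_eqF.
have Fb : F ((b + d) / mu) = b by rewrite /F mulrC divfK ?addrK // gt_eqF.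
have iG : (@lebesgue_measure R).-integrable
    [set` `[(a + d) / mu, (b + d) / mu]] (EFin \o (fun x => G (mu * x - d))).
  apply: continuous_compact_integrable; first exact: segment_compact.
  exact: continuous_subspaceT.
rewrite -(RintegralZl mu _ iG) //= /Rintegral; congr fine.
rewrite -{1}Fa -{1}Fb (@integration_by_substitution_increasing R F G) //.
- by apply: eq_integral => x _; rewrite /= F'E mulrC.
- by move=> x y _ _ xy; rewrite /F ltrD2r ltr_pM2l.
- by rewrite F'E => x _; exact: cvg_cst.
- by rewrite F'E; exact: is_cvg_cst.
- by rewrite F'E; exact: is_cvg_cst.
- split.
  + by move=> x _; case: (dF x).
  + by apply: cvg_at_right_filter; exact: affine_cvg.
  + by apply: cvg_at_left_filter; exact: affine_cvg.
- exact: continuous_subspaceT.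
Qed.

Lemma continuous_pow_sub (R : realType) r (e : R) :
  continuous (fun x : R => (x - e) ^+ r).
Proof.
have -> : (fun x : R => (x - e) ^+ r) = horner (('X - e%:P) ^+ r).
  by apply/funext => x; rewrite horner_exp !hornerE.
exact: continuous_horner.
Qed.

Lemma tpow_mul_piece (R : realType) r (e X : R) (g : R -> R) : continuous g ->
  (forall x, X < `|x| -> g x = 0) ->
  piece (fun x => tpow r (x - e) * g x) e (Num.max e X)
    (fun x => (x - e) ^+ r * g x).
Proof.
move=> gc g0; split; first by rewrite le_max lexx.
  by move=> x; apply: cvgM; [exact: continuous_pow_sub|exact: gc].
apply/funext => x; rewrite patchE_itv /tpow subr_ge0.
have [ex|] := leP e x; last by rewrite mul0r.
rewrite /=; case: ifPn => //; rewrite -ltNge gt_max => /andP[_ Xx].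
by rewrite g0 ?mulr0 // (lt_le_trans Xx) // ler_norm.
Qed.

(* The Euler integral B(a + 1, b + 1). *)
Definition euler_beta (R : realType) (a b : nat) : R :=
  (antiderivp ('X^a * (1 - 'X) ^+ b)).[1] -
  (antiderivp ('X^a * (1 - 'X) ^+ b)).[0].

Lemma euler_beta_gt0 (R : realType) a b : 0 < euler_beta R a b.
Proof.
rewrite /euler_beta; set p := 'X^a * _.
have [||c] := @MVT R (horner (antiderivp p)) (horner p) 0 1 ltr01.
- by move=> x _; have := is_derive_poly (antiderivp p) x; rewrite antiderivpK.
- by apply: continuous_subspaceT => x; exact: continuous_horner.
rewrite in_itv /= => /andP[c0 c1] ->; rewrite subr0 mulr1 /p.
by rewrite hornerM horner_exp !hornerE mulr_gt0 // exprn_gt0 // subr_gt0.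
Qed.

(** The substitution [t = al + l s], [l = be - al], reduces to the Euler integral with the factor
    [l ^+ (a + b).+1]; it is carried out on an explicit antiderivative. *)
Lemma tpow_conv (R : realType) (a b : nat) (al be : R) :
  integrableT (fun t => tpow a (t - al) * tpow b (be - t)) /\
  \int[@lebesgue_measure R]_t (tpow a (t - al) * tpow b (be - t)) =
    euler_beta R a b * tpow (a + b).+1 (be - al).
Proof.
have [ab|ba] := leP al be; last first.
  have -> : (fun t : R => tpow a (t - al) * tpow b (be - t)) = fun=> 0.
    apply/funext => t; rewrite /tpow !subr_ge0.
    have [h1|] := leP al t; last by rewrite mul0r.
    have [h2|] := leP t be; last by rewrite mulr0.
    by have := lt_le_trans ba (le_trans h1 h2); rewrite ltxx.
  split; first exact: integrable0.
  by rewrite /Rintegral integral0_eq // /tpow subr_ge0 leNgt ba mulr0.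
pose G t := (t - al) ^+ a * (be - t) ^+ b.
have Gc : continuous G.
  have -> : G = horner (('X - al%:P) ^+ a * (be%:P - 'X) ^+ b).
    by apply/funext => x; rewrite hornerM !horner_exp !hornerE.
  exact: continuous_horner.
have up : piece (fun t => tpow a (t - al) * tpow b (be - t)) al be G.
  split=> //; apply/funext => t; rewrite patchE_itv /tpow !subr_ge0.
  case: (al <= t) => /=; last by rewrite mul0r.
  by case: (t <= be) => //=; rewrite mulr0.
split; first exact: piece_integrable up.
rewrite (piece_Rintegral up).
move: ab; rewrite le_eqVlt => /orP[/eqP <-|ab].
  by rewrite set_itv1 Rintegral_set1 subrr /tpow lexx exprS mul0r mulr0.
have [l l0 beE] : exists2 l, 0 < l & be = al + l.
  by exists (be - al); rewrite ?subr_gt0 // addrC subrK.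
subst be; have ln0 : l != 0 by rewrite gt_eqF.
pose B := antiderivp ('X^a * (1 - 'X) ^+ b) : {poly R}.
pose F t := l ^+ (a + b).+1 * B.[l^-1 * t - al / l].
have dF (t : R) : is_derive t 1 F (G t).
  have := is_derive_poly B (l^-1 * t - al / l); rewrite antiderivpK.
  move=> /(@is_derive_affine R (horner B)) /(is_deriveZ (l ^+ (a + b).+1)).
  move=> h; apply: (is_derive_eq h); rewrite /GRing.scale /= /G.
  rewrite hornerM horner_exp !hornerE.
  have -> : al + l - t = l * (1 - (l^-1 * t - al / l)) by field.
  have -> : t - al = l * (l^-1 * t - al / l) by field.
  rewrite !exprMn exprS exprD; set X := _ - al / l.
  move: (X ^+ a) ((1 - X) ^+ b) (l ^+ a) (l ^+ b) => x1 x2 x3 x4.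
  by rewrite [LHS](_ : _ = l * (x3 * x4) * l^-1 * x1 * x2) //; field.
rewrite /Rintegral (@continuous_FTC2 R G F) //.
- rewrite /= /F -mulrBr; have -> : l^-1 * (al + l) - al / l = 1 by field.
  have -> : l^-1 * al - al / l = 0 by rewrite mulrC subrr.
  have -> : al + l - al = l by ring.
  by rewrite mulrC /euler_beta /tpow ltW.
- exact: continuous_subspaceT.
- have Fc (t : R) : {for t, continuous F}.
    by apply: differentiable_continuous; apply/derivable1_diffP; case: (dF t).
  split.
  + by move=> x _; case: (dF x).
  + by apply: cvg_at_right_filter; exact: Fc.
  + by apply: cvg_at_left_filter; exact: Fc.
- by move=> t _; rewrite derive1E; case: (dF t).
Qed.

(** * Splines as distributions *)

(** The list is a comb of pairs (point, weight), here convolved with a truncated power. Points may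
    repeat and weights may be 0. *)
Definition tspline (R : realType) (r : nat) (L : seq (R * R)) (x : R) : R :=
  \sum_(p <- L) p.2 * tpow r (x - p.1).

Lemma tspline_spline (R : realType) r (L : seq (R * R)) : spline (tspline r L).
Proof.
pose s := sort <=%O (undup (map fst L)).
have ss : sorted <%O s by rewrite sort_lt_sorted undup_uniq.
pose xs j : \bar R := if j is i.+1 then
  (if (i < size s)%N then (nth 0 s i)%:E else +oo%E) else -oo%E.
have xlt i j : (i < j <= (size s).+1)%N -> (xs i < xs j)%E.
  case: j => [|j]; first by rewrite ltn0.
  case: i => [|i] /andP[]; first by move=> _ _ /=; rewrite ltNye; case: ifP.
  rewrite !ltnS => ij js; rewrite /=; case: (ltnP i (size s)) => [is_|]; last first.
    by move=> si; have := leq_trans ij js; rewrite ltnNge si.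
  case: ifP => js'; last exact: ltry.
  by rewrite lte_fin; apply: sorted_ltn_nth => //; exact: lt_trans.
exists (size s), xs, (fun j => \sum_(p <- L | (p.1%:E <= xs j)%E)
  p.2 *: ('X - p.1%:P) ^+ r); split=> //.
- by rewrite /= ltnn.
- by move=> j js; apply: xlt; rewrite ltnSn.
move=> j t js xt tx; rewrite horner_sum /tspline [RHS]big_mkcond /=.
rewrite big_seq [RHS]big_seq; apply: eq_bigr => p pL.
rewrite /tpow subr_ge0; case: (boolP (p.1%:E <= xs j)%E) => [px|].
  have -> : p.1 <= t by rewrite -lee_fin; exact: le_trans px xt.
  by rewrite hornerZ horner_exp !hornerE.
rewrite -ltNge => xp; have ps : p.1 \in s by rewrite mem_sort mem_undup map_f.
pose i := index p.1 s; have is_ : (i < size s)%N by rewrite index_mem.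
have xi : xs i.+1 = p.1%:E by rewrite /= is_ nth_index.
have ji : (j < i.+1)%N.
  rewrite ltnNge; apply/negP; rewrite leq_eqVlt => /orP[/eqP ij|ij].
    by move: xp; rewrite -ij xi ltxx.
  have := xlt i.+1 j; rewrite ij leqW // xi => /(_ isT) h.
  by have := lt_trans xp h; rewrite ltxx.
have : (t%:E < p.1%:E)%E.
  apply: lt_le_trans tx _; rewrite -xi; move: ji; rewrite leq_eqVlt => /orP[/eqP->//|ji].
  by apply/ltW/xlt; rewrite ji /= ltnS ltnW.
by rewrite lte_fin ltNge => /negbTE ->; rewrite mulr0.
Qed.

(** Thanks to the half-open pieces, the polynomial is valid at [t] too, so splines can be compared
    at every point. *)
Lemma spline_right_poly (R : realType) (f : R -> R) (t : R) : spline f ->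
  exists (p : {poly R}) (e : R), 0 < e /\ forall y, t <= y -> y < t + e -> f y = p.[y].
Proof.
move=> [M [x [P [x0 xM xlt fP]]]].
have [j [jM xj jx]] : exists j, [/\ (j <= M)%N, (x j <= t%:E)%E & (t%:E < x j.+1)%E].
  have H k : (k <= M)%N -> (t%:E < x k.+1)%E ->
      exists j, [/\ (j <= M)%N, (x j <= t%:E)%E & (t%:E < x j.+1)%E].
    elim: k => [|k IH] kM tk; first by exists 0%N; rewrite x0 leNye.
    have [h|h] := leP (x k.+1) t%:E; first by exists k.+1.
    by apply: IH => //; exact: ltnW.
  by apply: (H M) => //; rewrite xM ltry.
have [e e0 he] : exists2 e : R, 0 < e & forall y, y < t + e -> (y%:E < x j.+1)%E.
  case: (x j.+1) jx => [r|_|//]; last by exists 1 => // y _; rewrite ltry.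
  rewrite lte_fin => tr; exists (r - t); first by rewrite subr_gt0.
  by move=> y; rewrite addrC subrK lte_fin.
exists (P j), e; split=> // y ty ye; apply: fP => //; last exact: he.
by apply: le_trans xj _; rewrite lee_fin.
Qed.

Lemma smooth_fun_cont (R : realType) (g : R -> R) : smooth_fun g -> continuous g.
Proof. by move=> gs x; exact: ndiff_near_cont (gs 1%N x). Qed.

Lemma tpow_mul_test (R : realType) r (e : R) (g : R -> R) : test_function g ->
  exists b G, piece (fun x => tpow r (x - e) * g x) e b G.
Proof.
move=> /test_functionP[gs [X gX]].
by have := tpow_mul_piece r e (smooth_fun_cont gs) gX; do 2 eexists; eauto.
Qed.

Lemma tspline_mulE (R : realType) r (L : seq (R * R)) (g : R -> R) :
  (fun x => tspline r L x * g x) =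
  (fun x => \sum_(p <- L) p.2 * (tpow r (x - p.1) * g x)).
Proof.
by apply/funext => x; rewrite mulr_suml; apply: eq_bigr => p _; rewrite mulrA.
Qed.

Lemma tspline_test (R : realType) r (L : seq (R * R)) (g : R -> R) :
  test_function g ->
  integrableT (fun x => tspline r L x * g x) /\
  \int[@lebesgue_measure R]_x (tspline r L x * g x) =
  \sum_(p <- L) p.2 * \int[@lebesgue_measure R]_x (tpow r (x - p.1) * g x).
Proof.
move=> gt; rewrite tspline_mulE; apply: Rintegral_lincomb => p.
by have [b [G pc]] := tpow_mul_test r p.1 gt; exact: piece_integrable pc.
Qed.

Section SplineDistribution.
Variables (R : realType) (r : nat) (L : seq (R * R)) (X : R).
Hypothesis L_supp : forall x, X < `|x| -> tspline r L x = 0.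

Definition spline_dist (g : R -> R) : R :=
  \int[@lebesgue_measure R]_x (tspline r L x * g x).

Lemma tspline_bounded : exists2 M : R, 0 <= M & forall x, `|tspline r L x| <= M.
Proof.
exists (\sum_(p <- L) `|p.2| * (`|X| + `|p.1|) ^+ r).
  by apply: sumr_ge0 => p _; rewrite mulr_ge0 // exprn_ge0 // addr_ge0.
move=> x; have [xX|Xx] := leP `|x| X; last first.
  rewrite L_supp // normr0; apply: sumr_ge0 => p _.
  by rewrite mulr_ge0 // exprn_ge0 // addr_ge0.
rewrite /tspline; apply: (le_trans (ler_norm_sum _ _ _)).
apply: ler_sum => p _; rewrite normrM ler_wpM2l // /tpow.
case: ifP => h; last by rewrite normr0 exprn_ge0 // addr_ge0.
rewrite normrX; apply: lerXn2r; rewrite ?nnegrE ?addr_ge0 //.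
apply: le_trans (ler_normB _ _) _; rewrite lerD2r.
exact: le_trans (ler_norm X).
Qed.

Lemma spline_dist_compact : compactly_supported_distribution spline_dist.
Proof.
split; last first.
  exists [set` `[- X, X]]; first exact: segment_compact.
  move=> g gt gK; rewrite /spline_dist.
  rewrite (_ : (fun _ => _) = fun=> 0) /Rintegral ?integral0_eq //.
  apply/funext => x; have [xX|Xx] := leP `|x| X; last by rewrite L_supp // mul0r.
  suff -> : g x = 0 by rewrite mulr0.
  apply/eqP/negPn/negP => gx; have : (fsupp g `&` [set` `[- X, X]]) x.
    split; first exact: subset_closure.
    by rewrite /= in_itv /= -ler_norml.
  by rewrite gK.
split.
  move=> a g h gt ht; have [ig _] := tspline_test r L gt.
  have [ih _] := tspline_test r L ht; rewrite /spline_dist.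
  have ia : integrableT (fun x => a * (tspline r L x * g x)).
    exact: (integrableZl measurableT a ig).
  rewrite -(RintegralZl a measurableT ig) -(RintegralD measurableT ia ih).
  by congr (Rintegral _ _ _); apply/funext => x; ring.
move=> K cK; have [M M0 hM] := tspline_bounded.
have X0 : - `|X| <= `|X| by rewrite ge0_cp.
pose one : R -> R := (fun=> 1 : R) \_ `[- `|X|, `|X|].
have po : piece one (- `|X|) `|X| (fun=> 1) by split=> // x; exact: cvg_cst.
(* Order 0 suffices: the integral is at most the supremum of the spline, times that of [g], times
   the length of the interval. *)
exists (M * \int[@lebesgue_measure R]_x one x), 0%N => g B gt gK hB.
have B0 : 0 <= B by apply: le_trans (hB 0%N 0 isT).
have [ig _] := tspline_test r L gt.
apply: (le_trans (le_normr_Rintegral measurableT ig)).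
have io := piece_integrable po.
rewrite mulrAC -(RintegralZl (M * B) measurableT io).
apply: le_Rintegral => //.
- exact: (integrable_norm ig).
- exact: (integrableZl measurableT (M * B) io).
move=> x _; rewrite normrM /one patchE_itv -ler_norml.
have [xX|Xx] := leP `|x| `|X|.
  by rewrite mulr1; apply: ler_pM => //; exact: (hB 0%N x isT).
by rewrite L_supp ?normr0 ?mul0r ?mulr0 // (le_lt_trans (ler_norm X)).
Qed.

(** The substitution is made term by term: a truncated power is not compactly supported, but its
    product with a test function is a [piece]. *)
Lemma spline_dist_refinable N mu (c : 'I_N.+1 -> R) (d : 'I_N.+1 -> int) :
  0 < mu -> (forall x, tspline r L x =
    \sum_j c j * tspline r L (mu * x - (d j)%:~R)) ->
  dist_refinable mu c d spline_dist.
Proof.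
move=> mu0 ref g gt; have mun0 : mu != 0 by rewrite gt_eqF.
pose u j (p : R * R) (x : R) := tpow r (mu * x - (d j)%:~R - p.1) * g x.
have up j (p : R * R) : integrableT (u j p) /\
    mu^-1 * \int[@lebesgue_measure R]_y (tpow r (y - p.1) * g ((y + (d j)%:~R) / mu)) =
    \int[@lebesgue_measure R]_x u j p x.
  have ht : test_function (fun y => g ((y + (d j)%:~R) / mu)).
    have := test_function_affine ((d j)%:~R / mu) (_ : mu^-1 != 0) gt.
    rewrite invr_eq0 => /(_ mun0); congr test_function; apply/funext => y.
    by rewrite mulrDl [y / _]mulrC.
  have [b [G pc]] := tpow_mul_test r p.1 ht.
  have uE : u j p = fun x => tpow r (mu * x - (d j)%:~R - p.1) *
      g ((mu * x - (d j)%:~R + (d j)%:~R) / mu).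
    by apply/funext => x; rewrite subrK [mu * x / mu]mulrC mulKf.
  rewrite (piece_subst (d j)%:~R mu0 pc) mulKf // uE; split=> //.
  exact: piece_integrable (piece_affine (d j)%:~R mu0 pc).
have H j : dist_dilate mu (d j)%:~R spline_dist g =
    \sum_(p <- L) p.2 * \int[@lebesgue_measure R]_x u j p x.
  have ht : test_function (fun y => g ((y + (d j)%:~R) / mu)).
    have := test_function_affine ((d j)%:~R / mu) (_ : mu^-1 != 0) gt.
    rewrite invr_eq0 => /(_ mun0); congr test_function; apply/funext => y.
    by rewrite mulrDl [y / _]mulrC.
  rewrite /dist_dilate /spline_dist (tspline_test r L ht).2 mulr_sumr.
  by apply: eq_bigr => p _; rewrite mulrCA (up j p).2.
under eq_bigr do rewrite H.
pose U j (x : R) := \sum_(p <- L) p.2 * u j p x.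
have HU j : integrableT (U j) /\ \int[@lebesgue_measure R]_x U j x =
    \sum_(p <- L) p.2 * \int[@lebesgue_measure R]_x u j p x.
  by apply: Rintegral_lincomb => p; exact: (up j p).1.
under eq_bigr do rewrite -(HU _).2.
rewrite -(Rintegral_lincomb (index_enum _) c (fun j => (HU j).1)).2.
rewrite /spline_dist; congr (Rintegral _ _ _); apply/funext => x.
rewrite ref mulr_suml; apply: eq_bigr => j _; rewrite -mulrA; congr (_ * _).
by rewrite /U /u mulr_suml; apply: eq_bigr => p _; rewrite mulrA.
Qed.

End SplineDistribution.

Lemma Rintegral_itv_one (R : realType) (a b : R) : a < b ->
  \int[@lebesgue_measure R]_(x in [set` `[a, b]]) (1 : R) = b - a.
Proof.
move=> ab; rewrite Rintegral_cst; last exact: measurable_itv.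
have E := @lebesgue_measure_itv R `[a, b].
by rewrite mul1r [X in fine X]E /= lte_fin ab.
Qed.

(** The bump sits just to the right of [t], where [p] keeps the sign of [p.[t]]; then [p.[t] * p *
    g] is nonnegative and at least [m > 0] on the middle third. *)
Lemma poly_bump (R : realType) (p : {poly R}) (t e : R) : 0 < e -> p.[t] != 0 ->
  exists g, [/\ test_function g, forall x, ~~ (t < x < t + e) -> g x = 0 &
    \int[@lebesgue_measure R]_x (p.[x] * g x) != 0].
Proof.
move=> e0 pt; have pt0 : 0 < `|p.[t]| by rewrite normr_gt0.
have : \forall y \near t, `|p.[t] - p.[y]| < `|p.[t]|.
  by have /cvgrPdist_lt := @continuous_horner R p t; exact.
move=> /nbhs_ballP[e1 /= e10 he1].
pose h := Num.min e e1; have h0 : 0 < h by rewrite lt_min e0.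
have he : h <= e by rewrite ge_min lexx.
have hh1 : h <= e1 by rewrite ge_min lexx orbT.
have pos y : t <= y -> y < t + h -> 0 < p.[t] * p.[y].
  move=> ty yt; have : `|p.[t] - p.[y]| < `|p.[t]|.
    by apply: he1; rewrite /ball /= distrC ger0_norm; lra.
  move: pt; rewrite neq_lt => /orP[n|n].
    rewrite (ltr0_norm n) ltr_norml => /andP[a b].
    by rewrite nmulr_rgt0 //; lra.
  rewrite (gtr0_norm n) ltr_norml => /andP[a b].
  by rewrite pmulr_rgt0 //; lra.
have [g [gs g0 gp gz]] := bump_exists t (t + h).
have gc := smooth_fun_cont gs.
exists g; split.
- apply/test_functionP; split=> //; exists (`|t| + h) => x hx; apply: gz.
  apply/negP => /andP[a b]; have := ler_norm t; have := ler_norm (- t).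
  by move: hx; rewrite normrN; have [x0|x0] := leP 0 x;
    [rewrite (ger0_norm x0)|rewrite (ltr0_norm x0)]; lra.
- move=> x; apply: contraNeq => gx; have : t < x < t + h.
    by apply: contraNT gx => /gz ->.
  by move=> /andP[-> b]; rewrite (lt_le_trans b) // lerD2l.
have pu : piece (fun x => p.[x] * g x) t (t + h) (fun x => p.[x] * g x).
  split; first lra.
    by move=> x; apply: cvgM; [exact: continuous_horner|exact: gc].
  apply/funext => x; rewrite patchE_itv; case: ifPn => // nx.
  by rewrite gz ?mulr0 //; apply: contra nx => /andP[/ltW -> /ltW ->].
have iu := piece_integrable pu.
pose a := t + h / 3; pose b := t + h * 2 / 3.
have ab : a < b by rewrite /a /b; lra.
have Gc : {within `[a, b], continuous (fun x => p.[t] * (p.[x] * g x))}.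
  apply: continuous_subspaceT => x; apply: cvgM; first exact: cvg_cst.
  by apply: cvgM; [exact: continuous_horner|exact: gc].
have [c cab cmin] := EVT_min (ltW ab) Gc.
set m := p.[t] * (p.[c] * g c) in cmin.
have m0 : 0 < m.
  move: cab; rewrite in_itv /= /a /b => /andP[c1 c2].
  by rewrite /m mulrA mulr_gt0 // ?pos // ?gp //; lra.
pose one : R -> R := (fun=> 1 : R) \_ `[a, b].
have po : piece one a b (fun=> 1).
  by split=> //; [exact: ltW|move=> x; exact: cvg_cst].
have io := piece_integrable po.
apply: contraTneq (ltr0n R 1) => z; rewrite -leNgt.
have : \int[@lebesgue_measure R]_x (m * one x) <=
    \int[@lebesgue_measure R]_x (p.[t] * (p.[x] * g x)).
  apply: le_Rintegral => //.
  - exact: (integrableZl measurableT m io).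
  - exact: (integrableZl measurableT p.[t] iu).
  move=> x _; rewrite /one patchE_itv; case: ifPn => [xab|_].
    by rewrite mulr1; apply: cmin; rewrite in_itv.
  rewrite mulr0; have [xt|] := boolP (t < x < t + h).
    rewrite mulrA mulr_ge0 //; case/andP: xt => /ltW x1 x2.
    by rewrite ltW // pos.
  by move=> /gz ->; rewrite !mulr0.
rewrite (RintegralZl m measurableT io) (RintegralZl p.[t] measurableT iu) z.
rewrite (piece_Rintegral po) Rintegral_itv_one // mulr0.
have mp : 0 < m * (b - a) by rewrite mulr_gt0 // subr_gt0.
by move=> /(lt_le_trans mp); rewrite ltxx.
Qed.

(** The equality holds everywhere: were the right-hand polynomials to differ at [t], a bump to the
    right of [t] would detect it. *)
Lemma spline_rep_unique (R : realType) (phi s : R -> R) (be : R) :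
  spline phi -> spline s ->
  (forall g, test_function g -> \int[@lebesgue_measure R]_x (phi x * g x) =
     be * \int[@lebesgue_measure R]_x (s x * g x)) ->
  forall x, phi x = be * s x.
Proof.
move=> sphi ss H t.
have [p [e [e0 pE]]] := spline_right_poly t sphi.
have [p' [e' [e'0 pE']]] := spline_right_poly t ss.
rewrite pE ?pE' ?lexx ?ltrDl //.
pose P := p - be *: p'.
have PE x : P.[x] = p.[x] - be * p'.[x] by rewrite hornerD hornerN hornerZ.
apply/eqP; rewrite -subr_eq0 -PE; apply/negPn/negP => Pt.
have m0 : 0 < Num.min e e' by rewrite lt_min e0.
have [g [gt g0 /negP]] := poly_bump m0 Pt; apply; apply/eqP.
have gE (u : R -> R) (q : {poly R}) e1 : Num.min e e' <= e1 ->
    (forall y, t <= y -> y < t + e1 -> u y = q.[y]) ->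
    (fun x => u x * g x) = (fun x => q.[x] * g x).
  move=> me uq; apply/funext => x; have [/andP[a b]|/g0 ->] :=
    boolP (t < x < t + Num.min e e'); last by rewrite !mulr0.
  by rewrite uq ?(ltW a) // (lt_le_trans b) // lerD2l.
have me : Num.min e e' <= e by rewrite ge_min lexx.
have me' : Num.min e e' <= e' by rewrite ge_min lexx orbT.
have [gs _] := (test_functionP g).1 gt.
have pc (q : {poly R}) : integrableT (fun x => q.[x] * g x).
  apply: (@piece_integrable _ _ (fun x => q.[x] * g x) t (t + Num.min e e')).
  split; first lra.
    by move=> x; apply: cvgM; [exact: continuous_horner|exact: smooth_fun_cont].
  apply/funext => x; rewrite patchE_itv; case: ifPn => // nx.
  by rewrite g0 ?mulr0 //; apply: contra nx => /andP[/ltW -> /ltW ->].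
have := H g gt; rewrite (gE _ _ _ me pE) (gE _ _ _ me' pE') => h.
have -> : (fun x => P.[x] * g x) = (fun x => p.[x] * g x + - be * (p'.[x] * g x)).
  by apply/funext => x; rewrite PE; ring.
have ib : integrableT (fun x => - be * (p'.[x] * g x)).
  exact: (integrableZl measurableT (- be) (pc p')).
rewrite (RintegralD measurableT (pc p) ib) (RintegralZl _ measurableT (pc p')) h.
by rewrite mulNr subrr.
Qed.

Lemma spline_dist_neq0 (R : realType) r (L : seq (R * R)) (b : R) :
  (forall x, x < b + 1 -> tspline r L x = tpow r (x - b)) ->
  nonzero_distribution (spline_dist r L).
Proof.
move=> H; pose p : {poly R} := ('X - b%:P) ^+ r.
have pE x : p.[x] = (x - b) ^+ r by rewrite horner_exp !hornerE.
have h0 : 0 < 1 / 2 :> R by lra.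
(* The bump lives in []b + 1/2, b + 1[], where the spline is [(x - b) ^+ r] and does not vanish. *)
have [|g [gt g0 gI]] := @poly_bump R p (b + 1 / 2) (1 / 2) h0.
  by rewrite pE expf_neq0 // gt_eqF //; lra.
exists g => //; rewrite /spline_dist.
rewrite (_ : (fun x => _) = (fun x => p.[x] * g x)) //; apply/funext => x.
have [/andP[x1 x2]|/g0 ->] := boolP (b + 1 / 2 < x < b + 1 / 2 + 1 / 2); last first.
  by rewrite !mulr0.
rewrite H ?pE /tpow ?ifT //; lra.
Qed.

(** With a comb read as a sum of terms [w z^a], this is the product, and [comb_dilate a] the
    substitution of [z^a] for [z]. *)
Definition comb_mul (R : realType) (L L' : seq (R * R)) : seq (R * R) :=
  [seq (p.1 + p'.1, p.2 * p'.2) | p <- L, p' <- L'].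

Definition comb_dilate (R : realType) (a : R) (L : seq (R * R)) : seq (R * R) :=
  [seq (a * p.1, p.2) | p <- L].

Lemma comb_mulE (R : realType) (L L' : seq (R * R)) (phi : R -> R) :
  \sum_(p <- comb_mul L L') p.2 * phi p.1 =
  \sum_(p <- L) \sum_(p' <- L') p.2 * p'.2 * phi (p.1 + p'.1).
Proof. by rewrite /comb_mul big_allpairs_dep. Qed.

Lemma comb_dilateE (R : realType) a (L : seq (R * R)) (phi : R -> R) :
  \sum_(p <- comb_dilate a L) p.2 * phi p.1 = \sum_(p <- L) p.2 * phi (a * p.1).
Proof. by rewrite big_map. Qed.

Lemma tspline_convolution (R : realType) a b (L L' : seq (R * R)) :
  convolution (tspline a L) (tspline b L') =
  (fun x => euler_beta R a b * tspline (a + b).+1 (comb_mul L L') x).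
Proof.
apply/funext => x; rewrite /convolution.
pose u (p p' : R * R) (t : R) := tpow a (t - p.1) * tpow b (x - p'.1 - t).
have iu p p' : integrableT (u p p') /\ \int[@lebesgue_measure R]_t u p p' t =
    euler_beta R a b * tpow (a + b).+1 (x - p'.1 - p.1) by exact: tpow_conv.
pose U (p : R * R) (t : R) := \sum_(p' <- L') p'.2 * u p p' t.
have iU p := Rintegral_lincomb L' snd (fun p' => (iu p p').1).
have -> : (fun t => tspline a L t * tspline b L' (x - t)) =
    (fun t => \sum_(p <- L) p.2 * U p t).
  apply/funext => t; rewrite /tspline mulr_suml; apply: eq_bigr => p _.
  rewrite -mulrA; congr (_ * _); rewrite mulr_sumr; apply: eq_bigr => p' _.
  by rewrite /u mulrCA (addrAC x).
rewrite (Rintegral_lincomb L snd (fun p => (iU p).1)).2 /tspline.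
rewrite (comb_mulE L L' (fun y => tpow (a + b).+1 (x - y))) mulr_sumr.
apply: eq_bigr => p _; rewrite (iU p).2 !mulr_sumr; apply: eq_bigr => p' _.
rewrite (iu p p').2 opprD addrA (addrAC x); ring.
Qed.

Lemma tspline_dilate (R : realType) r (L : seq (R * R)) (a : R) : 0 < a ->
  (fun x => tspline r L (a^-1 * x)) =
  (fun x => a ^- r * tspline r (comb_dilate a L) x).
Proof.
move=> a0; apply/funext => x; rewrite /tspline.
rewrite (comb_dilateE a L (fun y => tpow r (x - y))) mulr_sumr.
apply: eq_bigr => p _; rewrite mulrCA; congr (_ * _); rewrite /tpow.
have -> : a^-1 * x - p.1 = a^-1 * (x - a * p.1) by field; rewrite gt_eqF.
rewrite pmulr_rge0 ?invr_gt0 //; case: ifP => _; last by rewrite mulr0.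
by rewrite exprMn exprVn.
Qed.

(** * Combs and convolutions of splines *)

(** Combs are compared through their pairings with all functions, which ignore the order and the
    repetition of points in the lists. *)
Definition pairing (R : realType) (L : seq (R * R)) (phi : R -> R) : R :=
  \sum_(p <- L) p.2 * phi p.1.

Definition comb_scale (R : realType) (w : R) (L : seq (R * R)) : seq (R * R) :=
  [seq (p.1, w * p.2) | p <- L].

Lemma pairing_ext (R : realType) (L : seq (R * R)) (phi psi : R -> R) :
  phi =1 psi -> pairing L phi = pairing L psi.
Proof. by move=> E; apply: eq_bigr => p _; rewrite E. Qed.

Lemma pairingZ (R : realType) (L : seq (R * R)) a (phi : R -> R) :
  pairing L (fun x => a * phi x) = a * pairing L phi.
Proof. by rewrite mulr_sumr; apply: eq_bigr => p _; rewrite mulrCA. Qed.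

Lemma pairing_sum (R : realType) (L : seq (R * R)) (I : finType)
    (phi : I -> R -> R) :
  pairing L (fun x => \sum_i phi i x) = \sum_i pairing L (phi i).
Proof.
by rewrite exchange_big /=; apply: eq_bigr => p _; rewrite mulr_sumr.
Qed.

Lemma pairing_exchange (R : realType) (L L' : seq (R * R)) (phi : R -> R -> R) :
  pairing L (fun x => pairing L' (phi x)) =
  pairing L' (fun y => pairing L (fun x => phi x y)).
Proof.
rewrite /pairing; under eq_bigr do rewrite mulr_sumr.
rewrite exchange_big /=; apply: eq_bigr => p _; rewrite mulr_sumr.
by apply: eq_bigr => p' _; rewrite mulrCA.
Qed.

Lemma pairing_mul (R : realType) (L L' : seq (R * R)) (phi : R -> R) :
  pairing (comb_mul L L') phi =
  pairing L (fun x => pairing L' (fun y => phi (x + y))).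
Proof.
rewrite /pairing comb_mulE; apply: eq_bigr => p _; rewrite mulr_sumr.
by apply: eq_bigr => p' _; rewrite mulrA.
Qed.

Lemma pairing_dilate (R : realType) a (L : seq (R * R)) (phi : R -> R) :
  pairing (comb_dilate a L) phi = pairing L (fun x => phi (a * x)).
Proof. exact: comb_dilateE. Qed.

Lemma pairing_scale (R : realType) w (L : seq (R * R)) (phi : R -> R) :
  pairing (comb_scale w L) phi = w * pairing L phi.
Proof.
by rewrite /pairing big_map mulr_sumr; apply: eq_bigr => p _; rewrite mulrA.
Qed.

Lemma tsplineE (R : realType) r (L : seq (R * R)) x :
  tspline r L x = pairing L (fun a => tpow r (x - a)).
Proof. by []. Qed.

Lemma tspline_scale (R : realType) r w (L : seq (R * R)) :
  tspline r (comb_scale w L) = fun x => w * tspline r L x.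
Proof. by apply/funext => x; rewrite !tsplineE pairing_scale. Qed.

(* The first term of L is w times the point mass at b, the other ones lie at
   distance at least 1 to the right. *)
Definition leads (R : realType) (L : seq (R * R)) (b w : R) : Prop :=
  forall phi : R -> R, (forall y, b + 1 <= y -> phi y = 0) ->
    pairing L phi = w * phi b.

Lemma leads_mul (R : realType) (L L' : seq (R * R)) b b' w w' :
  leads L b w -> leads L' b' w' -> leads (comb_mul L L') (b + b') (w * w').
Proof.
move=> l l' phi phi0; rewrite pairing_mul l.
  rewrite l' ?mulrA // => y yb; apply: phi0; lra.
move=> x xb; rewrite l'.
  by rewrite phi0 ?mulr0 //; lra.
move=> y yb; apply: phi0; lra.
Qed.

Lemma leads_dilate (R : realType) (L : seq (R * R)) a b w : 1 <= a ->
  leads L b w -> leads (comb_dilate a L) (a * b) w.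
Proof.
move=> a1 l phi phi0; rewrite pairing_dilate l // => y yb; apply: phi0.
have a0 : 0 <= a by lra.
have := ler_wpM2l a0 yb; lra.
Qed.

Lemma leads_scale (R : realType) (L : seq (R * R)) v b w :
  leads L b w -> leads (comb_scale v L) b (v * w).
Proof. by move=> l phi phi0; rewrite pairing_scale l ?mulrA. Qed.

Lemma leads_tspline (R : realType) r (L : seq (R * R)) b w x :
  leads L b w -> x < b + 1 -> tspline r L x = w * tpow r (x - b).
Proof.
move=> l xb; rewrite tsplineE l // => y yb; rewrite /tpow subr_ge0 leNgt.
by rewrite (lt_le_trans xb yb).
Qed.

Section AbsoluteRefinement.
Variables (R : realType) (J : finType) (c0 : R) (c t : J -> R).

(** This is [c0 P(z^mu) = sum_j c_j z^(t_j) P(z)], with the original translations instead of the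
    gaps. *)
Definition comb_refinable (mu : R) (L : seq (R * R)) : Prop :=
  forall phi : R -> R, c0 * pairing L (fun x => phi (mu * x)) =
    \sum_j c j * pairing L (fun x => phi (x + t j)).

Lemma comb_refinable_scale mu w L :
  comb_refinable mu L -> comb_refinable mu (comb_scale w L).
Proof.
move=> h phi; rewrite pairing_scale mulrCA h mulr_sumr; apply: eq_bigr => j _.
by rewrite pairing_scale mulrCA.
Qed.

(** Truncated powers are homogeneous of degree [r], so a refinement of the comb becomes one of the
    spline, under the normalisation [ga * c0 * mu ^+ r = 1]. *)
Lemma tspline_refinable r mu ga L : 0 < mu -> ga * c0 * mu ^+ r = 1 ->
  comb_refinable mu L ->
  forall x, tspline r L x = \sum_j c j * ga * tspline r L (mu * x - t j).
Proof.
move=> mu0 h1 h x; have := h (fun u => tpow r (mu * x - u)).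
have -> : pairing L (fun a => tpow r (mu * x - mu * a)) =
    mu ^+ r * tspline r L x.
  rewrite tsplineE -pairingZ; apply: pairing_ext => a.
  rewrite -mulrBr /tpow pmulr_rge0 //; case: ifP => _; last by rewrite mulr0.
  by rewrite exprMn.
move=> h2; rewrite -[LHS]mul1r -h1 -!mulrA h2 mulr_sumr; apply: eq_bigr => j _.
rewrite mulrCA mulrA; congr (_ * _); rewrite tsplineE; apply: pairing_ext => a.
by rewrite opprD addrA addrAC.
Qed.

Variables (lam : R) (L : seq (R * R)).
Hypothesis lam_gt1 : 1 < lam.

Fixpoint conv_comb (n : nat) : seq (R * R) :=
  if n is m.+1 then comb_mul (conv_comb m) (comb_dilate (lam ^+ n) L) else L.

(** [conv_comb n] is [P(z) P(z^lam) ... P(z^(lam^n))]; the tail omits the factor [P(z)] and starts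
    from the unit comb. *)
Fixpoint conv_comb_tail (n : nat) : seq (R * R) :=
  if n is m.+1 then comb_mul (conv_comb_tail m) (comb_dilate (lam ^+ n) L)
  else [:: (0, 1)].

Lemma pairing_conv_comb n phi : pairing (conv_comb n) phi =
  pairing (conv_comb_tail n) (fun x => pairing L (fun y => phi (y + x))).
Proof.
elim: n phi => [|n IH] phi.
  rewrite /= /pairing big_seq1 mul1r; apply: eq_bigr => p _.
  by rewrite addr0.
rewrite /= !pairing_mul IH; apply: pairing_ext => x.
rewrite pairing_exchange; apply: pairing_ext => z; apply: pairing_ext => y.
by rewrite addrA.
Qed.

Lemma pairing_conv_comb_dilate n phi :
  pairing (conv_comb n) (fun x => phi (lam * x)) =
  pairing (conv_comb_tail n.+1) phi.
Proof.
elim: n phi => [|n IH] phi.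
  rewrite /= pairing_mul [RHS]/pairing big_seq1 mul1r pairing_dilate.
  by apply: pairing_ext => x; rewrite expr1 add0r.
rewrite [conv_comb_tail n.+2]/= -/(conv_comb_tail n.+1) [RHS]pairing_mul -IH /=.
rewrite pairing_mul; apply: pairing_ext => x; rewrite !pairing_dilate.
by apply: pairing_ext => y; rewrite mulrDr mulrA -exprS.
Qed.

(** Substituting [z^lam] shifts the factors by one: [P(z)] is lost and [P(z^(lam^(k+1)))] gained,
    and the latter is the mask times [P(z)]. *)
Lemma conv_comb_refinable k :
  comb_refinable (lam ^+ k.+1) L -> comb_refinable lam (conv_comb k).
Proof.
move=> h phi; rewrite pairing_conv_comb_dilate /= pairing_mul -pairingZ.
under eq_bigr do rewrite pairing_conv_comb -pairingZ.
rewrite -pairing_sum; apply: pairing_ext => x; rewrite pairing_dilate.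
rewrite (h (fun y => phi (x + y))); apply: eq_bigr => j _; congr (_ * _).
by apply: pairing_ext => y; rewrite addrCA addrA.
Qed.

Lemma conv_comb_leads b w n : leads L b w ->
  leads (conv_comb n) (\sum_(i < n.+1) lam ^+ i * b) (w ^+ n.+1).
Proof.
move=> l; elim: n => [|n IH].
  by rewrite big_ord1 expr0 mul1r expr1.
rewrite big_ord_recr exprSr; apply: leads_mul => //; apply: leads_dilate => //.
by rewrite exprn_ege1 // ltW.
Qed.

(** Each convolution raises the degree by [rho.+1]; [ka] collects the Euler integrals and the
    dilation factors, all nonzero. *)
Lemma conv_dilates_tspline rho n : exists2 ka : R, ka != 0 &
  conv_dilates lam (tspline rho L) n =
    tspline (n * rho.+1 + rho) (comb_scale ka (conv_comb n)).
Proof.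
have lam0 : 0 < lam by exact: lt_trans lam_gt1.
elim: n => [|n [ka ka0 IH]].
  exists 1; rewrite ?oner_neq0 // tspline_scale; apply/funext => x.
  by rewrite mul1r mul0n add0n.
pose la := lam ^+ n.+1; have la0 : 0 < la by rewrite exprn_gt0.
exists (euler_beta R (n * rho.+1 + rho) rho * (ka * la ^- rho)).
  apply: mulf_neq0; first by rewrite gt_eqF ?euler_beta_gt0.
  by rewrite mulf_neq0 // invr_eq0 expf_neq0 // gt_eqF.
rewrite /= IH (tspline_dilate rho L la0) -tspline_scale tspline_convolution.
rewrite tspline_scale; apply/funext => x; rewrite -mulrA; congr (_ * _).
have -> : ((n * rho.+1 + rho + rho).+1 = n.+1 * rho.+1 + rho)%N by lia.
rewrite !tsplineE !pairing_mul pairing_scale -mulrA; congr (_ * _).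
by rewrite -pairingZ; apply: pairing_ext => y; rewrite pairing_scale.
Qed.

End AbsoluteRefinement.

(** * Refinable functions up to germs *)

Lemma tpow_cont (R : realType) r (y : R) : y != 0 ->
  {for y, continuous (@tpow R r)}.
Proof.
have key (g : R -> R) : continuous g -> (\forall z \near y, g z = tpow r z) ->
    {for y, continuous (@tpow R r)}.
  move=> gc E; rewrite /prop_for /continuous_at -(nbhs_singleton E).
  by apply: cvg_trans (gc y); exact: near_eq_cvg.
rewrite neq_lt => /orP[y0|y0].
  apply: (key (fun=> 0)); first by move=> z; exact: cvg_cst.
  by move: (lt_nbhsl y0); apply: filterS => z z0; rewrite /tpow leNgt z0.
apply: (key (fun z => (z - 0) ^+ r)).
  have -> : (fun z : R => (z - 0) ^+ r) = horner 'X^r.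
    by apply/funext => z; rewrite hornerXn subr0.
  exact: continuous_horner.
by move: (lt_nbhsr y0); apply: filterS => z z0; rewrite /tpow ltW // subr0.
Qed.

Lemma cont_bigsum (R : realType) (T : eqType) (s : seq T) (f : T -> R -> R) x :
  (forall a, a \in s -> {for x, continuous (f a)}) ->
  {for x, continuous (fun y => \sum_(a <- s) f a y)}.
Proof.
elim: s => [|a s IH] h.
  rewrite (_ : (fun y => _) = cst 0); first exact: cvg_cst.
  by apply/funext => y; rewrite big_nil.
rewrite (_ : (fun y => _) = fun y => f a y + \sum_(b <- s) f b y).
  apply: cvgD; first by apply: h; rewrite mem_head.
  by apply: IH => b bs; apply: h; rewrite inE bs orbT.
by apply/funext => y; rewrite big_cons.
Qed.

Lemma refinable_germ_structure (R : realType) (I : finType) (lam c0 B : R)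
    (c : I -> R) (dl : I -> nat) (A : seq R) (F : R -> R) :
  1 < lam -> c0 != 0 -> (forall i, (0 < dl i)%N) ->
  germ_refinable lam c0 c dl F -> uniq A ->
  (forall x, x \notin A -> forall n, ndiff_near n F x) ->
  (forall x, B < `|x| -> F x = 0) ->
  ~ (forall x, germ0 F x) ->
  exists (r : nat) (C e : R) (q : R -> R), [/\ C != 0, 0 < e, c0^-1 = lam ^+ r
    & [/\ forall a, q a != 0 -> a \in A,
      forall b, q b = q (b / lam) - \sum_i c0^-1 * c i * q (b - (dl i)%:R),
      forall b, b < e -> q b = (b == 0)%:R
    & forall x, germ0 (fun y => F y - C * \sum_(a <- A) q a * tpow r (y - a)) x]].
Proof.
move=> lam1 c00 dl0 Fr uA Fs FB Fn.
have lam0 : 0 < lam by exact: lt_trans lam1.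
have Fneg x : x < 0 -> germ0 F x.
  apply: (germ_refinable_neg (B := - `|B|) lam1 Fr) => y yB.
  apply: nbhs_dnbhs; move: (lt_nbhsl yB); apply: filterS => z zB; apply: FB.
  by have := ler_norm B; have := ler_norm (- z); rewrite normrN; lra.
have Fl := F_left Fneg Fs.
have [e1 e10 he1] : exists2 e1 : R, 0 < e1 &
    forall y, 0 < y -> y < e1 -> F y = c0 * F (lam * y).
  have H : \forall y \near (0 : R)^', forall i, F (lam * y - (dl i)%:R) = 0.
    apply: filter_forall_fin => i.
    have lamn0 : lam != 0 by rewrite gt_eqF.
    apply: (near_scale_dnbhs (P := fun z => F (z - (dl i)%:R) = 0) lamn0).
    apply: (near_sub_dnbhs (P := fun z => F z = 0)); apply: Fneg.
    by rewrite mulr0 sub0r oppr_lt0 ltr0n.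
  have : \forall y \near (0 : R)^', F y = c0 * F (lam * y).
    move: H (Fr 0); apply: filterS2 => y H ->; rewrite [X in _ + X]big1 ?addr0 //.
    by move=> i _; rewrite H mulr0.
  move=> /near_dnbhs0P[e1 e10 he1]; exists e1 => // y y0 ye.
  by apply: he1; rewrite ?gt_eqF // gtr0_norm.
have [e2 e20 he2] := pos_seq_gap A.
pose e := Num.min e1 e2; have e0 : 0 < e by rewrite lt_min e10.
have [G [Gle Gh Gs FG]] : exists G : R -> R, [/\ forall t, t <= 0 -> G t = 0,
    forall t, G (lam * t) = c0^-1 * G t,
    forall n t, 0 < t -> ndiff_near n G t & forall t, 0 < t -> t < e -> G t = F t].
  apply: homogeneous_extension => //.
    by move=> y y0; rewrite lt_min => /andP[ye _]; exact: he1.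
  move=> n y y0; rewrite lt_min => /andP[_ ye]; apply: Fs; apply/negP => yA.
  by have := he2 y yA y0; rewrite leNgt ye.
(* A trivial profile would make [F] vanish near its left end, hence everywhere. *)
have Gn0 : ~ germ0 G 0.
  move=> /near_dnbhs0P[e' e'0 he']; apply: Fn.
  have m0 : 0 < Num.min e e' by rewrite lt_min e0.
  apply: (@germ_refinable_eq0 R I lam c0 c dl lam1 c00 dl0 F _ m0 Fr) => x xe.
  have [x0|x0] := ltP x 0; first exact: Fneg.
  have Fp : \forall y \near x^', 0 < y -> F y = 0.
    move: (nbhs_dnbhs (lt_nbhsl xe)); apply: filterS => y; rewrite lt_min.
    move=> /andP[ye ye'] y0; rewrite -FG // he' ?gt_eqF //.
    by rewrite gtr0_norm.
  have Fn' : \forall y \near x^', y < 0 -> F y = 0.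
    move: x0; rewrite le_eqVlt => /orP[/eqP<-|x0]; first exact: Fl.
    apply: nbhs_dnbhs; move: (lt_nbhsr x0); apply: filterS => y y0 y0'.
    by have := lt_trans y0 y0'; rewrite ltxx.
  move: (near_dnbhs_notin [:: 0] x) Fp Fn'; apply: filterS3 => y.
  by rewrite inE neq_lt => /orP[y0 _ /(_ y0)|y0 /(_ y0)].
have [q [q_supp q_ref q_small FH]] := @singular_part_exists R I lam c0 e c dl F G A
  lam1 c00 dl0 e0 Fr Fneg Fs Gle Gh Gs FG Gn0 uA.
have q0 : q 0 = 1 by rewrite q_small // eqxx.
have q0n : q 0 != 0 by rewrite q0 oner_neq0.
(* Coefficients at negative points vanish; dropping these points meets the sign condition of
   [homogeneous_comb_tpow]. *)
pose A' := [seq a <- A | 0 <= a].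
have sumA (phi : R -> R) : \sum_(a <- A) q a * phi a = \sum_(a <- A') q a * phi a.
  rewrite big_filter [LHS](bigID (fun a => 0 <= a)) /= [X in _ + X]big1 ?addr0 //.
  move=> a; rewrite -ltNge => a0; rewrite q_small ?(lt_trans a0) // lt_eqF //.
  by rewrite mul0r.
pose X := `|B| + \sum_(a <- A) `|a|.
have XA a : a \in A -> a <= X.
  move=> aA; rewrite /X (perm_big _ (perm_to_rem aA)) /= big_cons.
  have : 0 <= \sum_(j <- rem a A) `|j| by rewrite sumr_ge0.
  have := ler_norm a; have := normr_ge0 B; lra.
have HX x : X < x -> \sum_(a <- A') q a * G (x - a) = 0.
  move=> Xx; rewrite -(sumA (fun a => G (x - a))).
  have BX : B < x.
    apply: le_lt_trans Xx; rewrite /X; have := ler_norm B.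
    have : 0 <= \sum_(a <- A) `|a| by rewrite sumr_ge0.
    lra.
  apply: (@germ0_cont R (fun y => \sum_(a <- A) q a * G (y - a))).
    apply: cont_bigsum => a aA.
    have sh : {for x, continuous (fun y : R => y - a)}.
      by apply: cvgB; [exact: cvg_id|exact: cvg_cst].
    have Gc : {for x - a, continuous G}.
      apply: (@ndiff_near_cont _ 0); apply: Gs.
      by rewrite subr_gt0 (le_lt_trans (XA a aA)).
    apply: cvgM; first exact: cvg_cst.
    exact: (@cvg_comp _ _ _ (fun y => y - a) G _ _ _ sh Gc).
  move: (FH x) (nbhs_dnbhs (lt_nbhsr BX)); apply: filterS2 => y + By.
  rewrite FB ?sub0r; last exact: lt_le_trans (ler_norm y).
  by move=> /eqP; rewrite oppr_eq0 => /eqP.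
have A0 : 0 \in A' by rewrite mem_filter lexx /=; exact: q_supp.
have [|r [C [c0r C0 GC]]] := @homogeneous_comb_tpow R lam c0 X A' q G lam1 c00
    (filter_uniq _ uA) _ A0 q0n Gle Gh Gs Gn0 HX.
  by move=> a; rewrite mem_filter => /andP[].
exists r, C, e, q; split=> //; split=> // x.
move: (FH x) (near_dnbhs_notin A x); apply: filterS2 => y + yA.
suff -> : \sum_(a <- A) q a * G (y - a) = C * \sum_(a <- A) q a * tpow r (y - a).
  by [].
rewrite mulr_sumr big_seq [RHS]big_seq; apply: eq_bigr => a aA.
rewrite GC; first by ring.
by rewrite subr_eq0; apply: contra yA => /eqP ->.
Qed.

(** * Passing between almost everywhere equality and germs *)

Lemma ae_continuous_eq0 (R : realType) (h : R -> R) (y : R) :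
  {ae (@lebesgue_measure R), forall x : R, h x = 0} ->
  {for y, continuous h} -> h y = 0.
Proof.
move=> [N [mN N0 hN]] hc; apply/eqP/negPn/negP => hy.
have hy0 : 0 < `|h y| by rewrite normr_gt0.
move: hc => /cvgrPdist_lt /(_ _ hy0) /nbhs_ballP[e /= e0 he].
have sub : [set` `]y - e, y + e[] `<=` N.
  move=> z /=; rewrite in_itv /= => /andP[z1 z2]; apply: hN => /= hz.
  have : ball y e z by rewrite /ball /= ltr_norml; apply/andP; split; lra.
  by move=> /he; rewrite hz subr0 ltxx.
have := @le_measure _ _ _ (@lebesgue_measure R) [set` `]y - e, y + e[] N.
rewrite !inE => /(_ (measurable_itv _) mN sub).
have E := @lebesgue_measure_itv R `]y - e, y + e[.
rewrite [X in (_ <= X)%E]N0 [X in (X <= _)%E]E /= lte_fin ifT; last lra.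
by rewrite lee_fin; lra.
Qed.

Lemma ae_eq_off_seq (R : realType) (E : seq R) (f g : R -> R) :
  (forall x, x \notin E -> f x = g x) -> ae_eq_fun f g.
Proof.
move=> h; have Ec := finite_set_countable (finite_seq E).
exists [set` E]; split.
- exact: countable_measurable.
- exact: countable_lebesgue_measure0.
- by move=> x /= fx; apply/negPn/negP => xE; apply: fx; exact: h.
Qed.

Lemma piecewise_smooth_off_seq (R : realType) (f : R -> R) :
  piecewise_smooth f -> exists (A : seq R) (B : R), [/\ uniq A,
    forall x, x \notin A -> forall n, ndiff_near n f x
  & forall x, B < `|x| -> f x = 0].
Proof.
move=> [M [a [M0 amono asm asupp]]].
pose A := undup [seq a j | j <- iota 1 M].
have aA j : (1 <= j <= M)%N -> a j \in A.
  by move=> jM; rewrite mem_undup map_f // mem_iota; lia.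
have out x : ~~ (a 1%N <= x <= a M) -> f x = 0.
  move=> xa; apply/eqP; apply: contraNT xa => fx.
  by have := asupp x (subset_closure _); rewrite /= in_itv /=; exact.
exists A, (`|a 1%N| + `|a M|); split; first exact: undup_uniq.
  move=> x xA n; have [/andP[x1 xM]|] := boolP (a 1%N <= x <= a M); last first.
    rewrite negb_and -!ltNge => /orP[x1|x1].
      apply: (@ndiff_near_eq _ n (cst 0)); last exact: ndiff_near_cst.
      move: (lt_nbhsl x1); apply: filterS => y y1; rewrite out //.
      by rewrite negb_and -ltNge y1.
    apply: (@ndiff_near_eq _ n (cst 0)); last exact: ndiff_near_cst.
    move: (lt_nbhsr x1); apply: filterS => y y1; rewrite out //.
    by rewrite negb_and -!ltNge y1 orbT.
  have [j [jM xj jx]] : exists j, [/\ (1 <= j < M)%N, a j < x & x < a j.+1].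
    have lt1 : a 1%N < x.
      rewrite lt_neqAle x1 andbT; apply: contra xA => /eqP <-; apply: aA.
      by rewrite leqnn.
    have ltM : x < a M.
      rewrite lt_neqAle xM andbT; apply: contra xA => /eqP ->; apply: aA.
      by rewrite leqnn M0.
    have H k : (1 <= k <= M)%N -> x < a k ->
        exists j, [/\ (1 <= j < M)%N, a j < x & x < a j.+1].
      elim: k => [//|k IH] /andP[_ kM] xk.
      have [k0|k0] := posnP k; first by move: xk; rewrite k0 ltNge (ltW lt1).
      have [h|h] := ltP (a k) x; first by exists k; rewrite k0.
      apply: IH; first by rewrite k0 ltnW.
      rewrite lt_neqAle h andbT; apply: contra xA => /eqP ->.
      by apply: aA; rewrite k0 ltnW.
    by apply: (H M) => //; rewrite M0 leqnn.
  apply: (@smooth_ndiff_near R [set` `]a j, a j.+1[]); first exact: itv_open.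
    exact: asm.
  by rewrite /= in_itv /= xj jx.
move=> x xB; apply: out; apply: contraTN xB => /andP[x1 xM]; rewrite -leNgt.
rewrite ler_norml; apply/andP; split.
  have := ler_norm (- a 1%N); rewrite normrN; have := normr_ge0 (a M); lra.
have := ler_norm (a M); have := normr_ge0 (a 1%N); lra.
Qed.

Lemma ae_germ (R : realType) (E : seq R) (h : R -> R) (x : R) :
  {ae (@lebesgue_measure R), forall x : R, h x = 0} ->
  (forall y, y \notin E -> {for y, continuous h}) -> germ0 h x.
Proof.
move=> hae hc; move: (near_dnbhs_notin E x); apply: filterS => y yE.
by apply: ae_continuous_eq0 => //; exact: hc.
Qed.

Lemma germ_ae (R : realType) (E : seq R) (f g : R -> R) :
  (forall x, germ0 (fun y => f y - g y) x) ->
  (forall y, y \notin E -> {for y, continuous f}) ->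
  (forall y, y \notin E -> {for y, continuous g}) -> ae_eq_fun f g.
Proof.
move=> h fc gc; apply: (@ae_eq_off_seq _ E) => x xE.
apply/eqP; rewrite -subr_eq0; apply/eqP.
apply: (@germ0_cont R (fun y => f y - g y)) => //.
by apply: cvgB; [exact: fc|exact: gc].
Qed.

(** * The mask *)

Lemma tspline_cont (R : realType) r (L : seq (R * R)) (y : R) :
  y \notin map fst L -> {for y, continuous (tspline r L)}.
Proof.
move=> yL; apply: cont_bigsum => p pL; apply: cvgM; first exact: cvg_cst.
have sh : {for y, continuous (fun z : R => z - p.1)}.
  by apply: cvgB; [exact: cvg_id|exact: cvg_cst].
apply: (@cvg_comp _ _ _ (fun z => z - p.1) (tpow r) _ _ _ sh).
apply: tpow_cont; rewrite subr_eq0; apply: contra yL => /eqP ->.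
exact: map_f.
Qed.

Lemma sum_tpow_small (R : realType) (A : seq R) (q : R -> R) (e : R) r y :
  0 < e -> uniq A -> (forall a, q a != 0 -> a \in A) ->
  (forall b, b < e -> q b = (b == 0)%:R) -> y < e ->
  \sum_(a <- A) q a * tpow r (y - a) = tpow r y.
Proof.
move=> e0 uA qA qs ye.
have sa a : a \in A -> q a * tpow r (y - a) = if a == 0 then tpow r y else 0.
  move=> _; have [->|a0] := eqVneq a 0; first by rewrite qs // eqxx mul1r subr0.
  have [ae|ea] := ltP a e; first by rewrite qs // (negbTE a0) mul0r.
  by rewrite /tpow subr_ge0 leNgt (lt_le_trans ye ea) mulr0.
rewrite big_seq (eq_bigr _ sa) -big_seq -big_mkcond /= big_const_seq.
have A0 : 0 \in A by apply: qA; rewrite qs // eqxx oner_neq0.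
by rewrite count_uniq_mem // A0 /= addr0.
Qed.

Section Mask.
Variables (R : realType) (N : nat) (lam : R) (c : 'I_N.+1 -> R)
  (d : 'I_N.+1 -> int) (j0 : 'I_N.+1).
Hypotheses (lam_gt1 : 1 < lam)
  (d_incr : forall i j : 'I_N.+1, (i < j)%N -> d i < d j)
  (c_sum : \sum_(j < N.+1) c j = lam)
  (c_j0 : c j0 != 0) (c_lt : forall j : 'I_N.+1, (j < j0)%N -> c j = 0).

Definition mask_tail (j : 'I_N.+1) : R := if (j0 < j)%N then c j else 0.
(** The value 1 for [j <= j0], where [mask_tail] is 0, keeps all gaps positive. *)
Definition mask_gap (j : 'I_N.+1) : nat := if (j0 < j)%N then `|d j - d j0|%N else 1%N.

Local Notation d0 := ((d j0)%:~R : R).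
Local Notation cc := mask_tail.
Local Notation dl := mask_gap.

Lemma mask_gap_gt0 j : (0 < dl j)%N.
Proof.
rewrite /mask_gap; case: ifP => // h; have := d_incr h.
by rewrite absz_gt0 subr_eq0 => /gt_eqF ->.
Qed.

Lemma mask_gapE (j : 'I_N.+1) : (j0 < j)%N -> (d j)%:~R = d0 + (dl j)%:R.
Proof.
move=> h; rewrite /mask_gap h; have := d_incr h => dd.
have -> : (`|d j - d j0|%N)%:R = (d j - d j0)%:~R :> R.
  by rewrite -[in RHS](@gez0_abs (d j - d j0)) ?subr_ge0 ?ltW.
by rewrite intrB addrC subrK.
Qed.

Lemma mask_sum (phi : R -> R) : \sum_j c j * phi (d j)%:~R =
  c j0 * phi d0 + \sum_j cc j * phi (d0 + (dl j)%:R).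
Proof.
rewrite (bigD1 j0) //= [in RHS](bigD1 j0) //= /mask_tail ltnn mul0r add0r.
congr (_ + _); apply: eq_bigr => j; case: ltngtP => [jj|jj|/val_inj->] // jn.
- by rewrite mask_gapE.
- by rewrite c_lt // !mul0r.
- by rewrite eqxx in jn.
Qed.

(** The fixed point of [x -> lam * x - d0], which is the left end of the support of [f]. *)
Local Notation a0 := (d0 / (lam - 1)).

Lemma lam_a0 : lam * a0 = a0 + d0.
Proof. by field; rewrite subr_eq0 gt_eqF. Qed.

Lemma refinement_shift (g : R -> R) y :
  \sum_j c j * g (lam * (a0 + y) - (d j)%:~R) =
  c j0 * g (a0 + lam * y) + \sum_j cc j * g (a0 + (lam * y - (dl j)%:R)).
Proof.
rewrite (mask_sum (fun u => g (lam * (a0 + y) - u))) mulrDr lam_a0.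
congr (_ * g _ + _); first by ring.
by apply: eq_bigr => j _; congr (_ * g _); ring.
Qed.

Lemma refinable_shift (f : R -> R) :
  (forall x, \forall y \near x^', f y = \sum_j c j * f (lam * y - (d j)%:~R)) ->
  germ_refinable lam (c j0) cc dl (fun t => f (a0 + t)).
Proof.
move=> h x; have := @near_affine_dnbhs R 1 a0 x _ (oner_neq0 _) (h _).
by apply: filterS => y; rewrite mul1r [y + _]addrC refinement_shift.
Qed.

Lemma mask_tail_sum : c j0 + \sum_j cc j = lam.
Proof.
rewrite -c_sum; have := mask_sum (fun=> 1); rewrite mulr1.
by under eq_bigr do rewrite mulr1; move=> ->; under [in RHS]eq_bigr do rewrite mulr1.
Qed.

Section Function.
Variable f : R -> R.
Hypotheses (f_psmooth : piecewise_smooth f) (f_neq0 : ~ ae_eq_fun f (fun=> 0))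
  (f_ref : fun_refinable lam c d f).

Lemma germs_of_refinable : exists (r : nat) (C e : R) (q : R -> R) (A E : seq R),
  [/\ [/\ C != 0, 0 < e, (c j0)^-1 = lam ^+ r & uniq A],
   [/\ forall a, q a != 0 -> a \in A,
      forall b, q b = q (b / lam) -
        \sum_i (c j0)^-1 * cc i * q (b - (dl i)%:R)
    & forall b, b < e -> q b = (b == 0)%:R],
   forall y, y \notin E -> {for y, continuous f},
   germ_refinable lam (c j0) cc dl (fun t => f (a0 + t))
 & forall x, germ0 (fun y => f (a0 + y) -
      C * \sum_(a <- A) q a * tpow r (y - a)) x].
Proof.
have lam0 : 0 < lam by exact: lt_trans lam_gt1.
have [A [B [uA fs fB]]] := piecewise_smooth_off_seq f_psmooth.
have fc y : y \notin A -> {for y, continuous f}.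
  by move=> yA; exact: (@ndiff_near_cont _ 0 _ _ (fs y yA 1%N)).
(* The break points of both sides of the equation: off [E] both are continuous, so almost everywhere
   equality is equality. *)
pose E := A ++ flatten [seq [seq (a + (d j)%:~R) / lam | a <- A] | j <- enum 'I_N.+1].
have germ x : germ0 (fun y => f y - \sum_j c j * f (lam * y - (d j)%:~R)) x.
  apply: (@ae_germ R E).
    have [S [mS S0 hS]] := f_ref; exists S; split=> // z /= nz.
    by apply: hS => /= fz; apply: nz; rewrite fz subrr.
  move=> y; rewrite mem_cat negb_or => /andP[yA yE].
  apply: cvgB; first exact: fc.
  apply: cont_bigsum => j _; apply: cvgM; first exact: cvg_cst.
  have yj : lam * y - (d j)%:~R \notin A.
    apply: contra yE => yA'; apply/flattenP.
    exists [seq (a + (d j)%:~R) / lam | a <- A].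
      by apply/mapP; exists j; rewrite ?mem_enum.
    apply/mapP; exists (lam * y - (d j)%:~R) => //.
    by rewrite subrK mulrC mulKf // gt_eqF.
  apply: (@cvg_comp _ _ _ (fun z => lam * z - (d j)%:~R) f _ _ _ _ (fc _ yj)).
  exact: affine_cvg.
have Fr : germ_refinable lam (c j0) cc dl (fun t => f (a0 + t)).
  apply: refinable_shift => x; move: (germ x); apply: filterS => y /eqP.
  by rewrite subr_eq0 => /eqP.
pose A' := [seq a - a0 | a <- A].
have [||||r [C [e [q [C0 e0 c0r [h1 h2 h3 h4]]]]]] :=
  @refinable_germ_structure R _ lam (c j0) (`|B| + `|a0|) cc dl A'
    (fun t => f (a0 + t)) lam_gt1 c_j0 mask_gap_gt0 Fr.
- by rewrite map_inj_uniq //; exact: addIr.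
- move=> x xA n.
  have -> : (fun t => f (a0 + t)) = (fun t => f (1 * t + a0)).
    by apply/funext => t; rewrite mul1r addrC.
  apply: ndiff_near_affine; rewrite mul1r; apply: fs.
  by apply: contra xA => xA; apply/mapP; exists (x + a0); rewrite ?addrK.
- move=> x xB; apply: fB; apply: le_lt_trans (ler_norm B) _.
  by have := ler_normB (a0 + x) a0; rewrite addrAC subrr add0r; lra.
- move=> F0; apply: f_neq0; apply: (@germ_ae R A) => //.
    move=> x; have := near_sub_dnbhs (F0 (x - a0)); apply: filterS => y.
    by rewrite addrC subrK subr0.
  by move=> y _; exact: cvg_cst.
exists r, C, e, q, A', A; split=> //; split=> //.
by rewrite map_inj_uniq //; exact: addIr.
Qed.

End Function.
End Mask.

Definition comb_of (R : realType) (b : R) (A : seq R) (q : R -> R) : seq (R * R) :=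
  [seq (b + a, q a) | a <- A].

Lemma pairing_comb_of (R : realType) b (A : seq R) q (phi : R -> R) :
  pairing (comb_of b A q) phi = \sum_(a <- A) q a * phi (b + a).
Proof. by rewrite /pairing big_map. Qed.

(** To the right of all its points the spline is a polynomial whose expansion involves only moments
    of order at most [rho]. *)
Lemma tspline_comb_of_support (R : realType) (rho : nat) (b : R) (A : seq R)
    (q : R -> R) :
  (forall a, a < 0 -> q a = 0) ->
  (forall i, (i <= rho)%N -> \sum_(a <- A) q a * a ^+ i = 0) ->
  exists X, forall x, X < `|x| -> tspline rho (comb_of b A q) x = 0.
Proof.
move=> qneg mom; exists (`|b| + \sum_(a <- A) `|a|) => x hx.
have S0 (s : seq R) : 0 <= \sum_(a <- s) `|a| by rewrite sumr_ge0.
rewrite tsplineE pairing_comb_of; have [x0|x0] := ltP x 0.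
  have xb : x < b.
    move: hx; rewrite (ltr0_norm x0).
    by have := S0 A; have := ler_norm (- b); rewrite normrN; lra.
  rewrite big1 // => a _; have [a0|a0] := ltP a 0; first by rewrite qneg // mul0r.
  rewrite /tpow subr_ge0 leNgt ifF ?mulr0 //; apply/negbTE; rewrite negbK.
  by rewrite (lt_le_trans xb) // lerDl.
have xa a : a \in A -> 0 <= x - (b + a).
  move=> aA; move: hx; rewrite (ger0_norm x0).
  rewrite (perm_big _ (perm_to_rem aA)) /= big_cons.
  by have := S0 (rem a A); have := ler_norm a; have := ler_norm b; lra.
rewrite big_seq (eq_bigr (fun a => q a * ((x - b) - a) ^+ rho)); last first.
  by move=> a aA; rewrite /tpow xa // opprD addrA.
rewrite -big_seq; under eq_bigr do rewrite exprBn mulr_sumr.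
rewrite exchange_big big1 //= => i _.
transitivity (((-1) ^+ i * (x - b) ^+ (rho - i) *+ 'C(rho, i)) *
    \sum_(a <- A) q a * a ^+ i).
  rewrite mulr_sumr; apply: eq_bigr => a _; rewrite mulrnAr mulrnAl.
  by congr (_ *+ _); ring.
by rewrite mom ?mulr0 // -ltnS.
Qed.

(** * Integral powers, the generator and the factorization for a given comb *)

Section FinalMask.
Variables (R : realType) (N : nat) (lam : R) (c : 'I_N.+1 -> R)
  (d : 'I_N.+1 -> int) (j0 : 'I_N.+1).
Hypotheses (lam_gt1 : 1 < lam)
  (d_incr : forall i j : 'I_N.+1, (i < j)%N -> d i < d j)
  (c_sum : \sum_(j < N.+1) c j = lam)
  (c_j0 : c j0 != 0) (c_lt : forall j : 'I_N.+1, (j < j0)%N -> c j = 0).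
Variables (r : nat) (e : R) (q : R -> R) (A : seq R).
Hypotheses (e_gt0 : 0 < e) (c0_lam : (c j0)^-1 = lam ^+ r) (A_uniq : uniq A)
  (q_supp : forall a, q a != 0 -> a \in A)
  (q_ref : forall b, q b = q (b / lam) -
    \sum_i (c j0)^-1 * mask_tail c j0 i * q (b - (mask_gap d j0 i)%:R))
  (q_small : forall b, b < e -> q b = (b == 0)%:R).

Local Notation c0 := (c j0).
Local Notation cc := (mask_tail c j0).
Local Notation dl := (mask_gap d j0).
Local Notation d0 := ((d j0)%:~R : R).

Let lam_gt0 : 0 < lam. Proof. exact: lt_trans lam_gt1. Qed.
Let dl_gt0 : forall j, (0 < dl j)%N. Proof. exact: mask_gap_gt0. Qed.

Let c0E : c0 = lam ^- r. Proof. by rewrite -c0_lam invrK. Qed.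

Lemma int_power : exists l : nat, (0 < l)%N /\ lam ^+ l \is a Num.int.
Proof.
have [j1 cj1 jmax] := @arg_maxnP _ j0 (fun j => c j != 0) (@nat_of_ord _) c_j0.
(* With a single nonzero coefficient, the sum rule would give [c j0 = lam > 1], against
   [c j0 = lam ^- r <= 1]. *)
have j01 : (j0 < j1)%N.
  have j0j1 : (j0 <= j1)%N := jmax j0 c_j0.
  rewrite ltn_neqAle j0j1 andbT; apply/negP => /eqP E.
  have jE : j0 = j1 by exact: val_inj.
  have : c0 = lam.
    rewrite -c_sum (bigD1 j0) //= big1 ?addr0 // => j jn.
    apply/eqP/negPn/negP => cj; have jl : (j <= j1)%N := jmax j cj.
    have : (j0 <= j)%N by rewrite leqNgt; apply: contra cj => /c_lt ->.
    move=> jg; move: jn; rewrite -val_eqE /= eqn_leq jg andbT.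
    by rewrite E jl.
  rewrite c0E => h; have : lam ^- r <= 1.
    by rewrite invf_le1 ?exprn_gt0 // exprn_ege1 // ltW.
  by rewrite h leNgt lam_gt1.
have ccj1 : cc j1 != 0 by rewrite /mask_tail j01.
apply: (exists_int_power lam_gt1 c_j0 dl_gt0 e_gt0 q_supp q_ref q_small ccj1).
move=> i ij; rewrite /mask_tail; case: ifP => [j0i ci|]; last by rewrite eqxx.
have il : (i < j1)%N.
  by rewrite ltn_neqAle (jmax i ci : (i <= j1)%N) andbT; apply: contra ij => /eqP /val_inj ->.
have := d_incr il; rewrite -(@ltr_int R) (mask_gapE R d_incr j0i).
by rewrite (mask_gapE R d_incr j01) ltrD2l ltr_nat.
Qed.

Variable k : nat.
Hypotheses (k_gt0 : (0 < k)%N) (lamk_int : lam ^+ k \is a Num.int)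
  (k_min : forall m : nat, (0 < m < k)%N -> lam ^+ m \isn't a Num.int).

Let mu := lam ^+ k.
Let mu_gt1 : 1 < mu. Proof. by rewrite exprn_egt1 // -lt0n. Qed.
Let mu_gt0 : 0 < mu. Proof. exact: lt_trans mu_gt1. Qed.
(** The left end for the dilation factor [mu]: the fixed point of [x -> mu * x - d0]. *)
Let b0 := d0 / (mu - 1).

Lemma generator_exists : exists (rho : nat) (L : seq (R * R)),
  [/\ (r = k.-1 * rho.+1 + rho)%N, leads L b0 1,
      comb_refinable c0 c (fun j => (d j)%:~R) mu L
    & exists X, forall x, X < `|x| -> tspline rho L x = 0].
Proof.
have /natrP[L lamk] : mu \is a Num.nat by rewrite natrEint lamk_int ltW.
pose q1 := int_part q.
have q1_supp a : q1 a != 0 -> a \in A by exact: int_part_supp.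
have q1_small b : b < e -> q1 b = (b == 0)%:R by exact: int_part_small.
have q1_ref := int_part_refinement lam_gt1 c_j0 dl_gt0 e_gt0 q_ref q_small
  k_gt0 lamk k_min.
have H := comb_refinement mu_gt0 c_j0 A_uniq q1_supp q1_ref.
have q10 : q1 0 != 0 by rewrite q1_small // eqxx oner_neq0.
have exm := exists_moment_neq0 A_uniq (q1_supp 0 q10) q10.
have [m Mm mmin] := ex_minnP exm.
have M0 i : (i < m)%N -> \sum_(a <- A) q1 a * a ^+ i = 0.
  by move=> im; apply/eqP; apply: contraTT im => /mmin; rewrite -leqNgt.
have hm := moment_refinement H M0 Mm.
rewrite (mask_tail_sum d_incr c_sum c_lt) c0E /mu -exprM in hm.
have km : (k * m = r.+1)%N.
  apply: (ieexprIn lam_gt0); first by rewrite gt_eqF.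
  have l0 : lam ^+ r != 0 by rewrite expf_neq0 // gt_eqF.
  by apply: (mulfI (invr_neq0 l0)); rewrite hm exprSr mulrA mulVf // mul1r.
have m0 : (0 < m)%N by case: (m) km => //; rewrite muln0.
have rE : (r = k.-1 * m.-1.+1 + m.-1)%N.
  rewrite prednK //; apply: succn_inj; rewrite -km -addnS prednK //.
  by rewrite -{1}(prednK k_gt0) mulSn addnC.
have q1_neg a : a < 0 -> q1 a = 0.
  by move=> a0; rewrite q1_small ?(lt_trans a0) // lt_eqF.
exists m.-1, (comb_of b0 A q1); split=> //; last first.
- by apply: tspline_comb_of_support => // i im; apply: M0; rewrite -ltnS prednK in im.
- move=> phi; rewrite pairing_comb_of.
  under [RHS]eq_bigr do rewrite pairing_comb_of.
  have mub : mu * b0 = b0 + d0 by rewrite /b0; field; rewrite subr_eq0 gt_eqF.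
  have := H (fun u => phi (b0 + d0 + u)) => h.
  transitivity (c0 * \sum_(a <- A) q1 a * phi (b0 + d0 + mu * a)).
    by congr (_ * _); apply: eq_bigr => a _; rewrite mulrDr mub.
  rewrite h (mask_sum d_incr c_lt (fun u => \sum_(a <- A) q1 a * phi (b0 + a + u))).
  congr (_ * _ + _); first by apply: eq_bigr => a _; rewrite addrAC.
  apply: eq_bigr => j _; congr (_ * _); apply: eq_bigr => a _.
  by congr (_ * phi _); ring.
(* The points of the integer part are natural numbers, so all but 0 are at least 1. *)
- move=> phi phi0; rewrite pairing_comb_of mul1r.
  have sa a : a \in A -> q1 a * phi (b0 + a) = if a == 0 then phi b0 else 0.
    move=> _; have [->|a0] := eqVneq a 0; first by rewrite q1_small // eqxx mul1r addr0.
    rewrite /q1 /int_part; case: ifP => [/natrP[n an]|]; last by rewrite mul0r.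
    rewrite phi0 ?mulr0 // lerD2l an ler1n lt0n; apply: contra a0 => /eqP n0.
    by rewrite an n0.
  rewrite big_seq (eq_bigr _ sa) -big_seq -big_mkcond /= big_const_seq.
  by rewrite count_uniq_mem // (q1_supp 0 q10) /= addr0.
Qed.

Definition generator_dist (Phi : (R -> R) -> R) : Prop :=
  [/\ compactly_supported_distribution Phi, nonzero_distribution Phi
    & dist_refinable mu (fun j => c j * lam ^+ k.-1) d Phi].

Section Generator.
Variables (rho : nat) (L : seq (R * R)).
Hypotheses (r_rho : (r = k.-1 * rho.+1 + rho)%N) (L_leads : leads L b0 1)
  (L_ref : comb_refinable c0 c (fun j => (d j)%:~R) mu L)
  (L_supp : exists X, forall x, X < `|x| -> tspline rho L x = 0).

Lemma generator_spline_dist : generator_dist (spline_dist rho L).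
Proof.
have [X hX] := L_supp; split.
- exact: spline_dist_compact hX.
- apply: (@spline_dist_neq0 _ _ _ b0) => x xb.
  by rewrite (leads_tspline rho L_leads xb) mul1r.
- apply: (spline_dist_refinable mu_gt0) => x.
  rewrite [LHS](tspline_refinable (ga := lam ^+ k.-1) (r := rho) mu_gt0 _ L_ref) //.
  rewrite c0E /mu -exprM mulrAC -exprD.
  have -> : (k.-1 + k * rho = r)%N.
    by rewrite r_rho mulnS -{2}(prednK k_gt0) mulSn [(rho + _)%N]addnC addnA.
  by rewrite mulfV // expf_neq0 // gt_eqF.
Qed.

Lemma generator_unique Phi : generator_dist Phi ->
  exists2 be : R, be != 0 & forall g, test_function g ->
    Phi g = be * spline_dist rho L g.
Proof.
move=> [Pc Pn Pr]; have [Sc Sn Sr] := generator_spline_dist.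
have cs : \sum_j c j * lam ^+ k.-1 = mu.
  by rewrite -mulr_suml c_sum -exprS prednK.
have [chi hchi] := dist_unique mu_gt1 cs Pc Pr Sc Sr.
have S0 : spline_dist rho L chi != 0.
  apply/negP => /eqP z; have [g gt /negP] := Sn; apply; apply/eqP.
  by have [_] := hchi g gt; exact.
exists (Phi chi / spline_dist rho L chi).
  rewrite mulf_neq0 ?invr_eq0 //; apply/negP => /eqP z.
  have [g gt /negP] := Pn; apply; apply/eqP.
  by have [+ _] := hchi g gt; rewrite z mul0r => /eqP; rewrite mulf_eq0 (negbTE S0) orbF => /eqP.
move=> g gt; have [h _] := hchi g gt; apply: (mulIf S0); rewrite h.
by field.
Qed.

Lemma generator_scaled be g : test_function g ->
  \int[@lebesgue_measure R]_x (tspline rho (comb_scale be L) x * g x) =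
  be * spline_dist rho L g.
Proof.
move=> gt; rewrite /spline_dist.
rewrite -(RintegralZl be measurableT (tspline_test rho L gt).1).
by congr (Rintegral _ _ _); apply/funext => x; rewrite tspline_scale mulrA.
Qed.

Lemma generator_spline_distribution Phi :
  generator_dist Phi -> spline_distribution Phi.
Proof.
move=> /generator_unique[be _ h]; exists (tspline rho (comb_scale be L)).
  exact: tspline_spline.
by move=> g gt; rewrite generator_scaled // h.
Qed.

Lemma convolution_factorization (f : R -> R) (C : R) (E : seq R) Phi phi :
  (forall y, y \notin E -> {for y, continuous f}) ->
  germ_refinable lam c0 cc dl (fun t => f (d0 / (lam - 1) + t)) ->
  (forall x, germ0 (fun y => f (d0 / (lam - 1) + y) -
      C * \sum_(a <- A) q a * tpow r (y - a)) x) ->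
  generator_dist Phi -> spline phi -> is_dist_of_fun phi Phi ->
  exists alpha : R,
    ae_eq_fun f (fun x => alpha * conv_dilates lam phi k.-1 x).
Proof.
move=> fc Fr Fg /generator_unique[be be0 PhiE] phis phiD.
pose L1 := comb_scale be L.
have phiE : phi = tspline rho L1.
  apply/funext => x; rewrite tspline_scale.
  apply: (spline_rep_unique (be := be) phis (tspline_spline rho L)) => g gt.
  by rewrite -phiD // PhiE.
have L1_leads : leads L1 b0 be by have := leads_scale be L_leads; rewrite mulr1.
have L1_ref : comb_refinable c0 c (fun j => (d j)%:~R) (lam ^+ k.-1.+1) L1.
  by rewrite prednK //; exact: comb_refinable_scale.
have [ka ka0 convE] := conv_dilates_tspline L1 lam_gt1 rho k.-1.
pose Lc := conv_comb lam L1 k.-1.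
pose h := tspline r Lc.
(* The left ends of the [k] factors add up to that of [f], by the geometric sum
   [(lam ^+ k - 1) / (lam - 1)]. *)
have a0E : \sum_(i < k.-1.+1) lam ^+ i * b0 = d0 / (lam - 1).
  rewrite -mulr_suml prednK // /b0 /mu subrX1.
  have l1 : lam - 1 != 0 by rewrite subr_eq0 gt_eqF.
  have : mu - 1 != 0 by rewrite subr_eq0 gt_eqF.
  rewrite /mu subrX1 mulf_eq0 negb_or => /andP[_ s0].
  set S := \sum_(i < k) _ in s0 *.
  by field; rewrite l1 s0.
have Lc_leads : leads Lc (d0 / (lam - 1)) (be ^+ k).
  by have := @conv_comb_leads R lam L1 lam_gt1 b0 be k.-1 L1_leads; rewrite a0E prednK.
have h_ref x : h x = \sum_j c j * h (lam * x - (d j)%:~R).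
  have Lr : comb_refinable c0 c (fun j => (d j)%:~R) lam Lc.
    exact: conv_comb_refinable.
  rewrite /h [LHS](tspline_refinable (ga := 1) (r := r) lam_gt0 _ Lr).
    by apply: eq_bigr => j _; rewrite mulr1.
  by rewrite mul1r c0E mulVf // expf_neq0 // gt_eqF.
have bk0 : be ^+ k != 0 by rewrite expf_neq0.
(* Near the left end [f] is [C] times a truncated power and [h] is [be ^+ k] times the same one. *)
pose al := C / be ^+ k.
have ah_ref x : \forall y \near x^',
    al * h y = \sum_j c j * (al * h (lam * y - (d j)%:~R)).
  apply: nearW => y; rewrite {1}h_ref mulr_sumr; apply: eq_bigr => j _; ring.
have Hr := refinable_shift lam_gt1 d_incr c_lt ah_ref.
pose U t := f (d0 / (lam - 1) + t) - al * h (d0 / (lam - 1) + t).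
have Ur : germ_refinable lam c0 cc dl U.
  move=> x; move: (Fr x) (Hr x); apply: filterS2 => y Fy Hy.
  rewrite /U Fy Hy /U mulrBr.
  under [X in _ = _ + X]eq_bigr do rewrite mulrBr.
  rewrite sumrB; ring.
have m0 : 0 < Num.min e 1 by rewrite lt_min e_gt0 ltr01.
have U0 := @germ_refinable_eq0 R _ lam c0 cc dl lam_gt1 c_j0 dl_gt0 U _ m0 Ur.
have {}U0 : forall x, germ0 U x.
  apply: U0 => x xe; move: (Fg x) (nbhs_dnbhs (lt_nbhsl xe)).
  apply: filterS2 => y + ye; move: ye; rewrite lt_min => /andP[ye y1].
  rewrite (sum_tpow_small r e_gt0 A_uniq q_supp q_small ye).
  move=> /eqP; rewrite subr_eq0 => /eqP Fy; rewrite /U Fy /h.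
  rewrite (leads_tspline r Lc_leads); last by rewrite ltrD2l.
  have -> : d0 / (lam - 1) + y - d0 / (lam - 1) = y by rewrite addrAC subrr add0r.
  by rewrite mulrA /al divfK // subrr.
exists (al / ka).
have -> : (fun x => al / ka * conv_dilates lam phi k.-1 x) = (fun x => al * h x).
  apply/funext => x; rewrite phiE convE -r_rho tspline_scale -/Lc -/h.
  by field.
apply: (@germ_ae R (E ++ map fst Lc)).
- move=> x; have := near_sub_dnbhs (U0 (x - d0 / (lam - 1))).
  by apply: filterS => y; rewrite /U [_ + (y - _)]addrC subrK.
- by move=> y; rewrite mem_cat negb_or => /andP[yE _]; exact: fc.
- move=> y; rewrite mem_cat negb_or => /andP[_ yL].
  by apply: cvgM; [exact: cvg_cst|exact: tspline_cont].
Qed.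

End Generator.
End FinalMask.

Unset Implicit Arguments.
Set Strict Implicit.

Theorem theorem2p4 (R : realType) (N : nat) (lam : R)
    (c : 'I_N.+1 -> R) (d : 'I_N.+1 -> int) (f : R -> R)
    (lam_gt1 : 1 < lam)
    (d_incr : forall i j : 'I_N.+1, (i < j)%N -> d i < d j)
    (c_sum : \sum_(j < N.+1) c j = lam)
    (f_psmooth : piecewise_smooth f)
    (f_neq0 : ~ ae_eq_fun f (fun=> 0))
    (f_ref : fun_refinable lam c d f) :
  (exists2 s : R -> R, spline s & ae_eq_fun f s) /\
  (exists l : nat, (0 < l)%N /\ lam ^+ l \is a Num.int) /\
  (forall k : nat, (0 < k)%N -> lam ^+ k \is a Num.int ->
     (forall m : nat, (0 < m < k)%N -> lam ^+ m \isn't a Num.int) ->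
     let solution (Phi : (R -> R) -> R) :=
       [/\ compactly_supported_distribution Phi, nonzero_distribution Phi
         & dist_refinable (lam ^+ k) (fun j => c j * lam ^+ k.-1) d Phi] in
     (exists Phi, solution Phi) /\
     (forall Phi, solution Phi ->
        spline_distribution Phi /\
        (forall phi : R -> R, spline phi -> is_dist_of_fun phi Phi ->
           exists alpha : R,
             ae_eq_fun f (fun x => alpha * conv_dilates lam phi k.-1 x)))).
Proof.
have [i0 ci0] : exists i, c i != 0.
  apply: contrapT => NE; have : lam = 0.
    rewrite -c_sum big1 // => j _; apply/eqP/negPn/negP => cj.
    by apply: NE; exists j.
  by move=> l0; move: lam_gt1; rewrite l0 ltr10.
have [j0 cj0 jmin] := @arg_minnP _ i0 (fun j => c j != 0) (@nat_of_ord _) ci0.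
have c_lt (j : 'I_N.+1) : (j < j0)%N -> c j = 0.
  by move=> jj; apply/eqP; apply: contraTT jj => /jmin; rewrite -leqNgt.
have [r [C [e [q [A [E [[C0 e0 c0r uA] [qs qr qsm] fc Fr Fg]]]]]]] :=
  germs_of_refinable lam_gt1 d_incr cj0 c_lt f_psmooth f_neq0 f_ref.
split; [|split].
- pose L := comb_scale C (comb_of ((d j0)%:~R / (lam - 1)) A q).
  exists (tspline r L); first exact: tspline_spline.
  apply: (@germ_ae R (E ++ map fst L)).
  + move=> x; have := @near_sub_dnbhs R x ((d j0)%:~R / (lam - 1)) _ (Fg _).
    apply: filterS => y; rewrite [_ + (y - _)]addrC subrK => <-.
    rewrite tspline_scale tsplineE pairing_comb_of; congr (_ - _ * _).
    by apply: eq_bigr => a _; rewrite opprD addrA.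
  + by move=> y; rewrite mem_cat negb_or => /andP[yE _]; exact: fc.
  + by move=> y; rewrite mem_cat negb_or => /andP[_ yL]; exact: tspline_cont.
- exact: (int_power lam_gt1 d_incr c_sum cj0 c_lt e0 c0r qs qr qsm).
move=> k k0 kint kmin solution.
have [rho [L [rE Ll Lr Ls]]] := generator_exists lam_gt1 d_incr c_sum cj0 c_lt
  e0 c0r uA qs qr qsm k0 kint kmin.
split.
  exists (spline_dist rho L).
  exact: (generator_spline_dist lam_gt1 c0r k0 rE Ll Lr Ls).
move=> Phi sol; split.
  exact: (generator_spline_distribution lam_gt1 c_sum c0r k0 rE Ll Lr Ls sol).
move=> phi phis phiD.
exact: (convolution_factorization lam_gt1 d_incr c_sum cj0 c_lt e0 c0r uA qs qsm
  k0 rE Ll Lr Ls fc Fr Fg sol phis phiD).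
Qed.
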